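(* Let $a_1, a_2 \in \mathscr{A}$ and suppose that $h = a_1/a_2 \in H^{\infty}$. Then $$\mathfrak{M}(\overline{a_1}, \overline{a_2}) = \{\phi \in \mathscr{M}(\overline{a_2}): h \phi \in H^{\infty}\}.$$
   Context: Let $\mathbb{D}=\{|z|<1\}$, $\mathbb{T}=\partial\mathbb{D}$, let $\mathscr{O}(\mathbb{D})$ be the set of analytic functions on $\mathbb{D}$, $H^2$ the Hardy space of $\mathbb{D}$ (identified with a closed subspace of $L^2=L^2(\mathbb{T},d\theta/2\pi)$ via radial boundary values), and $H^\infty$ the bounded analytic functions on $\mathbb{D}$. For $a\in H^\infty$, the co-analytic Toeplitz operator $T_{\overline a}:H^2\to H^2$ is $T_{\overline a}f=P_+(\overline a f)$, where $P_+$ is the orthogonal projection of $L^2$ onto $H^2$. The range space of $T_{\overline a}$ is $\mathscr{M}(\overline a):=T_{\overline a}H^2$. For $a_1,a_2\in H^\infty$, the set of multipliers is $$\mathfrak{M}(\overline{a_1},\overline{a_2}):=\{\phi\in\mathscr{O}(\mathbb{D}):\ \forall f\in\mathscr{M}(\overline{a_1}),\ \phi f\in\mathscr{M}(\overline{a_2})\}.$$ $\mathscr{A}$ denotes the set of polynomials of the form $a(z)=\prod_{j=1}^{N}(z-\zeta_j)$ with $\zeta_j\in\mathbb{T}$ (not necessarily distinct), the case $N=0$ (empty product, $a=1$) being allowed. *)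

(* Defs.v *)
From HB Require Import structures.
From mathcomp Require Import all_boot all_order all_algebra.
From mathcomp Require Import complex.
From mathcomp Require Import all_classical all_reals all_analysis.

Set Implicit Arguments.
Unset Strict Implicit.
Unset Printing Implicit Defensive.

Import Order.TTheory GRing.Theory Num.Theory.
Import numFieldNormedType.Exports.
Import complex.ComplexField.Normc.

Local Open Scope classical_set_scope.
Local Open Scope complex_scope.
Local Open Scope ring_scope.

(* Functions on the disc or on the circle are total functions on the complex
   plane whose values elsewhere are never used.  In particular H2, Hinf,
   range_space and multipliers do not depend on values off the open disc. *)

(* R[i] packed as a numFieldType, the form from which MathComp-Analysis infers
   the norm topology. *)
Definition Cplx (R : realType) : numFieldType := R[i].

Definition unit_disc (R : realType) : set (Cplx R) := [set z | `|z| < 1].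

Definition expi (R : realType) (t : R) : Cplx R := cos t +i* sin t.

(* One period of the angle t parametrizing the unit circle. *)
Definition period (R : realType) : set R := `[0, 2 * pi].
Arguments period : clear implicits.

Definition analytic (R : realType) (f : Cplx R -> Cplx R) : Prop :=
  forall z, unit_disc z -> derivable f z 1.

Definition Hinf (R : realType) (f : Cplx R -> Cplx R) : Prop :=
  analytic f /\ exists M : R, forall z, unit_disc z -> `|f z| <= M%:C.

Definition circle_integral (R : realType) (u : Cplx R -> Cplx R) : Cplx R :=
  ((2 * pi)^-1 * \int[lebesgue_measure]_(t in period R)
       complex.Re (u (expi t)))
  +i*
  ((2 * pi)^-1 * \int[lebesgue_measure]_(t in period R)
       complex.Im (u (expi t))).

Definition sqnorm (R : realType) (u : Cplx R -> Cplx R) : \bar R :=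
  (((2 * pi)^-1)%:E *
   \int[lebesgue_measure]_(t in period R) (normc (u (expi t)) ^+ 2)%:E)%E.

Definition L2 (R : realType) (u : Cplx R -> Cplx R) : Prop :=
  [/\ measurable_fun (period R) (fun t : R => complex.Re (u (expi t))),
      measurable_fun (period R) (fun t : R => complex.Im (u (expi t)))
    & (sqnorm u < +oo)%E].

Definition inner (R : realType) (u v : Cplx R -> Cplx R) : Cplx R :=
  circle_integral (fun z => u z * conjc (v z)).

Definition H2 (R : realType) (f : Cplx R -> Cplx R) : Prop :=
  analytic f /\
  exists M : R, forall r : R, 0 <= r < 1 ->
    (sqnorm (fun z => f (r%:C * z)%R) <= M%:E)%E.

Definition boundary_value (R : realType) (f u : Cplx R -> Cplx R) : Prop :=
  L2 u /\
  {ae lebesgue_measure, forall t : R, period R t ->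
    (fun r : R => f (r%:C * expi t)) @ 1^'- --> u (expi t)}.

(* [orth_proj u g] says g = P_+ u: as an element of L^2 via its boundary values,
   g is the point of H^2 such that u - g is orthogonal to H^2. *)
Definition orth_proj (R : realType) (u g : Cplx R -> Cplx R) : Prop :=
  [/\ L2 u, H2 g &
    exists2 gb, boundary_value g gb &
      forall k kb, H2 k -> boundary_value k kb ->
        inner (fun z => u z - gb z) kb = 0].

(* [coToeplitz a f g] says that g is the image of f under the Toeplitz operator
   with symbol the complex conjugate of a. *)
Definition coToeplitz (R : realType) (a f g : Cplx R -> Cplx R) : Prop :=
  H2 f /\
  exists ab fb, [/\ boundary_value a ab, boundary_value f fb &
    orth_proj (fun z => conjc (ab z) * fb z) g].

Definition range_space (R : realType) (a : Cplx R -> Cplx R) :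
    set (Cplx R -> Cplx R) :=
  [set g | exists f, coToeplitz a f g].

Definition multipliers (R : realType) (a1 a2 : Cplx R -> Cplx R) :
    set (Cplx R -> Cplx R) :=
  [set phi | analytic phi /\
    forall f, range_space a1 f -> range_space a2 (fun z => phi z * f z)].

Definition circle_poly (R : realType) (a : {poly Cplx R}) : Prop :=
  exists2 s : seq (Cplx R), (forall zeta, zeta \in s -> `|zeta| = 1) &
    a = \prod_(zeta <- s) ('X - zeta%:P).

(* Main.v *)
(* For a = prod (X - zeta_j) with N unimodular roots, conj a = C conj z ^ N a on
   the circle, so the Toeplitz operator with symbol conj a is f |-> C S*^N (a f),
   S* the backward shift. Bezout and Euclidean division then give
   M(conj a) = a H^2 + polynomials (of degree < N, or arbitrary: it is the same).
   Since a1 / a2 is bounded, a1 = a2 H with H a polynomial.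
   If phi is a multiplier, then phi = phi 1 = a2 k0 + p0, and for f in H^2
   phi a1 f = a2 (H phi f) = a2 k1 + p. Hence p / a2 = H phi f - k1, which is
   O((1 - r)^(-1/2)) along the radii to the zeros of a2, because a1 kills the
   product k0 f there; so a2 divides p and H phi f is in H^2 for every f, i.e.
   H phi is a multiplier of H^2, hence bounded. Conversely, for f = a1 k + q and
   phi = a2 k0 + p0, phi f = a2 ((H phi) k + k0 q) + p0 q.
   No existence theorem for radial limits is needed: every function whose boundary
   values matter is an explicit combination of functions that are given with
   theirs, or a series of Szego kernels. *)

From HB Require Import structures.
Require Import Defs.
From mathcomp Require Import all_boot all_order all_algebra.
From mathcomp Require Import complex.
From mathcomp Require Import all_classical all_reals all_analysis.
From mathcomp Require Import measurable_realfun.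
From mathcomp Require Import ring lra.

Set Implicit Arguments.
Unset Strict Implicit.
Unset Printing Implicit Defensive.

Import Order.TTheory GRing.Theory Num.Theory.
Import numFieldNormedType.Exports.
Import complex.ComplexField.Normc.

Local Open Scope classical_set_scope.
Local Open Scope complex_scope.
Local Open Scope ring_scope.

(** * Norm and topology of the complex plane *)

Section ComplexPlane.
Context {R : realType}.
Implicit Types (z w : Cplx R) (f : Cplx R -> Cplx R).

(** Analyticity here means complex differentiability at each point of the disc, with no continuity
    of the derivative, and H^2 is defined by means over circles of radius r < 1. Both have to be
    tied to boundary functions by hand. Goursat's bisection in the coordinate log z gives mean
    values over circles and Cauchy's formula at radius r; letting r tend to 1 under a uniform L^2
    bound yields the reproducing formula. From it, the projection P_+ u is computed at z by pairing
    u with the Szego kernel, and |f(z)| = O((1 - |z|)^(-1/2)) follows. The exponent 1/2 is what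
    makes the divisibility argument work: k0 f is O(1 / (1 - r)) and the zero of a1 gives back a
    factor 1 - r, whereas a zero of a2 that p does not cancel would cost a full 1 / (1 - r). That a
    multiplier of H^2 is bounded is usually drawn from the closed graph theorem. Here it comes from
    a gliding hump: one explicit function of H^2, built with its boundary values, on which an
    unbounded multiplier violates the growth bound. *)

Lemma cnormE z : `|z| = (normc z)%:C.
Proof. by rewrite normc_def; case: z. Qed.

Lemma unit_discE z : unit_disc z <-> normc z < 1.
Proof. by rewrite /unit_disc /= cnormE -[1]/(1%:C) ltcR. Qed.

Lemma normc_ge0 z : 0 <= normc z.
Proof. by case: z => a b; rewrite /= sqrtr_ge0. Qed.

Lemma normcB z w : normc (z - w) = normc (w - z).
Proof. by rewrite -normcN opprB. Qed.

Lemma normc_eq0P z : normc z = 0 <-> z = 0.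
Proof. by split=> [/eq0_normc //|->]; exact: normc0. Qed.

Lemma normc_gt0P z : z != 0 -> 0 < normc z.
Proof.
move=> z0; rewrite lt_neqAle normc_ge0 andbT eq_sym; apply/eqP => /normc_eq0P.
exact/eqP.
Qed.

Lemma normcX z n : normc (z ^+ n) = normc z ^+ n.
Proof. by elim: n => [|n IH]; rewrite ?expr0 ?normc1// !exprS normcM IH. Qed.

Lemma normc_real (x : R) : normc (x%:C : Cplx R) = `|x|.
Proof. by rewrite /= expr0n addr0 sqrtr_sqr. Qed.

Lemma normcSq z : normc z ^+ 2 = complex.Re z ^+ 2 + complex.Im z ^+ 2.
Proof. by case: z => a b /=; rewrite sqr_sqrtr// addr_ge0// sqr_ge0. Qed.

Lemma Re_le_normc z : `|complex.Re z| <= normc z.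
Proof. by rewrite -lecR; have := normc_ge_Re z; rewrite cnormE. Qed.

Lemma Im_le_normc z : `|complex.Im z| <= normc z.
Proof.
case: z => a b /=; rewrite -sqrtr_sqr ler_sqrt ?lerDr ?sqr_ge0//.
by rewrite addr_ge0// sqr_ge0.
Qed.

Lemma normc_le_ReIm z : normc z <= `|complex.Re z| + `|complex.Im z|.
Proof.
rewrite -(@ler_pXn2r _ 2)// ?nnegrE ?normc_ge0 ?addr_ge0//.
by rewrite normcSq sqrrD !real_normK ?num_real// lerD2r lerDl mulrn_wge0// mulr_ge0.
Qed.

Lemma conjcM z w : conjc (z * w) = conjc z * conjc w.
Proof. exact: rmorphM. Qed.

Lemma conjcB z w : conjc (z - w) = conjc z - conjc w.
Proof. exact: rmorphB. Qed.

Lemma conjcD z w : conjc (z + w) = conjc z + conjc w.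
Proof. exact: rmorphD. Qed.

Lemma conjcV z : conjc z^-1 = (conjc z)^-1.
Proof. exact: conjc_inv. Qed.

Lemma conjcN z : conjc (- z) = - conjc z.
Proof. exact: rmorphN. Qed.

Lemma conjcX z n : conjc (z ^+ n) = conjc z ^+ n.
Proof. exact: rmorphXn. Qed.

Lemma conjc_one : conjc 1 = 1 :> Cplx R.
Proof. exact: rmorph1. Qed.

Lemma normc_conj z : normc (conjc z) = normc z.
Proof. by case: z => a b /=; rewrite sqrrN. Qed.

Lemma mulc_conj z : z * conjc z = (normc z ^+ 2)%:C.
Proof.
by rewrite normcSq; case: z => a b /=; apply/eqP; rewrite eq_complex/=; apply/andP;split;apply/eqP; ring.
Qed.

Lemma normc_sub_le z w : normc z - normc w <= normc (z - w).
Proof. by rewrite lerBlDr; have := le_normcD (z - w) w; rewrite subrK. Qed.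

Lemma nbhs_cplxP z (P : set (Cplx R)) :
  nbhs z P <-> exists2 d : R, 0 < d & forall w, normc (w - z) < d -> P w.
Proof.
split=> [/nbhs_ballP[e /= e0 eP]|[d d0 dP]].
  have [e' ee'] : exists e', e = e'%:C.
    by move: e0; case: e {eP} => a b; rewrite ltcE/= => /andP[/eqP -> _]; exists a.
  rewrite ee' in e0 eP; exists e' => [|w wz]; first by move: e0; rewrite -[0]/(0%:C) ltcR.
  by apply: eP; rewrite /ball/= cnormE ltcR normcB.
apply/nbhs_ballP; exists d%:C; first by rewrite /= -[0]/(0%:C) ltcR.
by move=> w; rewrite /ball/= cnormE ltcR normcB; exact: dP.
Qed.

Lemma cvg_cplxP (T : Type) (F : set_system T) {FF : Filter F} (f : T -> Cplx R) (l : Cplx R) :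
  f @ F --> l <-> forall e : R, 0 < e -> \forall x \near F, normc (f x - l) < e.
Proof.
split=> [fl e e0|H P /nbhs_cplxP[d d0 dP]].
  by apply: (fl (fun w => normc (w - l) < e)); apply/nbhs_cplxP; exists e.
by apply: filterS (H d d0) => x; exact: dP.
Qed.

Lemma radial_cvgP (f : R -> Cplx R) (l : Cplx R) :
  f @ 1^'- --> l <-> forall e : R, 0 < e ->
    exists2 d, 0 < d & forall r, 1 - d < r < 1 -> normc (f r - l) < e.
Proof.
rewrite cvg_cplxP; split => H e /H.
  rewrite /at_left near_withinE => -[d /= d0 dP]; exists d => // r /andP[r1 r2].
  by apply: dP => //=; rewrite ger0_norm ?subr_ge0 ?ltW//; lra.
move=> [d d0 dP]; exists d => //= r /=; rewrite ltr_norml => /andP[_ r1] r2.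
by apply: dP; rewrite r2 andbT; lra.
Qed.

(** Differentiability as a linear approximation, without a quotient: this form splits into real
    coordinates for Goursat's argument and is the one verified for sums of series. *)
Definition cdiff f z := exists L : Cplx R, forall e : R, 0 < e ->
  exists2 d, 0 < d & forall w, normc (w - z) < d ->
    normc (f w - f z - L * (w - z)) <= e * normc (w - z).

Lemma derivable_cdiff f z : derivable f z 1 <-> cdiff f z.
Proof.
split.
  move=> /(cvg_ex _)[L /= /cvg_cplxP H]; exists L => e /H.
  rewrite near_withinE => /nbhs_cplxP[d d0 dP]; exists d => // w wz.
  have [->|wNz] := eqVneq w z; first by rewrite !subrr mulr0 subr0 normc0 mulr0.
  have wz0 : w - z != 0 by rewrite subr_eq0.
  have := dP (w - z); rewrite subr0 => /(_ wz wz0); rewrite scaler1 subrK.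
  move=> /ltW; rewrite -(ler_pM2r (normc_gt0P wz0)) -normcM.
  congr (normc _ <= _); rewrite -[_ *: _]/(_ * _); field.
  exact: wz0.
move=> [L H]; apply/cvg_ex; exists L => /=; apply/cvg_cplxP => e e0.
have [d d0 dP] := H (e / 2) (divr_gt0 e0 (ltr0n _ 2)).
rewrite near_withinE; apply/nbhs_cplxP; exists d => // h; rewrite subr0 => hd h0.
have := dP (h + z); rewrite addrK => /(_ hd) hle.
rewrite -(ltr_pM2r (normc_gt0P h0)) -normcM scaler1.
suff -> : (h^-1 *: (f (h + z) - f z) - L) * h = f (h + z) - f z - L * h.
  apply: le_lt_trans hle _.
  by rewrite ltr_pM2r ?normc_gt0P// ltr_pdivrMr// ltr_pMr// ltr1n.
by rewrite -[_ *: _]/(_ * _); field.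
Qed.

Definition ccont f z := forall e : R, 0 < e ->
  exists2 d, 0 < d & forall w, normc (w - z) < d -> normc (f w - f z) < e.

Lemma cdiff_ccont f z : cdiff f z -> ccont f z.
Proof.
move=> [L H] e e0; have [d d0 dP] := H 1 ltr01.
have L1 : 0 < 1 + normc L by rewrite ltr_pwDl// normc_ge0.
exists (Num.min d (e / (1 + normc L))); first by rewrite lt_min d0 divr_gt0.
move=> w; rewrite lt_min ltr_pdivlMr// => /andP[/dP h1 h2].
apply: le_lt_trans h2; rewrite mulrDr mulr1.
have := le_normcD (f w - f z - L * (w - z)) (L * (w - z)).
by rewrite subrK normcM; lra.
Qed.

End ComplexPlane.

(** * Linear combinations of integrable real functions *)

Section RealIntegrable.
Context {d : measure_display} {T : measurableType d} {R : realType}.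
Variable mu : {measure set T -> \bar R}.
Implicit Types (D : set T) (f g : T -> R).

Lemma integrable_addR D f g : measurable D ->
  mu.-integrable D (EFin \o f) -> mu.-integrable D (EFin \o g) ->
  mu.-integrable D (EFin \o (fun x => f x + g x)).
Proof. by move=> mD fi gi; have := integrableD mD fi gi. Qed.

Lemma integrable_subR D f g : measurable D ->
  mu.-integrable D (EFin \o f) -> mu.-integrable D (EFin \o g) ->
  mu.-integrable D (EFin \o (fun x => f x - g x)).
Proof. by move=> mD fi gi; have := integrableB mD fi gi. Qed.

Lemma integrable_scaleR D f (k : R) : measurable D ->
  mu.-integrable D (EFin \o f) -> mu.-integrable D (EFin \o (fun x => k * f x)).
Proof. by move=> mD fi; have := integrableZl mD k fi. Qed.

End RealIntegrable.

(** * Goursat's theorem for closed forms in a rectangle *)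

Section IntervalIntegral.
Context {R : realType}.
Notation mu := (@lebesgue_measure R).
Implicit Types (a b c d e k s t : R) (g : R -> R).

Lemma continuous_itv_integrable a b g :
  (forall x, a <= x <= b -> {for x, continuous g}) ->
  mu.-integrable `[a, b] (EFin \o g).
Proof.
move=> cg; apply: continuous_compact_integrable; first exact: segment_compact.
apply: continuous_in_subspaceT => x; rewrite inE /= in_itv /=; exact: cg.
Qed.

Lemma Rintegral_itv_split a b c g : a <= c -> c <= b ->
  mu.-integrable `[a, b] (EFin \o g) ->
  \int[mu]_(t in `[a, b]) g t =
    \int[mu]_(t in `[a, c]) g t + \int[mu]_(t in `[c, b]) g t.
Proof.
move=> ac cb ig.
have icb : mu.-integrable `]c, b] (EFin \o g).
  apply: integrableS ig => // x /=.
  by rewrite !in_itv/= => /andP[/ltW cx ->]; rewrite (le_trans ac cx).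
by rewrite -(Rintegral_itv_obnd_cbnd icb) -(Rintegral_itvB ig)//= addrC subrK.
Qed.

Lemma Rintegral_itv_cst a b k : a <= b -> \int[mu]_(t in `[a, b]) k = k * (b - a).
Proof.
move=> ab; rewrite Rintegral_cst//=. rewrite lebesgue_measure_itv/= lte_fin.
by case: ltgtP ab => //= -> _; rewrite subrr.
Qed.

Lemma Rintegral_itv_close a b g k e : a <= b ->
  mu.-integrable `[a, b] (EFin \o g) ->
  (forall t, a <= t <= b -> `|g t - k| <= e) ->
  `|\int[mu]_(t in `[a, b]) g t - k * (b - a)| <= e * (b - a).
Proof.
move=> ab ig gk.
have ic x : mu.-integrable `[a, b] (EFin \o cst x).
  by apply: continuous_itv_integrable => y _; exact: cst_continuous.
have igk : mu.-integrable `[a, b] (EFin \o (fun t => g t - k)).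
  by apply: integrable_subR; [exact: measurable_itv|exact: ig|exact: ic].
rewrite -(Rintegral_itv_cst k ab) -(Rintegral_itv_cst e ab).
rewrite -(RintegralB _ ig (ic k))//.
apply: le_trans (le_normr_Rintegral _ igk) _ => //.
apply: le_Rintegral (integrable_norm igk) (ic e) _ => //.
Qed.

End IntervalIntegral.

Section Goursat.
Context {R : realType}.
Notation mu := (@lebesgue_measure R).
Variables P Q : R -> R -> R.

(** Differentiability of the form P ds + Q dt at one point. The coefficient [B] is shared by both
    expansions: this is the closedness condition dP/dt = dQ/ds. *)
Definition closed_form_at (s t : R) := exists A B E : R, forall e, 0 < e ->
  exists2 d, 0 < d & forall s' t', `|s' - s| < d -> `|t' - t| < d ->
    `|P s' t' - P s t - (A * (s' - s) + B * (t' - t))|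
      <= e * (`|s' - s| + `|t' - t|) /\
    `|Q s' t' - Q s t - (B * (s' - s) + E * (t' - t))|
      <= e * (`|s' - s| + `|t' - t|).

Lemma lin_approx_continuous (g : R -> R) (x A : R) :
  (forall e, 0 < e -> exists2 d, 0 < d & forall y, `|y - x| < d ->
     `|g y - g x - A * (y - x)| <= e * `|y - x|) -> {for x, continuous g}.
Proof.
move=> H; apply/cvgrPdist_lt => e e0; have [d d0 dP] := H 1 ltr01.
have A1 : 0 < 1 + `|A| by rewrite ltr_pwDl.
apply/nbhs_ballP; exists (Num.min d (e / (1 + `|A|))).
  by rewrite /= lt_min d0 divr_gt0.
move=> y; rewrite /ball/= lt_min => /andP[].
rewrite distrC => /dP h1; rewrite ltr_pdivlMr// => h2; rewrite distrC.
have := ler_normD (g y - g x - A * (y - x)) (A * (y - x)).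
by rewrite subrK normrM; lra.
Qed.

Lemma closed_form_continuousP s t :
  closed_form_at s t -> {for s, continuous (P^~ t)}.
Proof.
move=> [A [B [E H]]]; apply: (@lin_approx_continuous _ _ A) => e /H[d d0 dP].
exists d => // y /(dP y t); rewrite subrr normr0 !mulr0 !addr0 => /(_ d0)[].
by [].
Qed.

Lemma closed_form_continuousQ s t :
  closed_form_at s t -> {for t, continuous (Q s)}.
Proof.
move=> [A [B [E H]]]; apply: (@lin_approx_continuous _ _ E) => e /H[d d0 dP].
exists d => // y; have := dP s y; rewrite subrr normr0 !mulr0 !add0r.
by move=> /(_ d0) h /h[].
Qed.

(** The counterclockwise boundary integral of P ds + Q dt over the rectangle [a, a + h] x
    [c, c + k], opposite sides being paired. *)
Definition circulation (a h c k : R) :=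
  \int[mu]_(t in `[c, c + k]) (Q (a + h) t - Q a t)
  - \int[mu]_(s in `[a, a + h]) (P s (c + k) - P s c).

Definition closed_on (a h c k : R) := forall s t,
  a <= s <= a + h -> c <= t <= c + k -> closed_form_at s t.

Lemma closed_onS a h c k a' h' c' k' : closed_on a h c k ->
  a <= a' -> a' + h' <= a + h -> c <= c' -> c' + k' <= c + k ->
  closed_on a' h' c' k'.
Proof. by move=> H ? ? ? ? s t ? ?; apply: H; lra. Qed.

Lemma closed_on_intP a h c k t : closed_on a h c k -> c <= t <= c + k ->
  mu.-integrable `[a, a + h] (EFin \o P^~ t).
Proof.
move=> H ct; apply: continuous_itv_integrable => s /H/(_ ct).
exact: closed_form_continuousP.
Qed.

Lemma closed_on_intQ a h c k s : closed_on a h c k -> a <= s <= a + h ->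
  mu.-integrable `[c, c + k] (EFin \o Q s).
Proof.
move=> H cs; apply: continuous_itv_integrable => t /(H _ _ cs).
exact: closed_form_continuousQ.
Qed.

Lemma circulation_split_s a h c k : 0 <= h -> 0 <= k -> closed_on a (h + h) c k ->
  circulation a (h + h) c k = circulation a h c k + circulation (a + h) h c k.
Proof.
move=> h0 k0 H; rewrite /circulation addrA.
have iQ s : a <= s <= a + (h + h) -> mu.-integrable `[c, c + k] (EFin \o Q s).
  exact: closed_on_intQ H.
have iP t : c <= t <= c + k -> mu.-integrable `[a, a + (h + h)] (EFin \o P^~ t).
  exact: closed_on_intP H.
rewrite (@Rintegral_itv_split _ a (a + h + h) (a + h)); [|lra|lra|]; last first.
  rewrite -addrA; apply: integrable_subR => //; apply: iP; lra.
have QB s1 s2 : a <= s1 <= a + (h + h) -> a <= s2 <= a + (h + h) ->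
    \int[mu]_(t in `[c, c + k]) (Q s1 t - Q s2 t) =
    \int[mu]_(t in `[c, c + k]) Q s1 t - \int[mu]_(t in `[c, c + k]) Q s2 t.
  by move=> ? ?; rewrite RintegralB//; exact: iQ.
by rewrite !QB; lra.
Qed.

Lemma circulation_split_t a h c k : 0 <= h -> 0 <= k -> closed_on a h c (k + k) ->
  circulation a h c (k + k) = circulation a h c k + circulation a h (c + k) k.
Proof.
move=> h0 k0 H; rewrite /circulation addrA.
have iQ s : a <= s <= a + h -> mu.-integrable `[c, c + (k + k)] (EFin \o Q s).
  exact: closed_on_intQ H.
have iP t : c <= t <= c + (k + k) -> mu.-integrable `[a, a + h] (EFin \o P^~ t).
  exact: closed_on_intP H.
rewrite (@Rintegral_itv_split _ c (c + k + k) (c + k)); [|lra|lra|]; last first.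
  rewrite -addrA; apply: integrable_subR => //; apply: iQ; lra.
have PB t1 t2 : c <= t1 <= c + (k + k) -> c <= t2 <= c + (k + k) ->
    \int[mu]_(s in `[a, a + h]) (P s t1 - P s t2) =
    \int[mu]_(s in `[a, a + h]) P s t1 - \int[mu]_(s in `[a, a + h]) P s t2.
  by move=> ? ?; rewrite RintegralB//; exact: iP.
by rewrite !PB; lra.
Qed.

(** Both integrals have the main part B h k, because [B] is shared, and these cancel. What remains
    is an error of at most 2 e (h + k) under each integral, over lengths k and h. *)
Lemma circulation_small a h c k s t e d A B E : 0 <= h -> 0 <= k ->
  closed_on a h c k -> a <= s <= a + h -> c <= t <= c + k ->
  h < d -> k < d -> 0 < e ->
  (forall s' t', `|s' - s| < d -> `|t' - t| < d ->
    `|P s' t' - P s t - (A * (s' - s) + B * (t' - t))|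
      <= e * (`|s' - s| + `|t' - t|) /\
    `|Q s' t' - Q s t - (B * (s' - s) + E * (t' - t))|
      <= e * (`|s' - s| + `|t' - t|)) ->
  `|circulation a h c k| <= 2 * e * (h + k) ^+ 2.
Proof.
move=> h0 k0 cl /andP[as1 as2] /andP[ct1 ct2] hd kd e0 H.
have bnd x y x' y' : `|x - y| <= e * x' -> x' <= y' -> `|x - y| <= e * y'.
  by move=> h1 h2; apply: le_trans h1 _; rewrite ler_pM2l.
have near s' t' : a <= s' <= a + h -> c <= t' <= c + k ->
   `|s' - s| + `|t' - t| <= h + k /\ (`|s' - s| < d /\ `|t' - t| < d).
  move=> /andP[? ?] /andP[? ?].
  have ? : `|s' - s| <= h by rewrite ler_norml; lra.
  have ? : `|t' - t| <= k by rewrite ler_norml; lra.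
  by lra.
have iQ s' : a <= s' <= a + h -> mu.-integrable `[c, c + k] (EFin \o Q s').
  exact: closed_on_intQ cl.
have iP t' : c <= t' <= c + k -> mu.-integrable `[a, a + h] (EFin \o P^~ t').
  exact: closed_on_intP cl.
have JQ : `|\int[mu]_(t in `[c, c + k]) (Q (a + h) t - Q a t) - B * h * (c + k - c)|
    <= 2 * e * (h + k) * (c + k - c).
  apply: Rintegral_itv_close; first lra.
    by apply: integrable_subR => //; apply: iQ; lra.
  move=> t' ht'.
  have [n1 [m1 l1]] := near (a + h) t' ltac:(lra) ht'.
  have [n2 [m2 l2]] := near a t' ltac:(lra) ht'.
  have [_ /bnd/(_ n1) b1] := H _ _ m1 l1.
  have [_ /bnd/(_ n2) b2] := H _ _ m2 l2.
  by move: b1 b2; rewrite !ler_norml; lra.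
have JP : `|\int[mu]_(s in `[a, a + h]) (P s (c + k) - P s c) - B * k * (a + h - a)|
    <= 2 * e * (h + k) * (a + h - a).
  apply: Rintegral_itv_close; first lra.
    by apply: integrable_subR => //; apply: iP; lra.
  move=> s' hs'.
  have [n1 [m1 l1]] := near s' (c + k) hs' ltac:(lra).
  have [n2 [m2 l2]] := near s' c hs' ltac:(lra).
  have [/bnd/(_ n1) b1 _] := H _ _ m1 l1.
  have [/bnd/(_ n2) b2 _] := H _ _ m2 l2.
  by move: b1 b2; rewrite !ler_norml; lra.
move: JQ JP; rewrite /circulation !ler_norml.
set X := Rintegral _ _ _; set Y := Rintegral _ _ _; rewrite !(addrC _ (- c)) !(addrC _ (- a)) !addrA !addNr !add0r.
have -> : 2 * e * (h + k) ^+ 2 = 2 * e * (h + k) * k + 2 * e * (h + k) * h by ring.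
have -> : B * k * h = B * h * k by ring.
by move=> /andP[? ?] /andP[? ?]; apply/andP; split; lra.
Qed.

(* Goursat's bisection, for a 1-form [P ds + Q dt] that is differentiable with
   [dQ/ds = dP/dt] at every point, without continuity of these derivatives. *)
Lemma circulation_eq0 a h c k : 0 < h -> 0 < k -> closed_on a h c k ->
  circulation a h c k = 0.
Proof.
move=> h0 k0 cl; apply: contrapT => /eqP J0.
pose hn n : R := h / 2 ^+ n; pose kn n : R := k / 2 ^+ n.
have hnS n : hn n = hn n.+1 + hn n.+1.
  by rewrite /hn exprS; field; rewrite expf_neq0//.
have knS n : kn n = kn n.+1 + kn n.+1.
  by rewrite /kn exprS; field; rewrite expf_neq0//.
have hn0 n : 0 < hn n by rewrite divr_gt0// exprn_gt0.
have kn0 n : 0 < kn n by rewrite divr_gt0// exprn_gt0.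
(* A rectangle of generation n is kept if it carries at least its share 4^(-n) of the
   circulation. *)
pose good n (x : R * R) := closed_on x.1 (hn n) x.2 (kn n) /\
  `|circulation a h c k| <= 4 ^+ n * `|circulation x.1 (hn n) x.2 (kn n)|.
pose inside n (x y : R * R) := (x.1 <= y.1 <= x.1 + hn n.+1) /\
  (x.2 <= y.2 <= x.2 + kn n.+1).
have step (nx : nat * (R * R)) : exists y, good nx.1 nx.2 ->
    good nx.1.+1 y /\ inside nx.1 nx.2 y.
  case: nx => n [s t] /=; case: (pselect (good n (s, t))) => [[/= cln gn]|ng]; last first.
    by exists (s, t).
  have := hn0 n.+1; have := kn0 n.+1; move: (cln); rewrite (hnS n) (knS n).
  set H := hn n.+1; set K := kn n.+1 => cln' K0 H0.
  have : circulation s (hn n) t (kn n) =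
     circulation s H t K + circulation s H (t + K) K +
     (circulation (s + H) H t K + circulation (s + H) H (t + K) K).
    have cl1 : closed_on s H t (K + K) by apply: closed_onS cln' _ _ _ _; lra.
    have cl2 : closed_on (s + H) H t (K + K) by apply: closed_onS cln' _ _ _ _; lra.
    rewrite (hnS n) (knS n) -/H -/K.
    rewrite (circulation_split_s (ltW H0) (addr_ge0 (ltW K0) (ltW K0)) cln').
    by rewrite !(circulation_split_t (ltW H0) (ltW K0)).
  move=> E; have : [\/ (`|circulation a h c k| <= 4 ^+ n.+1 * `|circulation s H t K|),
      (`|circulation a h c k| <= 4 ^+ n.+1 * `|circulation s H (t + K) K|),
      (`|circulation a h c k| <= 4 ^+ n.+1 * `|circulation (s + H) H t K|) |
      (`|circulation a h c k| <= 4 ^+ n.+1 * `|circulation (s + H) H (t + K) K|)].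
    have [?|l1] := leP `|circulation a h c k| (4 ^+ n.+1 * `|circulation s H t K|).
      by apply: Or41.
    have [?|l2] := leP `|circulation a h c k| (4 ^+ n.+1 * `|circulation s H (t + K) K|).
      by apply: Or42.
    have [?|l3] := leP `|circulation a h c k| (4 ^+ n.+1 * `|circulation (s + H) H t K|).
      by apply: Or43.
    have [?|l4] := leP `|circulation a h c k| (4 ^+ n.+1 * `|circulation (s + H) H (t + K) K|).
      by apply: Or44.
    (* If all four quarters fell short of their share, their sum would contradict [gn]. *)
    exfalso; move: gn; rewrite /= E; apply/negP; rewrite -ltNge.
    set c1 := circulation s H t K in l1 *; set c2 := circulation s H _ K in l2 *.
    set c3 := circulation _ H t K in l3 *; set c4 := circulation _ H _ K in l4 *.
    have n4 : `|c1 + c2 + (c3 + c4)| <= `|c1| + `|c2| + (`|c3| + `|c4|).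
      by apply: le_trans (ler_normD _ _) _; apply: lerD; exact: ler_normD.
    apply: (@le_lt_trans _ _ (4 ^+ n * (`|c1| + `|c2| + (`|c3| + `|c4|)))).
      by rewrite ler_pM2l// exprn_gt0.
    by move: l1 l2 l3 l4; rewrite exprS -!mulrA; lra.
  move=> {E gn cl h0 k0 hnS knS hn0 kn0 J0}; case=> g; [exists (s, t)|exists (s, t + K)|exists (s + H, t)|exists (s + H, t + K)] => _;
  (split; [split => //=; apply: (closed_onS (h' := H) (k' := K) cln'); lra|rewrite /inside/= -/H -/K; lra]).
have [f fP] := choice step.
pose x := fix x n := if n is m.+1 then f (m, x m) else (a, c).
have xg n : good n (x n).
  elim: n => [|n IH]; first by rewrite /good /hn /kn !expr0 !divr1 mul1r.
  by have [] := fP (n, x n) IH.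
have xin n : inside n (x n) (x n.+1) by have [] := fP (n, x n) (xg n).
have mono (u v : nat -> R) : (forall n, u n <= u n.+1) -> (forall n, v n.+1 <= v n) ->
    (forall n, u n <= v n) -> exists l, forall n, u n <= l <= v n.
  move=> ui vd uv; have uv' n m : u n <= v m.
    have [nm|mn] := leqP n m.
      by apply: le_trans (uv m); exact: (homo_leq (@lexx _ _) (fun y x z => @le_trans _ _ y x z) ui).
    apply: le_trans (uv n) _.
    by apply: (homo_leq (r := fun x y => y <= x) (@lexx _ _) _ vd (ltnW mn)) => y x' z; exact: ge_trans.
  exists (sup (range u)) => n; apply/andP; split.
    by apply: ub_le_sup; [exists (v 0) => _ [m _ <-]|exists n].
  by apply: ge_sup; [exists (u 0); exists 0|move=> _ [m _ <-]].
have [s sP] := mono (fun n => (x n).1) (fun n => (x n).1 + hn n)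
  (fun n => ltac:(by have [/andP[]] := xin n))
  (fun n => ltac:(have [/andP[? ?] _] := xin n; rewrite [in leRHS]hnS; lra))
  (fun n => ltac:(by rewrite lerDl ltW)).
have [t tP] := mono (fun n => (x n).2) (fun n => (x n).2 + kn n)
  (fun n => ltac:(by have [_ /andP[]] := xin n))
  (fun n => ltac:(have [_ /andP[? ?]] := xin n; rewrite [in leRHS]knS; lra))
  (fun n => ltac:(by rewrite lerDl ltW)).
have [A [B [E AB]]] : closed_form_at s t.
  by apply: cl; [have := sP 0|have := tP 0]; rewrite /= /hn /kn expr0 divr1.
have hk0 : 0 < h + k by rewrite addr_gt0.
have Jp : 0 < `|circulation a h c k| by rewrite normr_gt0.
(* On the n-th rectangle the powers of 4 cancel, and this [e] makes the bound 2 e (h + k)^2 exactly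
   half of the circulation that it should dominate. *)
pose e := `|circulation a h c k| / (4 * (h + k) ^+ 2).
have e0 : 0 < e by rewrite divr_gt0// mulr_gt0// exprn_gt0.
have [d d0 dP] := AB e e0.
have [n hkn] : exists n, (h + k) / 2 ^+ n < d.
  exists (Num.bound ((h + k) / d)); rewrite ltr_pdivrMr ?exprn_gt0// mulrC -ltr_pdivrMr//.
  exact: upper_nthrootP.
have [hd kd] : hn n < d /\ kn n < d.
  have := hn0 n; have := kn0 n; move: hkn; rewrite mulrDl -/(hn n) -/(kn n); lra.
have [cln gn] := xg n.
have := circulation_small (ltW (hn0 n)) (ltW (kn0 n)) cln (sP n) (tP n) hd kd e0 dP.
move=> sm; have : `|circulation a h c k| <= 4 ^+ n * (2 * e * (hn n + kn n) ^+ 2).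
  by apply: le_trans gn _; rewrite ler_pM2l// exprn_gt0.
have -> : 4 ^+ n * (2 * e * (hn n + kn n) ^+ 2) = `|circulation a h c k| / 2.
  rewrite /hn /kn /e -mulrDl exprMn exprVn -exprM mulnC exprM.
  have -> : (2 ^+ 2 : R) = 4 by ring.
  by field; rewrite expf_neq0//= lt0r_neq0.
by lra.
Qed.

End Goursat.

(** * Integrals over the circle *)

Section CircleIntegral.
Context {R : realType}.
Notation mu := (@lebesgue_measure R).
Implicit Types (u v : Cplx R -> Cplx R) (z w : Cplx R).

Lemma expiD (s t : R) : expi (s + t) = expi s * expi t :> Cplx R.
Proof. by apply/eqP; rewrite eq_complex/= cosD sinD; apply/andP; split; apply/eqP; ring. Qed.

Lemma expi0 : expi 0 = 1 :> Cplx R.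
Proof. by rewrite /expi cos0 sin0. Qed.

Lemma expi2pi : expi (2 * pi) = 1 :> Cplx R.
Proof. by rewrite /expi mulrC mulr_natr cos2pi sin2pi. Qed.

Lemma normc_expi (t : R) : normc (expi t) = 1.
Proof. by rewrite /= cos2Dsin2 sqrtr1. Qed.

Lemma expi_neq0 (t : R) : expi t != 0 :> Cplx R.
Proof. by apply/eqP => /normc_eq0P; rewrite normc_expi => /eqP; rewrite oner_eq0. Qed.

Lemma conjc_expi (t : R) : conjc (expi t) = (expi t)^-1 :> Cplx R.
Proof.
apply: (mulfI (expi_neq0 t)); rewrite mulfV ?expi_neq0// mulc_conj normc_expi.
by rewrite expr1n.
Qed.

Lemma twopi_gt0 : 0 < 2 * pi :> R.
Proof. by rewrite mulr_gt0// pi_gt0. Qed.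

Lemma measurable_period :
  @measurable _ (g_sigma_algebraType (R.-ocitv.-measurable)) (period R).
Proof. exact: measurable_itv. Qed.

Lemma measure_period : mu (period R) = (2 * pi)%:E.
Proof. by rewrite lebesgue_measure_itv/= lte_fin twopi_gt0 oppr0 adde0. Qed.

Definition circle_integrable u :=
  mu.-integrable (period R) (EFin \o (fun t => complex.Re (u (expi t)))) /\
  mu.-integrable (period R) (EFin \o (fun t => complex.Im (u (expi t)))).

Lemma circle_integral_eq u v : (forall t, period R t -> u (expi t) = v (expi t)) ->
  circle_integral u = circle_integral v.
Proof.
by move=> uv; congr (_ * _ +i* (_ * _)); apply: eq_Rintegral => t; rewrite inE => /uv ->.
Qed.

Lemma circle_integrable_eq u v : (forall t, u (expi t) = v (expi t)) ->
  circle_integrable u -> circle_integrable v.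
Proof.
by move=> uv [h1 h2]; split; [move: h1|move: h2]; congr (_.-integrable _ _);
  apply/funext => t /=; rewrite uv.
Qed.

Lemma circle_integrableD u v : circle_integrable u -> circle_integrable v ->
  circle_integrable (fun z => u z + v z).
Proof.
move=> [u1 u2] [v1 v2]; split.
  have := integrable_addR measurable_period u1 v1; congr (_.-integrable _ _).
  by apply/funext => t /=; case: (u _) => ? ?; case: (v _).
have := integrable_addR measurable_period u2 v2; congr (_.-integrable _ _).
by apply/funext => t /=; case: (u _) => ? ?; case: (v _).
Qed.

Lemma circle_integrableZ (k : Cplx R) u : circle_integrable u ->
  circle_integrable (fun z => k * u z).
Proof.
case: k => a b [u1 u2]; split.
  have := integrable_subR measurable_period (integrable_scaleR a measurable_period u1) (integrable_scaleR b measurable_period u2).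
  by congr (_.-integrable _ _); apply/funext => t /=; case: (u _) => ? ?.
have := integrable_addR measurable_period (integrable_scaleR a measurable_period u2) (integrable_scaleR b measurable_period u1).
by congr (_.-integrable _ _); apply/funext => t /=; case: (u _) => ? ?.
Qed.

Lemma circle_integralD u v : circle_integrable u -> circle_integrable v ->
  circle_integral (fun z => u z + v z) = circle_integral u + circle_integral v.
Proof.
move=> [u1 u2] [v1 v2]; apply/eqP; rewrite eq_complex/= -!mulrDr; apply/andP; split.
  rewrite -(RintegralD measurable_period u1 v1); apply/eqP; congr (_ * _).
  by apply: eq_Rintegral => t _; case: (u _) => ? ?; case: (v _).
rewrite -(RintegralD measurable_period u2 v2); apply/eqP; congr (_ * _).
by apply: eq_Rintegral => t _; case: (u _) => ? ?; case: (v _).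
Qed.

Lemma circle_integralZ (k : Cplx R) u : circle_integrable u ->
  circle_integral (fun z => k * u z) = k * circle_integral u.
Proof.
case: k => a b [u1 u2]; apply/eqP; rewrite eq_complex/=.
have ia r := integrable_scaleR r measurable_period u1.
have ib r := integrable_scaleR r measurable_period u2.
apply/andP; split.
  under eq_Rintegral.
    move=> t _; rewrite (_ : complex.Re _ = a * complex.Re (u (expi t)) - b * complex.Im (u (expi t))); last by case: (u _).
    over.
  rewrite (RintegralB measurable_period (ia a) (ib b)).
  by rewrite (RintegralZl _ measurable_period u1) (RintegralZl _ measurable_period u2); apply/eqP; ring.
under eq_Rintegral.
  move=> t _; rewrite (_ : complex.Im _ = a * complex.Im (u (expi t)) + b * complex.Re (u (expi t))); last by case: (u _).
  over.
rewrite (RintegralD measurable_period (ib a) (ia b)).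
by rewrite (RintegralZl _ measurable_period u1) (RintegralZl _ measurable_period u2); apply/eqP; ring.
Qed.

Lemma circle_integralB u v : circle_integrable u -> circle_integrable v ->
  circle_integral (fun z => u z - v z) = circle_integral u - circle_integral v.
Proof.
move=> iu iv; rewrite -mulN1r -circle_integralZ// -circle_integralD//.
  by apply: circle_integral_eq => t _; rewrite mulN1r.
exact: circle_integrableZ.
Qed.

Lemma circle_integrable_conj u : circle_integrable u ->
  circle_integrable (fun z => conjc (u z)).
Proof.
move=> [u1 u2]; split.
  by move: u1; congr (_.-integrable _ _); apply/funext => t /=; case: (u _).
have := integrable_scaleR (-1) measurable_period u2; congr (_.-integrable _ _).
by apply/funext => t /=; case: (u _) => ? ?; rewrite /= mulN1r.
Qed.

Lemma circle_integral_conj u : circle_integrable u ->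
  circle_integral (fun z => conjc (u z)) = conjc (circle_integral u).
Proof.
move=> [u1 u2]; apply/eqP; rewrite eq_complex/=; apply/andP; split.
  by apply/eqP; congr (_ * _); apply: eq_Rintegral => t _; case: (u _).
rewrite -mulrN -mulN1r -(RintegralZl _ measurable_period u2); apply/eqP; congr (_ * _).
by apply: eq_Rintegral => t _; rewrite mulN1r; case: (u _).
Qed.

Lemma circle_integral_cst (k : Cplx R) : circle_integral (fun=> k) = k.
Proof.
rewrite /circle_integral !Rintegral_itv_cst ?ltW ?twopi_gt0// subr0.
case: k => a b /=; apply/eqP; rewrite eq_complex/=.
have h : (2 * pi != 0 :> R) by rewrite gt_eqF// twopi_gt0.
by apply/andP; split; apply/eqP; rewrite mulrC -mulrA divff// mulr1.
Qed.

(** Real and imaginary parts are estimated separately, whence the factor 2. *)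
Lemma circle_integral_close u v (e : R) : circle_integrable u -> circle_integrable v ->
  (forall t, period R t -> normc (u (expi t) - v (expi t)) <= e) ->
  normc (circle_integral u - circle_integral v) <= 2 * e.
Proof.
move=> iu iv uv.
have aux (g : R -> R) : mu.-integrable (period R) (EFin \o g) ->
    (forall t, period R t -> `|g t| <= e) ->
    `|(2 * pi)^-1 * \int[mu]_(t in period R) g t| <= e.
  move=> ig ge; have := @Rintegral_itv_close R 0 (2 * pi) g 0 e (ltW twopi_gt0) ig.
  rewrite mul0r !subr0 normrM.
  have c0 : 0 < (2 * pi)^-1 :> R by rewrite invr_gt0 twopi_gt0.
  rewrite (gtr0_norm c0) [(2 * pi)^-1 * _]mulrC.
  rewrite ler_pdivrMr ?twopi_gt0//; apply => t ht; rewrite subr0; apply: ge.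
  by rewrite /period /= in_itv.
rewrite -circle_integralB//.
have [i1 i2] : circle_integrable (fun z => u z - v z).
  have := circle_integrableD iu (circle_integrableZ (-1) iv).
  by apply: circle_integrable_eq => t; rewrite mulN1r.
apply: le_trans (normc_le_ReIm _) _; rewrite mulr2n mulrDl mul1r lerD//; apply: aux => // t /uv.
  exact: le_trans (Re_le_normc _).
exact: le_trans (Im_le_normc _).
Qed.

End CircleIntegral.

(** * Cauchy's formula *)

Section PolarCoordinates.
Context {R : realType}.
Implicit Types (F : Cplx R -> Cplx R) (z w : Cplx R).

Lemma is_derive_lin_approx (f : R -> R) (x l : R) : is_derive x 1 f l ->
  forall e, 0 < e -> exists2 d, 0 < d & forall y, `|y - x| < d ->
    `|f y - f x - l * (y - x)| <= e * `|y - x|.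
Proof.
move=> [df fl] e e0; move: df; rewrite /derivable.
move=> /cvgrPdist_le; rewrite -/(derive f x 1) fl => /(_ _ e0).
rewrite near_withinE => /nbhs_ballP[d /= d0 dP]; exists d => // y yx.
have [->|yNx] := eqVneq y x; first by rewrite !subrr mulr0 subrr normr0 mulr0.
have yx0 : y - x != 0 by rewrite subr_eq0.
have := dP (y - x); rewrite /ball/= sub0r normrN => /(_ yx yx0).
rewrite -[_ *: 1]/(_ * 1) mulr1 subrK -[_^-1 *: _]/(_^-1 * _) => le1.
have -> : f y - f x - l * (y - x) = - ((l - (y - x)^-1 * (f y - f x)) * (y - x)).
  by field.
by rewrite normrN normrM ler_wpM2r.
Qed.

Lemma exp_lin_approx (e : R) : 0 < e ->
  exists2 d, 0 < d & forall h k, `|h| < d -> `|k| < d ->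
    normc ((expR h)%:C * expi k - 1 - (h +i* k)) <= e * (`|h| + `|k|).
Proof.
(* The bounds [t1], [t3] and [t2] below contribute 3, 2 and 3 times e1 [|k|], which makes 8. *)
move=> e0; pose e1 := Num.min 1 (e / 8).
have e10 : 0 < e1 by rewrite lt_min ltr01 divr_gt0.
have e11 : e1 <= 1 by rewrite ge_min lexx.
have e1e : e1 <= e / 8 by rewrite ge_min lexx orbT.
clearbody e1.
have [d1 d10 P1] := is_derive_lin_approx (is_derive_expR 0) e10.
have [d2 d20 P2] := is_derive_lin_approx (is_derive_cos 0) e10.
have [d3 d30 P3] := is_derive_lin_approx (is_derive_sin 0) e10.
exists (Num.min e1 (Num.min d1 (Num.min d2 d3))); first by rewrite lt_min e10/= lt_min d10/= lt_min d20.
move=> h k; rewrite !lt_min => /and4P[h0 h1 _ _] /and4P[_ _ k2 k3].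
have := P1 h; have := P2 k; have := P3 k.
rewrite expR0 cos0 sin0 !(subr0, oppr0, mul0r, addr0, mul1r) => /(_ k3) + /(_ k2) + /(_ h1).
set c := cos k - 1; set s := sin k - k; set E := expR h - 1 - h => s1 c1 E1.
apply: le_trans (normc_le_ReIm _) _ => /=; rewrite /= !(mul0r, subr0, oppr0, addr0).
have -> : expR h * cos k - 1 - h = E + c * (1 + h + E) by rewrite /E /c; ring.
have -> : expR h * sin k - k = (h + E) * k + s * (1 + h + E) by rewrite /E /s; ring.
have h1' : `|h| <= 1 := le_trans (ltW h0) e11.
have E2 : `|E| <= `|h| by apply: le_trans E1 _; rewrite ler_piMl.
have b3 : `|1 + h + E| <= 3.
  have := ler_normD (1 + h) E; have := ler_normD 1 h; rewrite normr1; lra.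
have b2 : `|h + E| <= 2 * e1 by have := ler_normD h E; lra.
have t1 : `|c * (1 + h + E)| <= e1 * `|k| * 3 by rewrite normrM ler_pM.
have t2 : `|s * (1 + h + E)| <= e1 * `|k| * 3 by rewrite normrM ler_pM.
have t3 : `|(h + E) * k| <= 2 * e1 * `|k| by rewrite normrM ler_wpM2r.
have t4 := ler_normD E (c * (1 + h + E)).
have t5 := ler_normD ((h + E) * k) (s * (1 + h + E)).
have : e1 * (8 * (`|h| + `|k|)) <= e / 8 * (8 * (`|h| + `|k|)).
  by rewrite ler_wpM2r// mulr_ge0// addr_ge0.
have : 0 <= e1 * `|h| by rewrite mulr_ge0// ltW.
by lra.
Qed.

(** The map exp(s + i t). It turns circles around 0 into vertical lines, and F dz / z into F (ds + i
    dt), whose integral over t is the circle mean up to a constant. *)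
Definition polar (s t : R) : Cplx R := (expR s)%:C * expi t.

(** Chain rule: the derivative of F(exp(s + i t)) in s + i t is L z, here split as al + i be. *)
Lemma polar_diff_approx F s t : cdiff F (polar s t) -> exists al be : R,
  forall e, 0 < e -> exists2 d, 0 < d & forall s' t', `|s' - s| < d -> `|t' - t| < d ->
    normc (F (polar s' t') - F (polar s t) - (al +i* be) * ((s' - s) +i* (t' - t)))
      <= e * (`|s' - s| + `|t' - t|).
Proof.
set z := polar s t => -[L H]; have [al [be Lz]] : exists al be : R, L * z = al +i* be.
  by case: (L * z) => al be; exists al, be.
exists al, be => e e0; rewrite -Lz.
pose r := normc z + 1; have r0 : 0 < r by rewrite ltr_wpDl// normc_ge0.
have L0 : 0 < 1 + normc L by rewrite ltr_pwDl// normc_ge0.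
(* Two errors arise, that of [F] along its differential and that of the exponential; these
   tolerances make each at most e / 2 times |h| + |k|. *)
have [d1 d10 P1] := H (e / (4 * r)) (divr_gt0 e0 (mulr_gt0 (ltr0n _ 4) r0)).
pose e2 := Num.min 1 (e / (2 * r * (1 + normc L))).
have e20 : 0 < e2 by rewrite lt_min ltr01 divr_gt0// mulr_gt0// mulr_gt0.
have [d2 d20 P2] := exp_lin_approx e20.
exists (Num.min d2 (d1 / (4 * r))).
  by rewrite lt_min d20 divr_gt0// mulr_gt0.
move=> s' t'; rewrite !lt_min => /andP[s1 s2] /andP[t1 t2].
set h := s' - s in s1 s2 *; set k := t' - t in t1 t2 *.
have zE : polar s' t' = z * ((expR h)%:C * expi k).
  rewrite /z /polar mulrACA -expiD -rmorphM/= -expRD.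
  by congr ((expR _)%:C * expi _); rewrite /h /k; ring.
have := P2 h k s1 t1; set X := _ - (h +i* k) => X1.
have wz : polar s' t' - z = z * ((h +i* k) + X) by rewrite zE /X; ring.
pose m := `|h| + `|k|; have m0 : 0 <= m by rewrite addr_ge0.
have hk : normc (h +i* k : Cplx R) <= m by exact: normc_le_ReIm.
have Xm : normc X <= e2 * m by [].
have e2m : e2 * m <= m by rewrite ler_piMl// /e2 ge_min lexx.
have zr : normc z <= r by rewrite /r lerDl.
have wz2 : normc (polar s' t' - z) <= r * (2 * m).
  rewrite wz normcM ler_pM// ?normc_ge0//.
  by have := le_normcD (h +i* k) X; lra.
have wzd : normc (polar s' t' - z) < d1.
  apply: le_lt_trans wz2 _; move: s2 t2; rewrite !ltr_pdivlMr ?mulr_gt0//.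
  by rewrite /m; lra.
have := P1 _ wzd; set Y := _ - L * _ => Y1.
have -> : F (polar s' t') - F z - L * z * (h +i* k) = Y + L * (z * X).
  by rewrite /Y wz; ring.
apply: le_trans (le_normcD _ _) _.
have Y2 : normc Y <= e / (4 * r) * (r * (2 * m)).
  by apply: le_trans Y1 _; rewrite ler_wpM2l// ltW// divr_gt0// mulr_gt0.
have Z2 : normc (L * (z * X)) <= (1 + normc L) * (r * (e / (2 * r * (1 + normc L)) * m)).
  rewrite (normcM L) (normcM z); apply: ler_pM; rewrite ?mulr_ge0 ?normc_ge0 ?lerDr//.
  apply: ler_pM; rewrite ?normc_ge0//. apply: (le_trans Xm).
  by rewrite ler_wpM2r// /e2 ge_min lexx orbT.
have E1 : e / (4 * r) * (r * (2 * m)) = e * m / 2 by field; rewrite gt_eqF.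
have E2 : (1 + normc L) * (r * (e / (2 * r * (1 + normc L)) * m)) = e * m / 2.
  by field; rewrite !gt_eqF.
move: Y2 Z2; rewrite E1 E2 -/m; lra.
Qed.

(** This is the imaginary part of F (ds + i dt); its closedness is one way to state the
    Cauchy-Riemann equations. *)
Lemma polar_closed_Re F s t : cdiff F (polar s t) ->
  closed_form_at (fun s t => complex.Im (F (polar s t)))
                 (fun s t => complex.Re (F (polar s t))) s t.
Proof.
move=> /polar_diff_approx[al [be H]]; exists be, al, (- be) => e /H[d d0 dP].
exists d => // s' t' hs ht; have := dP s' t' hs ht.
move: (F _) (F _) => [a b] [a' b']; set n := normc _; set m := _ * (_ + _) => nm.
split; apply: le_trans nm.
  by apply: le_trans (Im_le_normc _); rewrite /= le_eqVlt; apply/orP; left; apply/eqP; congr `|_|; ring.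
by apply: le_trans (Re_le_normc _); rewrite /= le_eqVlt; apply/orP; left; apply/eqP; congr `|_|; ring.
Qed.

(** The real part of F (ds + i dt), with its sign changed so that dt carries Im F. *)
Lemma polar_closed_Im F s t : cdiff F (polar s t) ->
  closed_form_at (fun s t => - complex.Re (F (polar s t)))
                 (fun s t => complex.Im (F (polar s t))) s t.
Proof.
move=> /polar_diff_approx[al [be H]]; exists (- al), be, al => e /H[d d0 dP].
exists d => // s' t' hs ht; have := dP s' t' hs ht.
move: (F _) (F _) => [a b] [a' b']; set n := normc _; set m := _ * (_ + _) => nm.
split; apply: le_trans nm.
  by apply: le_trans (Re_le_normc _); rewrite /= le_eqVlt; apply/orP; left; apply/eqP; rewrite -normrN; congr `|_|; ring.
by apply: le_trans (Im_le_normc _); rewrite /= le_eqVlt; apply/orP; left; apply/eqP; congr `|_|; ring.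
Qed.

Lemma normc_polar s t : normc (polar s t) = expR s.
Proof. by rewrite normcM normc_expi mulr1 normc_real gtr0_norm// expR_gt0. Qed.

(** The sides t = 0 and t = 2 pi of the rectangle cancel by periodicity, so the other two have equal
    integrals. *)
Lemma circulation_period (P Q : R -> R -> R) (a b : R) : a < b ->
  (forall s t, a <= s <= b -> closed_form_at P Q s t) ->
  (forall s, P s (2 * pi) = P s 0) ->
  \int[lebesgue_measure]_(t in period R) Q b t =
  \int[lebesgue_measure]_(t in period R) Q a t.
Proof.
move=> ab cl per.
have ba0 : 0 < b - a by rewrite subr_gt0.
have clo : closed_on P Q a (b - a) 0 (2 * pi).
  by move=> s t hs _; apply: cl; move: hs; lra.
have := circulation_eq0 ba0 twopi_gt0 clo; rewrite /circulation add0r (addrC a) subrK.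
rewrite [X in _ - X = 0](_ : _ = 0) ?subr0; last first.
  under eq_Rintegral do rewrite per subrr.
  by rewrite Rintegral_itv_cst ?mul0r// ltW.
have iQ s : a <= s <= b -> lebesgue_measure.-integrable (period R) (EFin \o Q s).
  move=> hs; have := closed_on_intQ clo (s := s); rewrite add0r; apply.
  by move: hs; lra.
by rewrite (RintegralB measurable_period (iQ b _) (iQ a _)); lra.
Qed.

Lemma mean_annulus F (r1 r2 : R) : 0 < r1 -> r1 < r2 ->
  (forall z, r1 <= normc z <= r2 -> cdiff F z) ->
  circle_integral (fun z => F (r1%:C * z)) = circle_integral (fun z => F (r2%:C * z)).
Proof.
move=> r10 r12 H; have r20 : 0 < r2 by apply: lt_trans r12.
have Hp s t : ln r1 <= s <= ln r2 -> cdiff F (polar s t).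
  move=> /andP[s1 s2]; apply: H; rewrite normc_polar; apply/andP; split.
    by rewrite -[leLHS]lnK ?ler_expR.
  by rewrite -[leRHS]lnK ?ler_expR.
have ln12 : ln r1 < ln r2 by rewrite ltr_ln.
have per s : polar s (2 * pi) = polar s 0 by rewrite /polar expi2pi expi0.
have := circulation_period ln12 (fun s t h => polar_closed_Re (Hp s t h)) (fun s => congr1 (fun z => complex.Im (F z)) (per s)).
have := circulation_period ln12 (fun s t h => polar_closed_Im (Hp s t h)) (fun s => congr1 (fun z => - complex.Re (F z)) (per s)).
rewrite /polar !lnK//.
by move=> im re; rewrite /circle_integral re im.
Qed.

End PolarCoordinates.

(** * Mean values and Cauchy's formula on circles inside the disc *)

Section CauchyFormula.
Context {R : realType}.
Implicit Types (f F G u : Cplx R -> Cplx R) (p z w : Cplx R).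

Lemma ccontP f z : ccont f z <-> {for z, continuous f}.
Proof.
have P := @cvg_cplxP _ _ (nbhs z) (nbhs_filter z) f (f z).
split=> [H|/P H e /H /nbhs_cplxP[d d0 dP]]; last by exists d.
by apply/P => e /H[d d0 dP]; apply/nbhs_cplxP; exists d.
Qed.

Lemma continuous_expi : continuous (@expi R).
Proof.
move=> t; apply/(@cvg_cplxP _ _ (nbhs t) (nbhs_filter t)) => e e0.
have e2 : 0 < e / 2 by rewrite divr_gt0.
have /cvgrPdist_lt/(_ _ e2) hc := @continuous_cos R t.
have /cvgrPdist_lt/(_ _ e2) hs := @continuous_sin R t.
near=> x.
have h1 : `|cos t - cos x| < e / 2 by near: x.
have h2 : `|sin t - sin x| < e / 2 by near: x.
rewrite normcB; apply: le_lt_trans (normc_le_ReIm _) _ => /=; lra.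
Unshelve. all: by end_near. Qed.

Lemma continuous_Re : continuous (@complex.Re R : Cplx R -> R).
Proof.
move=> z; apply/(@cvgrPdist_lt _ _ _ (nbhs z) (nbhs_filter z)) => e e0; apply/nbhs_cplxP; exists e => // w wz.
by apply: le_lt_trans wz; rewrite normcB; case: z w => ? ? [? ?]; exact: (Re_le_normc (_ +i* _)).
Qed.

Lemma continuous_Im : continuous (@complex.Im R : Cplx R -> R).
Proof.
move=> z; apply/(@cvgrPdist_lt _ _ _ (nbhs z) (nbhs_filter z)) => e e0; apply/nbhs_cplxP; exists e => // w wz.
by apply: le_lt_trans wz; rewrite normcB; case: z w => ? ? [? ?]; exact: (Im_le_normc (_ +i* _)).
Qed.

Lemma continuous_conjc : continuous (@conjc R : Cplx R -> Cplx R).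
Proof.
move=> z; apply/ccontP => e e0; exists e => // w.
by rewrite -conjcB normc_conj.
Qed.

Lemma circle_continuous_integrable u :
  (forall t, {for expi t, continuous u}) -> circle_integrable u.
Proof.
move=> cu; have cue t : {for t, continuous (u \o @expi R)}.
  by apply: continuous_comp; [exact: continuous_expi|exact: cu].
split; apply: continuous_itv_integrable => t _.
  by apply: (@continuous_comp _ _ _ (u \o @expi R) _ t) => //; exact: continuous_Re.
by apply: (@continuous_comp _ _ _ (u \o @expi R) _ t) => //; exact: continuous_Im.
Qed.

Lemma continuous_dilation F (r : R) w : {for r%:C * w, continuous F} ->
  {for w, continuous (fun z : Cplx R => F (r%:C * z))}.
Proof.
move=> /ccontP cF; apply/ccontP => e /cF[d d0 dP].
have r1 : 0 < `|r| + 1 by rewrite ltr_wpDl.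
exists (d / (`|r| + 1)); first exact: divr_gt0.
move=> v; rewrite ltr_pdivlMr// => vw; apply: dP.
rewrite -mulrBr normcM normc_real; apply: le_lt_trans vw.
by rewrite mulrC ler_wpM2l ?normc_ge0// lerDl.
Qed.

Lemma dilation_disc (r : R) w : 0 <= r < 1 -> normc w <= 1 -> normc (r%:C * w) < 1.
Proof.
move=> /andP[r0 r1] w1; rewrite normcM normc_real ger0_norm//.
by apply: le_lt_trans r1; rewrite ler_piMr.
Qed.

(** Uniformity in the angle comes from the compactness of the period. *)
Lemma circle_uniform_close F (r : R) : (forall t, {for r%:C * expi t, continuous F}) ->
  forall e, 0 < e -> exists2 d, 0 < d & forall r', `|r' - r| < d ->
    forall t, period R t -> normc (F (r'%:C * expi t) - F (r%:C * expi t)) < e.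
Proof.
move=> cF e e0; have e2 : 0 < e / 2 by rewrite divr_gt0.
have /compact_near_coveringP cov := @segment_compact R 0 (2 * pi).
have := cov R (nbhs r) (fun r' t => normc (F (r'%:C * expi t) - F (r%:C * expi t)) < e).
have nb t : period R t -> \forall t' \near t & r' \near nbhs r,
    normc (F (r'%:C * expi t') - F (r%:C * expi t')) < e.
  move=> _; have /ccontP/(_ _ e2)[d d0 dP] := cF t.
  have d2 : 0 < d / 2 by rewrite divr_gt0.
  have M0 : 0 < `|r| + 1 by rewrite ltr_wpDl.
  have /(@cvg_cplxP _ _ (nbhs t) (nbhs_filter t)) ce := @continuous_expi t.
  have dM : 0 < d / 2 / (`|r| + 1) by rewrite divr_gt0.
  exists ([set t' | normc (expi t' - expi t) < d / 2 / (`|r| + 1)],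
          ball r (Num.min 1 (d / 2))) => /=.
    by split; [exact: ce|apply: nbhsx_ballx; rewrite lt_min ltr01].
  move=> [t' r'] /= [h1]; rewrite /ball/= lt_min => /andP[h2 h3].
  have near q : `|r - q| < d / 2 -> `|q| <= `|r| + 1 ->
      normc (F (q%:C * expi t') - F (r%:C * expi t)) < e / 2.
    move=> hq hq1; apply: dP.
    have -> : q%:C * expi t' - r%:C * expi t =
        q%:C * (expi t' - expi t) + (q - r)%:C * expi t by rewrite rmorphB/=; ring.
    apply: le_lt_trans (le_normcD _ _) _; rewrite !normcM normc_expi mulr1 !normc_real.
    have : `|q| * normc (expi t' - expi t) <= d / 2.
      apply: (@le_trans _ _ ((`|r| + 1) * (d / 2 / (`|r| + 1)))).
        by apply: ler_pM; rewrite ?normc_ge0// ltW.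
      by rewrite mulrC mulfVK// gt_eqF.
    by move: hq; rewrite distrC; lra.
  have n1 : normc (F (r'%:C * expi t') - F (r%:C * expi t)) < e / 2.
    apply: near => //; have := ler_normD r (r' - r); rewrite addrC subrK (distrC r' r).
    lra.
  have n2 : normc (F (r%:C * expi t') - F (r%:C * expi t)) < e / 2.
    by apply: near; rewrite ?subrr ?normr0//; lra.
  have := le_normcD (F (r'%:C * expi t') - F (r%:C * expi t)) (F (r%:C * expi t) - F (r%:C * expi t')).
  by rewrite subrKA (normcB (F (r%:C * expi t))); lra.
move=> /(_ _ nb)/nbhs_ballP[d /= d0 dP]; exists d => // r' r'd t pt.
by apply: dP => //; rewrite /ball/= distrC.
Qed.

Lemma normc_small_eq (x y : Cplx R) : (forall e, 0 < e -> normc (x - y) <= e) -> x = y.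
Proof.
move=> H; apply/eqP; rewrite -subr_eq0; apply/eqP/normc_eq0P/eqP.
rewrite eq_le normc_ge0 andbT; apply/ler_addgt0Pr => e e0; rewrite add0r; exact: H.
Qed.

(* The mean is constant in r on either side of |p|, and continuous across. *)
Lemma mean_value_punctured F p : (forall z, normc z < 1 -> {for z, continuous F}) ->
  (forall z, normc z < 1 -> z != p -> cdiff F z) ->
  forall r : R, 0 < r < 1 -> circle_integral (fun z => F (r%:C * z)) = F 0.
Proof.
move=> cF dF; pose I (r : R) := circle_integral (fun z => F (r%:C * z)).
have cFr (r t : R) : 0 <= r < 1 -> {for r%:C * expi t, continuous F}.
  by move=> hr; apply: cF; apply: dilation_disc; rewrite ?normc_expi.
have iF (r : R) : 0 <= r < 1 -> circle_integrable (fun z => F (r%:C * z)).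
  by move=> hr; apply: circle_continuous_integrable => t; apply/continuous_dilation/cFr.
have close (r : R) : 0 <= r < 1 -> forall e, 0 < e -> exists2 d, 0 < d &
    forall r', 0 <= r' < 1 -> `|r' - r| < d -> normc (I r' - I r) <= e.
  move=> hr e e0; have [d d0 dP] := circle_uniform_close (fun t => cFr r t hr) (divr_gt0 e0 (ltr0n _ 2)).
  exists d => // r' hr' r'd; have -> : e = 2 * (e / 2) by field.
  apply: circle_integral_close; [exact: iF|exact: iF|] => t pt.
  exact/ltW/dP.
have I0 : I 0 = F 0.
  rewrite /I -[RHS]circle_integral_cst; apply: circle_integral_eq => t _.
  by rewrite mul0r.
have ann (r1 r2 : R) : 0 < r1 -> r1 < r2 -> r2 < 1 ->
    (normc p < r1 \/ r2 < normc p) -> I r1 = I r2.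
  move=> r10 r12 r21 hp; apply: mean_annulus => // z /andP[h1 h2].
  apply: dF; first exact: le_lt_trans r21.
  by apply/eqP => zp; move: hp; rewrite -zp; lra.
(* Continuity of the mean at [r0] extends to [r0] a constancy known on the open interval to its
   right. *)
have right (r0 r : R) : 0 <= r0 -> r0 < r -> r < 1 ->
    (forall r', r0 < r' < r -> I r' = I r) -> I r0 = I r.
  move=> h0 hr h1 H; apply: normc_small_eq => e e0.
  have [|d d0 dP] := close r0 _ e e0; first by lra.
  pose x := r0 + Num.min d (r - r0) / 2.
  have m0 : 0 < Num.min d (r - r0) by rewrite lt_min d0 subr_gt0.
  have m1 : Num.min d (r - r0) <= d by rewrite ge_min lexx.
  have m2 : Num.min d (r - r0) <= r - r0 by rewrite ge_min lexx orbT.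
  rewrite normcB -(H x); last by rewrite /x; lra.
  by apply: dP; [rewrite /x; lra|rewrite /x addrC addKr gtr0_norm; lra].
have inner (r : R) : 0 < r < 1 -> r < normc p -> I r = F 0.
  move=> /andP[r0 r1] rp; rewrite -I0; apply/esym/right => // r' /andP[h1 h2].
  by apply: ann => //; right.
(* The radius |p| is reached from below, where the mean is already known; larger radii are then
   compared with |p| through [right]. *)
have at_p : normc p < 1 -> I (normc p) = F 0.
  move=> p1; have [p0|p0] := eqVneq (normc p) 0; first by rewrite p0.
  have p0' : 0 < normc p by rewrite lt_neqAle eq_sym p0 normc_ge0.
  apply: normc_small_eq => e e0.
  have [|d d0 dP] := close (normc p) _ e e0; first by lra.
  pose x := normc p - Num.min d (normc p) / 2.
  have m0 : 0 < Num.min d (normc p) by rewrite lt_min d0.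
  have m1 : Num.min d (normc p) <= d by rewrite ge_min lexx.
  have m2 : Num.min d (normc p) <= normc p by rewrite ge_min lexx orbT.
  rewrite normcB -(inner x); try by rewrite /x; lra.
  by apply: dP; [rewrite /x; lra|rewrite /x addrAC subrr sub0r normrN gtr0_norm; lra].
move=> r /andP[r0 r1]; rewrite -/(I r).
have [rp|pr|rp] := ltgtP r (normc p); first by apply: inner; rewrite ?r0.
  rewrite -at_p; last exact: lt_trans r1.
  apply/esym/right => //; first exact: normc_ge0.
  move=> r' /andP[h1 h2]; apply: ann => //; last by left.
  by apply: le_lt_trans h1; exact: normc_ge0.
by rewrite rp at_p// -rp.
Qed.

Lemma cdiff_local f g z (d : R) : 0 < d ->
  (forall w, normc (w - z) < d -> f w = g w) -> cdiff g z -> cdiff f z.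
Proof.
move=> d0 fg [L H]; exists L => e /H[d' d'0 dP].
exists (Num.min d d'); first by rewrite lt_min d0.
move=> w; rewrite lt_min => /andP[w1 w2]; rewrite !fg//; first exact: dP.
by rewrite subrr normc0.
Qed.

Lemma cdiff_continuous f z : cdiff f z -> {for z, continuous f}.
Proof. by move=> /cdiff_ccont/ccontP. Qed.

Lemma derivable_cauchy_kernel (a z : Cplx R) : 1 - a * z != 0 ->
  derivable (fun w : Cplx R => 1 / (1 - a * w)) z 1.
Proof.
move=> h; have -> : (fun w : Cplx R => 1 / (1 - a * w)) = (fun w => (1 - a * w)^-1).
  by apply/funext => w; rewrite mul1r.
by apply: derivableV => //; apply: derivableB => //.
Qed.

Lemma one_sub_neq0 (a : Cplx R) : normc a < 1 -> 1 - a != 0.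
Proof.
by move=> a1; apply/eqP => /eqP; rewrite subr_eq0 => /eqP h; move: a1; rewrite -h normc1 ltxx.
Qed.

(** The conjugate of the kernel is analytic beyond the circle. As the mean value property is only
    available at radii below 1, that conjugate is written as K(r w), with r strictly between |a| and
    1 so that [K] is still analytic on the whole open disc. *)
Lemma mean_cauchy_kernel (a : Cplx R) : normc a < 1 ->
  circle_integrable (fun w => 1 / (1 - a * conjc w)) /\
  circle_integral (fun w => 1 / (1 - a * conjc w)) = 1.
Proof.
move=> a1; pose r := (1 + normc a) / 2; have a0 := normc_ge0 a.
have r0 : 0 < r by rewrite /r; lra.
have r1 : r < 1 by rewrite /r; lra.
pose K w : Cplx R := 1 / (1 - (conjc a / r%:C) * w).
have ar w : normc w < 1 -> normc (conjc a / r%:C * w) < 1.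
  move=> w1; rewrite !normcM normcV normc_conj normc_real (gtr0_norm r0).
  apply: (@le_lt_trans _ _ (normc a / r)).
    by apply: ler_piMr; [apply: divr_ge0 => //|]; exact: ltW.
  by rewrite ltr_pdivrMr// mul1r /r; lra.
have dK w : normc w < 1 -> cdiff K w.
  by move=> w1; apply/derivable_cdiff/derivable_cauchy_kernel/one_sub_neq0/ar.
have cK w : normc w < 1 -> {for w, continuous K}.
  by move=> /dK; exact: cdiff_continuous.
have := @mean_value_punctured K 0 cK (fun z h _ => dK z h) r; rewrite r0 r1 => /(_ isT).
rewrite {2}/K mulr0 subr0 divr1 => mK.
have iK : circle_integrable (fun z => K (r%:C * z)).
  apply: circle_continuous_integrable => t; apply/continuous_dilation/cK/dilation_disc.
    by rewrite r1 ltW.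
  by rewrite normc_expi.
have E t : conjc (K (r%:C * expi t)) = 1 / (1 - a * conjc (expi t)).
  have rn : r%:C != 0 :> Cplx R by rewrite -[0]/(0%:C) (inj_eq (@complexI _)) gt_eqF.
  rewrite /K mulrA mulfVK// !mul1r conjcV conjcB conjc_one conjcM.
  by rewrite conjcK.
split.
  apply: (@circle_integrable_eq _ (fun z => conjc (K (r%:C * z)))) => //.
  exact: circle_integrable_conj.
rewrite -(@circle_integral_eq _ (fun z => conjc (K (r%:C * z)))); last by move=> t _; exact: E.
by rewrite circle_integral_conj// mK conjc_one.
Qed.

(* Removable singularity: the mean value property of w (f w - f (rz)) / (w - rz),
   which vanishes at 0, is Cauchy's formula for f at rz. *)
Lemma cauchy_dilation f z (r : R) : analytic f -> normc z < 1 -> 0 < r < 1 ->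
  circle_integral (fun w => f (r%:C * w) * (1 / (1 - z * conjc w))) = f (r%:C * z).
Proof.
move=> af z1 /andP[r0 r1]; set p : Cplx R := r%:C * z.
have rn : r%:C != 0 :> Cplx R by rewrite -[0]/(0%:C) (inj_eq (@complexI _)) gt_eqF.
have p1 : normc p < 1 by apply: dilation_disc; rewrite ?ltW.
have df w : normc w < 1 -> cdiff f w by move=> ?; apply/derivable_cdiff/af/unit_discE.
have [L HL] := df p p1.
pose G w : Cplx R := if w == p then p * L else w * (f w - f p) / (w - p).
have dG w : normc w < 1 -> w != p -> cdiff G w.
  move=> w1 wp; have wp0 : w - p != 0 by rewrite subr_eq0.
  apply: (@cdiff_local _ (fun w => (w * (f w - f p)) * (w - p)^-1) _ (normc (w - p))).
  - exact: normc_gt0P.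
  - move=> v vw; rewrite /G ifN//; apply: contraTneq vw => ->.
    by rewrite normcB ltxx.
  - apply/derivable_cdiff; apply: derivableM.
      by apply: derivableM => //; apply: derivableB => //; exact/derivable_cdiff/df.
    by apply: derivableV => //; exact: derivableB.
have cG w : normc w < 1 -> {for w, continuous G}.
  move=> w1; have [->|wp] := eqVneq w p; last exact/cdiff_continuous/dG.
  apply/ccontP => e e0.
  pose M := normc p + 1; have M0 : 0 < M by rewrite ltr_wpDl// normc_ge0.
  have L0 : 0 < 1 + normc L by rewrite ltr_pwDl// normc_ge0.
  have [d d0 dP] := HL (e / (4 * M)) (divr_gt0 e0 (mulr_gt0 (ltr0n _ 4) M0)).
  exists (Num.min d (Num.min 1 (e / (4 * (1 + normc L))))).
    by rewrite lt_min d0/= lt_min ltr01 divr_gt0// mulr_gt0.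
  move=> v; rewrite lt_min => /andP[vd]; rewrite lt_min => /andP[v1 ve].
  rewrite /G eqxx; case: ifPn => [_|vp]; first by rewrite subrr normc0.
  have vp0 : v - p != 0 by rewrite subr_eq0.
  have -> : v * (f v - f p) / (v - p) - p * L =
      v * ((f v - f p - L * (v - p)) / (v - p)) + L * (v - p) by field.
  apply: le_lt_trans (le_normcD _ _) _.
  have vM : normc v <= M.
    by have := le_normcD (v - p) p; rewrite subrK /M; lra.
  have b1 : normc (v * ((f v - f p - L * (v - p)) / (v - p))) <= M * (e / (4 * M)).
    rewrite normcM; apply: ler_pM; rewrite ?normc_ge0// normcM normcV.
    by rewrite ler_pdivrMr ?normc_gt0P//; exact: dP.
  have b2 : normc (L * (v - p)) <= (1 + normc L) * (e / (4 * (1 + normc L))).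
    by rewrite normcM; apply: ler_pM; rewrite ?normc_ge0 ?lerDr// ltW.
  have E1 : M * (e / (4 * M)) = e / 4 by field; rewrite gt_eqF.
  have E2 : (1 + normc L) * (e / (4 * (1 + normc L))) = e / 4 by field; rewrite gt_eqF.
  by move: b1 b2; rewrite E1 E2; lra.
have := mean_value_punctured cG dG (r := r); rewrite r0 r1 => /(_ isT).
have -> : G 0 = 0.
  by rewrite /G; case: ifPn => [/eqP <-|_]; rewrite ?mul0r.
have [iK mK] := mean_cauchy_kernel z1.
have iG : circle_integrable (fun w => G (r%:C * w)).
  apply: circle_continuous_integrable => t; apply/continuous_dilation/cG/dilation_disc.
    by rewrite r1 ltW.
  by rewrite normc_expi.
(* On the circle 1 - z conj w = (w - z) / w, so G(r w) = (f(r w) - f p) / (1 - z conj w). *)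
move=> mG; have E t : G (r%:C * expi t) + f p * (1 / (1 - z * conjc (expi t))) =
    f (r%:C * expi t) * (1 / (1 - z * conjc (expi t))).
  have ez : expi t - z != 0.
    rewrite subr_eq0; apply/eqP => ez; move: z1.
    by rewrite -ez normc_expi ltxx.
  have e0 := expi_neq0 t.
  rewrite /G ifN; last by rewrite /p (inj_eq (mulfI rn)) -subr_eq0.
  rewrite conjc_expi /p; move: (f _) (f _) => A B.
  have -> : r%:C * expi t - r%:C * z = r%:C * (expi t - z) by ring.
  have -> : 1 - z / expi t = (expi t - z) / expi t by field.
  by field; rewrite rn ez e0.
rewrite -(@circle_integral_eq _ (fun w => G (r%:C * w) + f p * (1 / (1 - z * conjc w)))); last first.
  by move=> t _; exact: E.
rewrite circle_integralD//; last exact: circle_integrableZ.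
by rewrite circle_integralZ// mG mK mulr1 add0r.
Qed.

End CauchyFormula.

(** * Square-integrable functions *)

Section AlmostEverywhere.
Context {d : measure_display} {T : measurableType d} {R : realType}.
Variable mu : {measure set T -> \bar R}.

Lemma ae_mono (P Q : T -> Prop) : {ae mu, forall t, P t} ->
  (forall t, P t -> Q t) -> {ae mu, forall t, Q t}.
Proof. by move=> aP PQ; apply: filterS aP. Qed.

Lemma ae_mono2 (P P' Q : T -> Prop) : {ae mu, forall t, P t} ->
  {ae mu, forall t, P' t} -> (forall t, P t -> P' t -> Q t) ->
  {ae mu, forall t, Q t}.
Proof. by move=> aP aP' PQ; apply: filterS2 aP aP'. Qed.

End AlmostEverywhere.

Section SquareIntegrable.
Context {d : measure_display} {T : measurableType d} {R : realType}.
Variables (mu : {measure set T -> \bar R}) (D : set T).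
Hypotheses (mD : measurable D) (muD : (mu D < +oo)%E).
Implicit Types x y : T -> R.

Lemma integrable_sqr x M : measurable_fun D x ->
  (\int[mu]_(t in D) (x t ^+ 2)%:E <= M%:E)%E ->
  mu.-integrable D (EFin \o (fun t => x t ^+ 2)).
Proof.
move=> mx xM; apply/integrableP; split.
  by apply/measurable_EFinP; exact: measurable_funX.
under eq_integral do rewrite gee0_abs ?lee_fin ?sqr_ge0//.
exact: le_lt_trans xM (ltry _).
Qed.

Lemma integrable_cst_finite (k : R) : mu.-integrable D (EFin \o cst k).
Proof.
apply/integrableP; split; first exact/measurable_EFinP/measurable_cst.
suff : (\int[mu]_(t in D) (cst `|k|%:E) t < +oo)%E by [].
by rewrite integral_cst// lte_mul_pinfty// ?lee_fin.
Qed.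

Lemma square_integrable x M : measurable_fun D x ->
  (\int[mu]_(t in D) (x t ^+ 2)%:E <= M%:E)%E -> mu.-integrable D (EFin \o x).
Proof.
move=> mx xM.
have := integrable_addR mD (integrable_cst_finite 1) (integrable_sqr mx xM).
apply: le_integrable => //; first exact/measurable_EFinP.
move=> t _ /=; rewrite lee_fin [leRHS]ger0_norm ?addr_ge0 ?sqr_ge0//.
have -> : x t ^+ 2 = `|x t| ^+ 2 by rewrite real_normK ?num_real.
by have := sqr_ge0 (`|x t| - 1); rewrite !expr2; nra.
Qed.

Lemma Rintegral_le_EFin x M : mu.-integrable D (EFin \o x) ->
  (\int[mu]_(t in D) (x t)%:E <= M%:E)%E -> \int[mu]_(t in D) x t <= M.
Proof.
by move=> ix xM; rewrite -lee_fin /Rintegral fineK// integrable_fin_num.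
Qed.

(* Boundedness in L^2 gives uniform integrability:
   [`|d| <= min `|d| l + d ^+ 2 / l] for every [l > 0]. *)
Lemma Rintegral_cvg_L2_bounded (x_ : nat -> T -> R) x (M : R) :
  (forall n, measurable_fun D (x_ n)) -> measurable_fun D x ->
  (forall n, \int[mu]_(t in D) (x_ n t ^+ 2)%:E <= M%:E)%E ->
  (\int[mu]_(t in D) (x t ^+ 2)%:E <= M%:E)%E ->
  {ae mu, forall t, D t -> x_ ^~ t @ \oo --> x t} ->
  (fun n => \int[mu]_(t in D) x_ n t) @ \oo --> \int[mu]_(t in D) x t.
Proof.
move=> mx_ mx xM_ xM xx; apply/cvgrPdist_lt => e e0.
(* With this [l] the quadratic term, at most 4 (|M| + 1) / l, is at most e / 4; dominated
   convergence brings the truncated part below e / 2. *)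
pose l := 16 * (`|M| + 1) / e.
have M1 : 0 < `|M| + 1 by rewrite ltr_wpDl.
have l0 : 0 < l by rewrite divr_gt0// mulr_gt0.
pose dd n t := x t - x_ n t.
have mdd n : measurable_fun D (dd n) by exact: measurable_funB.
pose m n t := Num.min `|dd n t| l.
have mm n : measurable_fun D (m n).
  by apply: measurable_minr => //; apply: measurableT_comp.
have mm0 n t : 0 <= m n t by rewrite le_min normr_ge0 ltW.
have ml n t : m n t <= l by rewrite ge_min lexx orbT.
have [_ _] : [/\ mu.-integrable D (cst 0%E),
   [sequence (\int[mu]_(t in D) `|(m n t)%:E - 0|)%E]_n @ \oo --> 0%E &
   [sequence (\int[mu]_(t in D) (m n t)%:E)%E]_n @ \oo --> (\int[mu]_(t in D) cst 0%E t)%E].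
  apply: (@dominated_convergence _ _ _ mu D mD (fun n t => (m n t)%:E) (cst 0%E) (EFin \o cst l)).
  - by move=> n; exact/measurable_EFinP.
  - exact: measurable_cst.
  - apply: filterS xx => t + Dt => /(_ Dt) xt; apply/cvg_EFin; first by near=> n.
    apply/cvgrPdist_lt => r r0.
    move/cvgrPdist_lt : xt => /(_ _ r0); apply: filterS => n hn.
    by rewrite /= sub0r normrN ger0_norm// /m (le_lt_trans _ hn)// ge_min lexx.
  - exact: integrable_cst_finite.
  - by apply: aeW => t n _ /=; rewrite lee_fin ger0_norm.
rewrite integral0 => /fine_cvgP[_] /cvgrPdist_lt/(_ _ (divr_gt0 e0 (ltr0n _ 2))).
have ix n : mu.-integrable D (EFin \o x_ n) by exact: square_integrable (xM_ n).
have ix0 : mu.-integrable D (EFin \o x) by exact: square_integrable xM.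
have idd n : mu.-integrable D (EFin \o dd n) by exact: integrable_subR.
have im n : mu.-integrable D (EFin \o m n).
  apply: le_integrable (idd n) => //; first exact/measurable_EFinP.
  by move=> t _ /=; rewrite lee_fin ger0_norm// ge_min lexx.
have is_ n : mu.-integrable D (EFin \o (fun t => x_ n t ^+ 2)) := integrable_sqr (mx_ n) (xM_ n).
have is0 : mu.-integrable D (EFin \o (fun t => x t ^+ 2)) := integrable_sqr mx xM.
have is2 n := integrable_addR mD (integrable_scaleR 2 mD is0) (integrable_scaleR 2 mD (is_ n)).
have imaj n := integrable_addR mD (im n) (integrable_scaleR l^-1 mD (is2 n)).
apply: filterS => n; rewrite /= sub0r normrN => mn.
rewrite -RintegralB//.
apply: le_lt_trans (le_normr_Rintegral mD (idd n)) _.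
have : \int[mu]_(t in D) `|dd n t| <=
    \int[mu]_(t in D) (m n t + l^-1 * (2 * x t ^+ 2 + 2 * x_ n t ^+ 2)).
  apply: le_Rintegral (integrable_norm (idd n)) (imaj n) _ => // t Dt /=.
  have s0 : 0 <= 2 * x t ^+ 2 + 2 * x_ n t ^+ 2.
    by rewrite addr_ge0// mulr_ge0// sqr_ge0.
  have [dl|ld] := leP `|dd n t| l.
    by rewrite /m (min_l dl) lerDl mulr_ge0// invr_ge0 ltW.
  rewrite /m (min_r (ltW ld)); apply: (@le_trans _ _ (l^-1 * `|dd n t| ^+ 2)).
    by rewrite mulrC ler_pdivlMr// expr2 ler_wpM2l// ltW.
  apply: ler_wpDl; first exact: ltW.
  rewrite ler_wpM2l ?invr_ge0 ?(ltW l0)// real_normK ?num_real// /dd.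
  by have := sqr_ge0 (x t + x_ n t); rewrite sqrrB sqrrD; lra.
rewrite (RintegralD mD (im n) (integrable_scaleR _ mD (is2 n))).
rewrite (RintegralZl _ mD (is2 n)) (RintegralD mD (integrable_scaleR 2 mD is0) (integrable_scaleR 2 mD (is_ n))).
rewrite (RintegralZl _ mD is0) (RintegralZl _ mD (is_ n)).
have b1 := Rintegral_le_EFin is0 xM.
have b2 := Rintegral_le_EFin (is_ n) (xM_ n).
have : l^-1 * (2 * \int[mu]_(t in D) x t ^+ 2 + 2 * \int[mu]_(t in D) x_ n t ^+ 2) <= e / 4.
  apply: (@le_trans _ _ (l^-1 * (4 * (`|M| + 1)))).
    by rewrite ler_wpM2l ?invr_ge0 ?(ltW l0)//; have := ler_norm M; lra.
  by rewrite /l le_eqVlt; apply/orP; left; apply/eqP; field; rewrite !gt_eqF.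
move: mn; rewrite ger0_norm; last by apply: Rintegral_ge0.
by rewrite -/(Rintegral mu D (m n)); lra.
Unshelve. all: by end_near. Qed.

End SquareIntegrable.

(** * Square norms and limits of integrals on the circle *)

Section CircleL2.
Context {R : realType}.
Notation mu := (@lebesgue_measure R).
Implicit Types (f u v : Cplx R -> Cplx R) (z w : Cplx R).

Definition circle_measurable u :=
  measurable_fun (period R) (fun t : R => complex.Re (u (expi t))) /\
  measurable_fun (period R) (fun t : R => complex.Im (u (expi t))).

Lemma circle_measurableD u v : circle_measurable u -> circle_measurable v ->
  circle_measurable (fun z => u z + v z).
Proof.
move=> [u1 u2] [v1 v2]; split.
  have := measurable_funD u1 v1; congr measurable_fun.
  by apply/funext => t /=; case: (u _) => ? ?; case: (v _).
have := measurable_funD u2 v2; congr measurable_fun.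
by apply/funext => t /=; case: (u _) => ? ?; case: (v _).
Qed.

Lemma circle_measurableM u v : circle_measurable u -> circle_measurable v ->
  circle_measurable (fun z => u z * v z).
Proof.
move=> [u1 u2] [v1 v2]; split.
  have := measurable_funB (measurable_funM u1 v1) (measurable_funM u2 v2).
  congr measurable_fun; apply/funext => t /=; case: (u _) => ? ?; by case: (v _).
have := measurable_funD (measurable_funM u1 v2) (measurable_funM u2 v1).
congr measurable_fun; apply/funext => t /=; case: (u _) => ? ?; by case: (v _).
Qed.

Lemma circle_measurable_conj u : circle_measurable u ->
  circle_measurable (fun z => conjc (u z)).
Proof.
move=> [u1 u2]; split.
  by move: u1; congr measurable_fun; apply/funext => t /=; case: (u _).
have := measurable_funN u2; congr measurable_fun.
by apply/funext => t /=; case: (u _).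
Qed.

Lemma circle_continuous_measurable u :
  (forall t, {for expi t, continuous u}) -> circle_measurable u.
Proof.
move=> cu; have cue : continuous (u \o @expi R).
  by move=> t; apply: continuous_comp; [exact: continuous_expi|exact: cu].
split; apply: measurable_funTS; apply: continuous_measurable_fun => t.
  by apply: (@continuous_comp _ _ _ (u \o @expi R) _ t); [exact: cue|exact: continuous_Re].
by apply: (@continuous_comp _ _ _ (u \o @expi R) _ t); [exact: cue|exact: continuous_Im].
Qed.

Lemma circle_measurable_normc u : circle_measurable u ->
  measurable_fun (period R) (fun t : R => normc (u (expi t)) ^+ 2).
Proof.
move=> [u1 u2]; have := measurable_funD (measurable_funX 2 u1) (measurable_funX 2 u2).
by congr measurable_fun; apply/funext => t /=; rewrite normcSq.
Qed.

Lemma sqnorm_leP u (M : R) : (sqnorm u <= M%:E)%E <->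
  (\int[mu]_(t in period R) (normc (u (expi t)) ^+ 2)%:E <= (2 * pi * M)%:E)%E.
Proof.
rewrite /sqnorm EFinM -lee_pdivrMl ?twopi_gt0//.
Qed.

Lemma sqnorm_ge0 u : (0 <= sqnorm u)%E.
Proof.
apply: mule_ge0; first by rewrite lee_fin invr_ge0 ltW// twopi_gt0.
by apply: integral_ge0 => t _; rewrite lee_fin sqr_ge0.
Qed.

Lemma L2P u : L2 u <-> circle_measurable u /\ exists M : R, (sqnorm u <= M%:E)%E.
Proof.
split=> [[u1 u2 u3]|[[u1 u2] [M uM]]]; last first.
  by split=> //; apply: le_lt_trans uM (ltry _).
split=> //; exists (fine (sqnorm u)); rewrite fineK// ge0_fin_numE//.
exact: sqnorm_ge0.
Qed.

Lemma sqnorm_le u v (k : R) : 0 <= k -> circle_measurable u -> circle_measurable v ->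
  {ae mu, forall t, period R t ->
     normc (u (expi t)) ^+ 2 <= k * normc (v (expi t)) ^+ 2} ->
  (sqnorm u <= k%:E * sqnorm v)%E.
Proof.
move=> k0 mu_ mv uv; rewrite /sqnorm muleCA lee_wpmul2l//.
  by rewrite lee_fin invr_ge0 ltW// twopi_gt0.
have m1 := circle_measurable_normc mu_; have m2 := circle_measurable_normc mv.
rewrite -ge0_integralZl_EFin//; first last.
- exact/measurable_EFinP.
- by move=> t _; rewrite lee_fin sqr_ge0.
- exact: measurable_period.
apply: ae_ge0_le_integral => //.
- exact: measurable_period.
- by move=> t _; rewrite lee_fin sqr_ge0.
- exact/measurable_EFinP.
- by move=> t _; rewrite -EFinM lee_fin mulr_ge0// sqr_ge0.
- by apply: measurable_funeM; exact/measurable_EFinP.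
Qed.

Lemma sqnorm_le_bound u v (k M : R) : 0 <= k -> circle_measurable u -> circle_measurable v ->
  {ae mu, forall t, period R t ->
     normc (u (expi t)) ^+ 2 <= k * normc (v (expi t)) ^+ 2} ->
  (sqnorm v <= M%:E -> sqnorm u <= (k * M)%:E)%E.
Proof.
move=> k0 m1 m2 uv vM; apply: le_trans (sqnorm_le k0 m1 m2 uv) _.
by rewrite EFinM lee_wpmul2l.
Qed.

Lemma sqnormD_bound u v (M N : R) : circle_measurable u -> circle_measurable v ->
  (sqnorm u <= M%:E -> sqnorm v <= N%:E ->
   sqnorm (fun z => (u z + v z)%R) <= (2 * M + 2 * N)%:E)%E.
Proof.
move=> m1 m2 /sqnorm_leP uM /sqnorm_leP vN; apply/sqnorm_leP.
have n1 := circle_measurable_normc m1; have n2 := circle_measurable_normc m2.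
apply: (@le_trans _ _ (\int[mu]_(t in period R) (2%:E * (normc (u (expi t)) ^+ 2)%:E + 2%:E * (normc (v (expi t)) ^+ 2)%:E))%E).
  apply: ge0_le_integral => //.
  - exact: measurable_period.
  - by move=> t _; rewrite lee_fin sqr_ge0.
  - apply/measurable_EFinP.
    exact: (circle_measurable_normc (circle_measurableD m1 m2)).
  - by apply: emeasurable_funD; apply: measurable_funeM; exact/measurable_EFinP.
  - move=> t _; rewrite -!EFinM -EFinD lee_fin.
    have := le_normcD (u (expi t)) (v (expi t)).
    have := normc_ge0 (u (expi t) + v (expi t)).
    move: (normc (u _)) (normc (v _)) (normc _) => a b c c0 cab.
    have : c ^+ 2 <= (a + b) ^+ 2 by rewrite ler_pXn2r// nnegrE (le_trans c0).
    by have := sqr_ge0 (a - b); rewrite sqrrB sqrrD; lra.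
rewrite (ge0_integralD _ measurable_period)//; first last.
- by apply: measurable_funeM; exact/measurable_EFinP.
- by move=> t _; rewrite -EFinM lee_fin mulr_ge0// sqr_ge0.
- by apply: measurable_funeM; exact/measurable_EFinP.
- by move=> t _; rewrite -EFinM lee_fin mulr_ge0// sqr_ge0.
rewrite !(ge0_integralZl_EFin _ measurable_period)//; try by [exact/measurable_EFinP|move=> t _; rewrite lee_fin sqr_ge0].
rewrite (_ : 2 * pi * (2 * M + 2 * N) = 2 * (2 * pi * M) + 2 * (2 * pi * N)); last by ring.
rewrite [leRHS]EFinD (EFinM _ (2 * pi * M)) (EFinM _ (2 * pi * N)).
by apply: leeD; rewrite lee_wpmul2l.
Qed.

Lemma L2D u v : L2 u -> L2 v -> L2 (fun z => u z + v z).
Proof.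
move=> /L2P[mu_ [M uM]] /L2P[mv [N vN]]; apply/L2P; split.
  exact: circle_measurableD.
by eexists; exact: sqnormD_bound uM vN.
Qed.

Lemma L2_Re_bound u (M : R) : circle_measurable u -> (sqnorm u <= M%:E)%E ->
  (\int[mu]_(t in period R) (complex.Re (u (expi t)) ^+ 2)%:E <= (2 * pi * M)%:E)%E /\
  (\int[mu]_(t in period R) (complex.Im (u (expi t)) ^+ 2)%:E <= (2 * pi * M)%:E)%E.
Proof.
move=> m /sqnorm_leP uM; have n := circle_measurable_normc m; case: m => m1 m2.
split; apply: le_trans uM; apply: (@ge0_le_integral _ _ _ mu _ measurable_period) => //; try by [
  move=> t _; rewrite lee_fin sqr_ge0|exact/measurable_EFinP/measurable_funX|
  exact/measurable_EFinP].
  by move=> t _; rewrite lee_fin normcSq lerDl sqr_ge0.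
by move=> t _; rewrite lee_fin normcSq lerDr sqr_ge0.
Qed.

Lemma period_finite : (mu (period R) < +oo)%E.
Proof. by rewrite measure_period ltry. Qed.

Lemma L2_circle_integrable u : L2 u -> circle_integrable u.
Proof.
move=> /L2P[m [M uM]]; have [h1 h2] := L2_Re_bound m uM; case: m => m1 m2.
split.
  exact: (@square_integrable _ _ _ mu _ measurable_period period_finite _ _ m1 h1).
exact: (@square_integrable _ _ _ mu _ measurable_period period_finite _ _ m2 h2).
Qed.

(** Meant for the dilations f(r w) with r tending to 1, which are bounded in L^2 but come with no
    integrable majorant. *)
Lemma circle_integral_cvg (u_ : nat -> Cplx R -> Cplx R) u (M : R) :
  (forall n, circle_measurable (u_ n)) -> circle_measurable u ->
  (forall n, sqnorm (u_ n) <= M%:E)%E -> (sqnorm u <= M%:E)%E ->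
  {ae mu, forall t, period R t -> forall e, 0 < e ->
     \forall n \near \oo, normc (u_ n (expi t) - u (expi t)) < e} ->
  forall e, 0 < e -> \forall n \near \oo,
    normc (circle_integral (u_ n) - circle_integral u) < e.
Proof.
move=> m_ m b_ b uu e e0.
have cRe : (fun n => \int[mu]_(t in period R) complex.Re (u_ n (expi t))) @ \oo
     --> \int[mu]_(t in period R) complex.Re (u (expi t)).
  apply: (@Rintegral_cvg_L2_bounded _ _ _ mu _ measurable_period period_finite _ _ (2 * pi * M)).
  - by move=> n; have [] := m_ n.
  - by case: m.
  - by move=> n; have [] := L2_Re_bound (m_ n) (b_ n).
  - by have [] := L2_Re_bound m b.
  - apply: (ae_mono uu) => t h pt; apply/cvgrPdist_lt => r r0.
    apply: filterS (h pt r r0) => n; rewrite distrC; apply: le_lt_trans.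
    by case: (u_ n _) => ? ?; case: (u _) => ? ?; exact: (Re_le_normc (_ +i* _)).
have cIm : (fun n => \int[mu]_(t in period R) complex.Im (u_ n (expi t))) @ \oo
     --> \int[mu]_(t in period R) complex.Im (u (expi t)).
  apply: (@Rintegral_cvg_L2_bounded _ _ _ mu _ measurable_period period_finite _ _ (2 * pi * M)).
  - by move=> n; have [] := m_ n.
  - by case: m.
  - by move=> n; have [] := L2_Re_bound (m_ n) (b_ n).
  - by have [] := L2_Re_bound m b.
  - apply: (ae_mono uu) => t h pt; apply/cvgrPdist_lt => r r0.
    apply: filterS (h pt r r0) => n; rewrite distrC; apply: le_lt_trans.
    by case: (u_ n _) => ? ?; case: (u _) => ? ?; exact: (Im_le_normc (_ +i* _)).
have e2 : 0 < e * pi by rewrite mulr_gt0// pi_gt0.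
move/cvgrPdist_lt : cRe => /(_ _ e2) hR; move/cvgrPdist_lt : cIm => /(_ _ e2) hI.
near=> n.
have h1 := near hR n; have h2 := near hI n.
have p0 := @twopi_gt0 R.
have c0 : 0 < (2 * pi)^-1 :> R by rewrite invr_gt0.
apply: le_lt_trans (normc_le_ReIm _) _ => /=.
rewrite -!mulrBr !normrM (gtr0_norm c0) -mulrDr mulrC ltr_pdivrMr//.
rewrite ![`|\int[_]_(_ in _) _ - \int[_]_(_ in _) complex.Re (u _)|]distrC.
rewrite ![`|\int[_]_(_ in _) _ - \int[_]_(_ in _) complex.Im (u _)|]distrC.
have -> : e * (2 * pi) = e * pi + e * pi by ring.
by apply: ltrD; [apply: h1|apply: h2].
Unshelve. all: by end_near. Qed.

End CircleL2.

(** * The reproducing formula *)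

Section HardySpace.
Context {R : realType}.
Notation mu := (@lebesgue_measure R).
Implicit Types (f g k u v : Cplx R -> Cplx R) (z w : Cplx R).

Lemma analytic_continuous f z : analytic f -> normc z < 1 -> {for z, continuous f}.
Proof. by move=> af z1; apply/cdiff_continuous/derivable_cdiff/af/unit_discE. Qed.

Lemma analytic_circle_measurable f (r : R) : analytic f -> 0 <= r < 1 ->
  circle_measurable (fun z => f (r%:C * z)).
Proof.
move=> af hr; apply: circle_continuous_measurable => t; apply/continuous_dilation.
by apply: analytic_continuous => //; apply: dilation_disc; rewrite ?normc_expi.
Qed.

Lemma sqnorm_cst (k : Cplx R) : sqnorm (fun=> k) = (normc k ^+ 2)%:E.
Proof.
have E : (\int[mu]_(t in period R) (normc k ^+ 2)%:E = (normc k ^+ 2)%:E * (2 * pi)%:E)%E.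
  by rewrite -measure_period; apply: (@integral_cst _ _ _ mu _ measurable_period (normc k ^+ 2)%:E).
rewrite /sqnorm [X in (_ * X)%E]E.
have n0 : (2 * pi != 0 :> R) by rewrite gt_eqF// twopi_gt0.
by rewrite muleCA -!EFinM (mulVf n0) mulr1.
Qed.

Lemma sqnorm_le_cst u (M : R) : circle_measurable u ->
  {ae mu, forall t, period R t -> normc (u (expi t)) <= M} ->
  (sqnorm u <= (M ^+ 2)%:E)%E.
Proof.
move=> mu_ uM; have mc : circle_measurable (fun=> 1 : Cplx R).
  by apply: circle_continuous_measurable => t; apply/ccontP => e e0; exists 1 => // w _; rewrite subrr normc0.
have -> : (M ^+ 2)%:E = ((M ^+ 2)%:E * sqnorm (fun=> 1%R : Cplx R))%E.
  by rewrite sqnorm_cst normc1 expr1n mule1.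
apply: (sqnorm_le (sqr_ge0 M) mu_ mc); apply: (ae_mono uM) => t h /h le; rewrite normc1 expr1n mulr1.
by rewrite ler_pXn2r// nnegrE ?normc_ge0// (le_trans (normc_ge0 _) le).
Qed.

Lemma analyticM f g : analytic f -> analytic g -> analytic (fun z => f z * g z).
Proof. by move=> af ag z hz; apply: derivableM; [exact: af|exact: ag]. Qed.

Lemma analyticD f g : analytic f -> analytic g -> analytic (fun z => f z + g z).
Proof. by move=> af ag z hz; apply: derivableD; [exact: af|exact: ag]. Qed.

Lemma analytic_eq f g : analytic f -> (forall z, normc z < 1 -> f z = g z) -> analytic g.
Proof.
move=> af fg z hz; have z1 := (unit_discE z).1 hz.
have d0 : 0 < 1 - normc z by rewrite subr_gt0.
apply/derivable_cdiff; apply: (@cdiff_local _ g f z _ d0) => [w wz|].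
  by rewrite fg//; have := le_normcD (w - z) z; rewrite subrK; lra.
exact/derivable_cdiff/af.
Qed.

Lemma H2_eq f g : H2 f -> (forall z, normc z < 1 -> f z = g z) -> H2 g.
Proof.
move=> [af [M fM]] fg; split; first exact: analytic_eq fg.
exists M => r hr; apply: le_trans (fM r hr); rewrite le_eqVlt; apply/orP; left.
apply/eqP; congr (_ * _)%E; apply: eq_integral => t _; rewrite fg//.
by apply: dilation_disc; rewrite ?normc_expi.
Qed.

Lemma boundary_value_eq f g u : boundary_value f u ->
  (forall z, normc z < 1 -> f z = g z) -> boundary_value g u.
Proof.
move=> [Lu ae] fg; split => //; apply: (ae_mono ae) => t h pt.
apply/radial_cvgP => e e0; have [d d0 dP] := (radial_cvgP _ _).1 (h pt) e e0.
exists (Num.min d 1); first by rewrite lt_min d0 ltr01.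
move=> r /andP[r1 r2]; have m1 : Num.min d 1 <= d by rewrite ge_min lexx.
have m2 : Num.min d 1 <= 1 by rewrite ge_min lexx orbT.
rewrite -fg; first by apply: dP; lra.
by apply: dilation_disc; rewrite ?normc_expi// r2 andbT; lra.
Qed.

(** The boundary function is an argument and its existence is not claimed: every construction has to
    deliver it along with the function. *)
Definition H2bv f u := H2 f /\ boundary_value f u.

Lemma H2bv_eq f g u : H2bv f u -> (forall z, normc z < 1 -> f z = g z) -> H2bv g u.
Proof. by move=> [h1 h2] fg; split; [exact: H2_eq fg|exact: boundary_value_eq fg]. Qed.

Lemma H2bvD f g u v : H2bv f u -> H2bv g v ->
  H2bv (fun z => f z + g z) (fun z => u z + v z).
Proof.
move=> [[af [M fM]] [Lu bu]] [[ag [N gN]] [Lv bv]]; split; split.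
- exact: analyticD.
- exists (2 * M + 2 * N) => r hr.
  by apply: sqnormD_bound; [exact: analytic_circle_measurable|exact: analytic_circle_measurable|
    exact: fM|exact: gN].
- exact: L2D.
- by apply: (ae_mono2 bu bv) => t h1 h2 pt; apply: cvgD; [exact: h1|exact: h2].
Qed.

Lemma boundary_value_bound f u (M : R) : boundary_value f u ->
  (forall z, normc z < 1 -> normc (f z) <= M) ->
  {ae mu, forall t, period R t -> normc (u (expi t)) <= M}.
Proof.
move=> [_ bu] fM; apply: (ae_mono bu) => t h pt.
apply/ler_addgt0Pr => e e0; have [d d0 dP] := (radial_cvgP _ _).1 (h pt) e e0.
pose r := 1 - Num.min d 1 / 2.
have m0 : 0 < Num.min d 1 by rewrite lt_min d0 ltr01.
have m1 : Num.min d 1 <= d by rewrite ge_min lexx.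
have m2 : Num.min d 1 <= 1 by rewrite ge_min lexx orbT.
have := dP r ltac:(rewrite /r; lra).
have := fM (r%:C * expi t); rewrite dilation_disc ?normc_expi//; last by rewrite /r; lra.
move=> /(_ isT); have := normc_sub_le (u (expi t)) (f (r%:C * expi t)).
by rewrite normcB; lra.
Qed.

Lemma H2bvM_bounded f g u v (M : R) : analytic f -> boundary_value f u ->
  (forall z, normc z < 1 -> normc (f z) <= M) -> H2bv g v ->
  H2bv (fun z => f z * g z) (fun z => u z * v z).
Proof.
move=> af bf fM [[ag [N gN]] [Lv bv]].
have ub := boundary_value_bound bf fM; case: bf => Lu bu.
have [mu_ _] := (L2P u).1 Lu; have [mv [N' vN]] := (L2P v).1 Lv.
have sq (a b : Cplx R) : normc a <= M -> normc (a * b) ^+ 2 <= M ^+ 2 * normc b ^+ 2.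
  move=> aM; rewrite normcM exprMn ler_wpM2r ?sqr_ge0// ler_pXn2r// nnegrE ?normc_ge0//.
  exact: le_trans (normc_ge0 _) aM.
split; split.
- exact: analyticM.
- exists (M ^+ 2 * N) => r hr.
  have m1 := analytic_circle_measurable af hr; have m2 := analytic_circle_measurable ag hr.
  apply: (sqnorm_le_bound (sqr_ge0 M) (circle_measurableM m1 m2) m2 _ (gN r hr)).
  apply: aeW => t _; apply: sq; apply: fM; apply: dilation_disc => //.
  by rewrite normc_expi.
- apply/L2P; split; first exact: circle_measurableM.
  exists (M ^+ 2 * N'); apply: (sqnorm_le_bound (sqr_ge0 M) (circle_measurableM mu_ mv) mv _ vN).
  by apply: (ae_mono ub) => t h pt; apply: sq; exact: h.
- by apply: (ae_mono2 bu bv) => t h1 h2 pt; apply: cvgM; [exact: h1|exact: h2].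
Qed.

Lemma boundary_value_continuous f (M : R) : (forall t, {for expi t, continuous f}) ->
  (forall t, normc (f (expi t)) <= M) -> boundary_value f f.
Proof.
move=> cf fM; split.
  apply/L2P; split; first exact: circle_continuous_measurable.
  exists (M ^+ 2); apply: sqnorm_le_cst; first exact: circle_continuous_measurable.
  by apply: aeW => t _; exact: fM.
apply: aeW => t _; apply/radial_cvgP => e /((ccontP _ _).2 (cf t))[d d0 dP].
exists d => // r /andP[r1 r2]; apply: dP.
rewrite -[X in _ - X]mul1r -mulrBl normcM normc_expi mulr1 -(rmorph1 (real_complex R)) -rmorphB.
by rewrite normc_real distrC gtr0_norm; lra.
Qed.

Lemma H2_bounded f (M : R) : analytic f ->
  (forall z, normc z < 1 -> normc (f z) <= M) -> H2 f.
Proof.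
move=> af fM; split => //; exists (M ^+ 2) => r hr.
apply: sqnorm_le_cst; first exact: analytic_circle_measurable.
by apply: aeW => t _; apply/fM/dilation_disc; rewrite ?normc_expi.
Qed.

Definition szego (z w : Cplx R) : Cplx R := 1 / (1 - conjc z * w).

Lemma szego_bound z w : normc z < 1 -> normc w <= 1 ->
  normc (szego z w) <= (1 - normc z)^-1.
Proof.
move=> z1 w1; rewrite /szego normcM normc1 mul1r normcV lef_pV2 ?posrE ?subr_gt0//; last first.
  apply/normc_gt0P/one_sub_neq0; rewrite normcM normc_conj; apply: le_lt_trans z1.
  by rewrite ler_piMr ?normc_ge0.
have := normc_sub_le 1 (conjc z * w); rewrite normc1 normcM normc_conj.
have : normc z * normc w <= normc z by rewrite ler_piMr ?normc_ge0.
lra.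
Qed.

Lemma szego_cdiff z w : normc z < 1 -> normc w <= 1 -> cdiff (szego z) w.
Proof.
move=> z1 w1; apply/derivable_cdiff/derivable_cauchy_kernel/one_sub_neq0.
rewrite normcM normc_conj; apply: le_lt_trans z1; by rewrite ler_piMr ?normc_ge0.
Qed.

Lemma H2bv_szego z : normc z < 1 -> H2bv (szego z) (szego z).
Proof.
move=> z1; split.
  apply: (@H2_bounded _ (1 - normc z)^-1) => w hw.
    by apply/derivable_cdiff/szego_cdiff => //; apply: ltW; exact/unit_discE.
  by apply: szego_bound => //; exact: ltW.
apply: (@boundary_value_continuous _ (1 - normc z)^-1) => t.
  by apply/cdiff_continuous/szego_cdiff; rewrite ?normc_expi.
by apply: szego_bound; rewrite ?normc_expi.
Qed.

Lemma conjc_szego z w : conjc (szego z w) = 1 / (1 - z * conjc w).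
Proof. by rewrite /szego !mul1r conjcV conjcB conjc_one conjcM conjcK. Qed.

(** Cauchy's formula holds for the dilations of [f] by r n < 1. The H^2 bound on these dilations
    lets the integrals converge to that of the boundary function. *)
Lemma reproducing f u z : H2bv f u -> normc z < 1 -> inner u (szego z) = f z.
Proof.
move=> [[af [M fM]] [Lu bu]] z1.
have [mu_ [N uN]] := (L2P u).1 Lu.
pose k w := conjc (szego z w); pose K := (1 - normc z)^-1.
have mk : circle_measurable k.
  apply: circle_measurable_conj; apply: circle_continuous_measurable => t.
  by apply/cdiff_continuous/szego_cdiff; rewrite ?normc_expi.
(* The shift by 2 keeps r 0 positive, as [cauchy_dilation] demands. *)
pose r n : R := 1 - n.+2%:R^-1.
have r1 n : 0 < r n < 1.
  rewrite /r subr_gt0 ltrBlDr ltrDl invr_gt0 ltr0n andbT.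
  by rewrite invf_lt1 ?ltr0n// ltr1n.
have r1' n : 0 <= r n < 1 by have /andP[h ->] := r1 n; rewrite ltW.
have sq (a : Cplx R) (t : R) : normc (a * k (expi t)) ^+ 2 <= K ^+ 2 * normc a ^+ 2.
  rewrite normcM exprMn mulrC ler_wpM2r ?sqr_ge0// ler_pXn2r ?nnegrE ?normc_ge0//.
    by rewrite /k normc_conj; apply: szego_bound; rewrite ?normc_expi.
  by rewrite /K invr_ge0 subr_ge0 ltW.
have r_cvg (e : R) : 0 < e -> \forall n \near \oo, 1 - e < r n.
  move=> e0; have /cvgrPdist_lt/(_ _ e0) := @cvg_harmonic R.
  apply: filterS => n; rewrite sub0r normrN ger0_norm ?invr_ge0 ?ler0n// /r => h.
  rewrite ltrD2l ltrN2; apply: le_lt_trans h.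
  by rewrite lef_pV2 ?posrE ?ltr0n// ler_nat.
pose B := K ^+ 2 * (`|M| + `|N|).
have BM : K ^+ 2 * M <= B by rewrite ler_wpM2l ?sqr_ge0//; have := ler_norm M; have := normr_ge0 N; lra.
have BN : K ^+ 2 * N <= B by rewrite ler_wpM2l ?sqr_ge0//; have := ler_norm N; have := normr_ge0 M; lra.
have cvg := @circle_integral_cvg R (fun n w => f ((r n)%:C * w) * k w) (fun w => u w * k w) B.
apply/esym/normc_small_eq => e e0.
have [||||| n _ hn] := (cvg _ _ _ _ _ (e / 2) ltac:(lra)).
- by move=> n; apply: circle_measurableM => //; exact: analytic_circle_measurable.
- exact: circle_measurableM.
- move=> n; apply: (@le_trans _ _ (K ^+ 2 * M)%:E); last by rewrite lee_fin.
  have mf := analytic_circle_measurable af (r1' n).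
  apply: (sqnorm_le_bound (sqr_ge0 K) (circle_measurableM mf mk) mf _ (fM _ (r1' n))).
  by apply: aeW => t _; exact: sq.
- apply: (@le_trans _ _ (K ^+ 2 * N)%:E); last by rewrite lee_fin.
  apply: (sqnorm_le_bound (sqr_ge0 K) (circle_measurableM mu_ mk) mu_ _ uN).
  by apply: aeW => t _; exact: sq.
- apply: (ae_mono bu) => t h pt e' e'0.
  pose K1 := normc (k (expi t)) + 1.
  have K10 : 0 < K1 by rewrite ltr_wpDl// normc_ge0.
  have [d d0 dP] := (radial_cvgP _ _).1 (h pt) (e' / K1) (divr_gt0 e'0 K10).
  apply: filterS (r_cvg d d0) => n hn.
  rewrite -mulrBl normcM; have /andP[_ hr] := r1 n.
  have := dP (r n) ltac:(by rewrite hn hr); rewrite ltr_pdivlMr//.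
  apply: le_lt_trans; rewrite ler_wpM2l ?normc_ge0// /K1 lerDl.
  exact: ler01.
have cfz : {for z, continuous f} by exact: analytic_continuous.
have [d d0 dP] := (ccontP _ _).2 cfz (e / 2) ltac:(lra).
have [m _ hm] := r_cvg d d0.
pose q := maxn n m.
have := hn q (leq_maxl _ _); have := hm q (leq_maxr _ _) => h1 h2.
have fq : circle_integral (fun w => f ((r q)%:C * w) * k w) = f ((r q)%:C * z).
  rewrite -(cauchy_dilation af z1 (r1 q)); apply: circle_integral_eq => t _.
  by rewrite /k conjc_szego.
have h2' : normc (f ((r q)%:C * z) - circle_integral (fun w => u w * k w)) < e / 2.
  by rewrite -fq; exact: h2.
have h3 : normc (f ((r q)%:C * z) - f z) < e / 2.
  apply: dP; rewrite -[X in _ - X]mul1r -mulrBl normcM.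
  rewrite -(rmorph1 (real_complex R)) -rmorphB normc_real distrC.
  have /andP[_ hr] := r1 q; rewrite gtr0_norm ?subr_gt0//.
  apply: (@le_lt_trans _ _ (1 - r q)); last by lra.
  by rewrite ler_piMr// ?subr_ge0 ltW.
rewrite /inner -/k.
have := le_normcD (f z - f ((r q)%:C * z)) (f ((r q)%:C * z) - circle_integral (fun w => u w * k w)).
rewrite subrKA (normcB (f z)) => h4; apply: (le_trans h4); lra.
Qed.

End HardySpace.

(** * Polynomials, uniqueness of boundary values, growth in the disc *)

Section Polynomials.
Context {R : realType}.
Notation mu := (@lebesgue_measure R).
Implicit Types (f g k u v F : Cplx R -> Cplx R) (z w : Cplx R) (p q r a : {poly Cplx R}).

Lemma poly_bound p : exists M : R, forall w, normc w <= 1 -> normc p.[w] <= M.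
Proof.
elim/poly_ind: p => [|p c [M pM]].
  by exists 0 => w _; rewrite horner0 normc0.
exists (M + normc c) => w w1; rewrite !hornerE.
have := le_normcD (p.[w] * w) c; rewrite normcM => h; apply: (le_trans h).
by rewrite lerD2r; apply: le_trans (pM w w1); rewrite ler_piMr// normc_ge0.
Qed.

Lemma poly_derivable p z : derivable (fun w : Cplx R => p.[w]) z 1.
Proof.
elim/poly_ind: p => [|p c IH].
  by have -> : (fun w : Cplx R => (0 : {poly Cplx R}).[w]) = cst 0 by apply/funext => w; rewrite horner0.
have -> : (fun w : Cplx R => (p * 'X + c%:P).[w]) = (fun w => p.[w] * w + c).
  by apply/funext => w; rewrite !hornerE.
apply: derivableD; last exact: derivable_cst.
by apply: derivableM; [exact: IH|exact: derivable_id].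
Qed.

Lemma poly_continuous p z : {for z, continuous (fun w : Cplx R => p.[w])}.
Proof. by apply/cdiff_continuous/derivable_cdiff/poly_derivable. Qed.

Lemma poly_analytic p : analytic (fun w : Cplx R => p.[w]).
Proof. by move=> z _; exact: poly_derivable. Qed.

Lemma boundary_value_poly p : boundary_value (fun w => p.[w]) (fun w => p.[w]).
Proof.
have [M pM] := poly_bound p.
apply: (@boundary_value_continuous _ _ M) => t; first exact: poly_continuous.
by apply: pM; rewrite normc_expi.
Qed.

Lemma H2bv_poly p : H2bv (fun w => p.[w]) (fun w => p.[w]).
Proof.
have [M pM] := poly_bound p; split; last exact: boundary_value_poly.
by apply: (@H2_bounded _ _ M) => [|z z1]; [exact: poly_analytic|exact/pM/ltW].
Qed.

Lemma H2bv_polyM p f u : H2bv f u -> H2bv (fun z => p.[z] * f z) (fun z => p.[z] * u z).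
Proof.
have [M pM] := poly_bound p; apply: (@H2bvM_bounded _ _ _ _ _ M).
- exact: poly_analytic.
- exact: boundary_value_poly.
- by move=> z z1; exact/pM/ltW.
Qed.

Lemma L2M_bounded b u (M : R) : circle_measurable b ->
  (forall t, normc (b (expi t)) <= M) -> L2 u -> L2 (fun z => b z * u z).
Proof.
move=> mb bM /L2P[m [N uN]]; apply/L2P; split; first exact: circle_measurableM.
exists (M ^+ 2 * N); apply: (sqnorm_le_bound (sqr_ge0 M) (circle_measurableM mb m) m _ uN).
apply: aeW => t _; rewrite normcM exprMn ler_wpM2r ?sqr_ge0// ler_pXn2r// nnegrE ?normc_ge0//.
by apply: le_trans (bM t); rewrite normc_ge0.
Qed.

Lemma circle_integrable_boundedM b u (M : R) : circle_measurable b ->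
  (forall t, normc (b (expi t)) <= M) -> L2 u -> circle_integrable (fun z => b z * u z).
Proof. by move=> mb bM Lu; apply/L2_circle_integrable/(L2M_bounded mb bM). Qed.

Lemma circle_integral_ae u v : circle_measurable u -> circle_measurable v ->
  {ae mu, forall t, period R t -> u (expi t) = v (expi t)} ->
  circle_integral u = circle_integral v.
Proof.
move=> [u1 u2] [v1 v2] uv; congr (_ * _ +i* (_ * _)); rewrite /Rintegral; congr fine;
  apply: (@ae_eq_integral _ _ _ mu _ _ _ measurable_period); try exact/measurable_EFinP.
  by apply: (ae_mono uv) => t h pt; rewrite h.
by apply: (ae_mono uv) => t h pt; rewrite h.
Qed.

Lemma boundary_value_ae f u v : boundary_value f u -> boundary_value f v ->
  {ae mu, forall t, period R t -> u (expi t) = v (expi t)}.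
Proof.
move=> [_ bu] [_ bv]; apply: (ae_mono2 bu bv) => t h1 h2 pt.
apply: normc_small_eq => e e0.
have [d1 d10 P1] := (radial_cvgP _ _).1 (h1 pt) (e / 2) ltac:(lra).
have [d2 d20 P2] := (radial_cvgP _ _).1 (h2 pt) (e / 2) ltac:(lra).
pose r := 1 - Num.min d1 d2 / 2.
have m0 : 0 < Num.min d1 d2 by rewrite lt_min d10.
have m1 : Num.min d1 d2 <= d1 by rewrite ge_min lexx.
have m2 : Num.min d1 d2 <= d2 by rewrite ge_min lexx orbT.
have q1 := P1 r ltac:(rewrite /r; lra); have q2 := P2 r ltac:(rewrite /r; lra).
have := le_normcD (u (expi t) - f (r%:C * expi t)) (f (r%:C * expi t) - v (expi t)).
by rewrite subrKA (normcB (u _)); lra.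
Qed.

Lemma szego0 w : szego 0 w = 1.
Proof. by rewrite /szego conjc0 mul0r subr0 divr1. Qed.

Lemma mean_boundary_value f u : H2bv f u -> circle_integral u = f 0.
Proof.
move=> fu; rewrite -(reproducing fu); last by rewrite normc0.
by apply: circle_integral_eq => t _; rewrite szego0 conjc_one mulr1.
Qed.

(** Cauchy-Schwarz against the Szego kernel, whose square norm is 1 / (1 - |z|^2). It is applied
    pointwise, as x y <= x^2 / (2 s) + s y^2 / 2 with s = sqrt(1 - |z|), so that only the two square
    norms are integrated. *)
Lemma growth f u : H2bv f u -> exists2 C : R, 0 <= C &
  forall z, normc z < 1 -> normc (f z) <= C / Num.sqrt (1 - normc z).
Proof.
move=> fu; have [_ [Lu _]] := fu; have [mu_ [N uN]] := (L2P u).1 Lu.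
have isq v (K : R) : circle_measurable v -> (sqnorm v <= K%:E)%E ->
    mu.-integrable (period R) (EFin \o (fun t => normc (v (expi t)) ^+ 2)).
  move=> mv vK; apply/integrableP; split; first by apply/measurable_EFinP; exact: (circle_measurable_normc mv).
  under eq_integral do rewrite gee0_abs ?lee_fin ?sqr_ge0//.
  by apply: le_lt_trans ((sqnorm_leP _ _).1 vK) (ltry _).
have iu := isq u N mu_ uN.
pose I (x : R -> R) : R := \int[mu]_(t in period R) x t.
pose c : R := (2 * pi)^-1.
have c0 : 0 < c by rewrite /c invr_gt0 twopi_gt0.
pose A := c * I (fun t => normc (u (expi t)) ^+ 2).
have A0 : 0 <= A by rewrite mulr_ge0 ?(ltW c0)//; apply: Rintegral_ge0 => t _; exact: sqr_ge0.
(* The real and imaginary parts together give A / s + s / (1 - |z|^2), and the second term is at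
   most 1 / s because s^2 = 1 - |z| <= 1 - |z|^2. *)
exists (A + 1) => [|z z1]; first by rewrite addr_ge0.
pose s := Num.sqrt (1 - normc z).
have s0 : 0 < s by rewrite sqrtr_gt0 subr_gt0.
have [_ [Lk _]] := H2bv_szego z1; have [mk [K kK]] := (L2P _).1 Lk.
have ik := isq _ K mk kK.
have kE : c * I (fun t => normc (szego z (expi t)) ^+ 2) = (1 - normc z ^+ 2)^-1.
  have := reproducing (H2bv_szego z1) z1; rewrite /inner => /(congr1 (@complex.Re R)).
  have -> : szego z z = ((1 - normc z ^+ 2)^-1)%:C.
    rewrite /szego (mulrC (conjc z)) mulc_conj mul1r -(rmorph1 (real_complex R)).
    by rewrite -rmorphB fmorphV.
  move=> /= <-; congr (_ * _); apply: eq_Rintegral => t _.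
  by rewrite mulc_conj.
have [i1 i2] : circle_integrable (fun w => u w * conjc (szego z w)).
  apply: (@circle_integrable_eq _ (fun w => conjc (szego z w) * u w)).
    by move=> t; rewrite mulrC.
  apply: (@circle_integrable_boundedM _ _ (1 - normc z)^-1) => //.
    exact: circle_measurable_conj.
  by move=> t; rewrite normc_conj; apply: szego_bound; rewrite ?normc_expi.
have imaj' := integrable_addR measurable_period (integrable_scaleR (s^-1 / 2) measurable_period iu)
   (integrable_scaleR (s / 2) measurable_period ik).
have part (x : R -> R) : mu.-integrable (period R) (EFin \o x) ->
    (forall t, `|x t| <= normc (u (expi t) * conjc (szego z (expi t)))) ->
    `|c * I x| <= (s^-1 / 2) * A + s / 2 * (1 - normc z ^+ 2)^-1.
  move=> ix xle; rewrite normrM (gtr0_norm c0).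
  rewrite -kE /A mulrCA (mulrCA (s / 2)) -mulrDr ler_wpM2l ?(ltW c0)//.
  apply: le_trans (le_normr_Rintegral measurable_period ix) _.
  rewrite /I -(RintegralZl _ measurable_period iu) -(RintegralZl _ measurable_period ik).
  rewrite -(RintegralD measurable_period (integrable_scaleR _ measurable_period iu)
     (integrable_scaleR _ measurable_period ik)).
  apply: (le_Rintegral measurable_period (integrable_norm ix) imaj') => t _ /=.
  apply: (le_trans (xle t)); rewrite normcM normc_conj.
  move: (normc (u _)) (normc (szego _ _)) => x0 y0.
  have := sqr_ge0 (x0 - s * y0); rewrite sqrrB exprMn => h.
  have h' : 0 <= (x0 ^+ 2 - x0 * (s * y0) *+ 2 + s ^+ 2 * y0 ^+ 2) * (s^-1 / 2).
    by apply: mulr_ge0 => //; rewrite divr_ge0// invr_ge0 ltW.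
  have E : (x0 ^+ 2 - x0 * (s * y0) *+ 2 + s ^+ 2 * y0 ^+ 2) * (s^-1 / 2) =
     s^-1 / 2 * x0 ^+ 2 + s / 2 * y0 ^+ 2 - x0 * y0 by field; rewrite gt_eqF.
  by rewrite E in h'; lra.
rewrite -(reproducing fu z1).
apply: le_trans (normc_le_ReIm _) _.
have p1 := part _ i1 (fun t => Re_le_normc _).
have p2 := part _ i2 (fun t => Im_le_normc _).
have s2 : s ^+ 2 = 1 - normc z by rewrite sqr_sqrtr// subr_ge0 ltW.
have last : s * (1 - normc z ^+ 2)^-1 <= s^-1.
  have n0 := normc_ge0 z; have d0 : 0 < 1 - normc z ^+ 2.
    by rewrite subr_gt0 expr_lt1.
  rewrite ler_pdivrMr// mulrC ler_pdivlMr// -expr2 s2.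
  have : normc z ^+ 2 <= normc z by rewrite expr2 ler_piMr// ltW.
  lra.
rewrite /inner /circle_integral; apply: (@le_trans _ _ (s^-1 * A + s * (1 - normc z ^+ 2)^-1)).
  by move: p1 p2; rewrite /I /c /=; lra.
by rewrite -/s mulrDl mul1r (mulrC A) lerD2l.
Qed.

End Polynomials.

(** * Range spaces of co-analytic Toeplitz operators *)

Section RangeSpace.
Context {R : realType}.
Notation mu := (@lebesgue_measure R).
Implicit Types (f g k u v F : Cplx R -> Cplx R) (z w : Cplx R) (p q r a : {poly Cplx R}).

Lemma normc_zeta z : `|z| = 1 -> normc z = 1.
Proof. by rewrite cnormE -[1]/(1%:C) => /complexI. Qed.

Definition unimodular (s : seq (Cplx R)) := forall zeta, zeta \in s -> normc zeta = 1.

Lemma unimodular_cons z s : unimodular (z :: s) -> normc z = 1 /\ unimodular s.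
Proof.
by move=> h; split=> [|w ws]; apply: h; rewrite ?mem_head// inE ws orbT.
Qed.

Lemma circle_polyE a : circle_poly a -> exists2 s, unimodular s &
  a = \prod_(zeta <- s) ('X - zeta%:P).
Proof. by move=> [s h ->]; exists s => // z /h/normc_zeta. Qed.

Lemma circle_prod_neq0 s z : unimodular s -> normc z < 1 ->
  (\prod_(zeta <- s) ('X - zeta%:P)).[z] != 0.
Proof.
move=> us z1; rewrite horner_prod prodf_seq_neq0; apply/allP => zeta /us zs.
by rewrite !hornerE subr_eq0; apply/eqP => zz; move: z1; rewrite zz zs ltxx.
Qed.

(** For |z| = |x| = 1 one has z conj(z - x) = - conj x (z - x); the constant [C] collects the
    factors - conj x. *)
Lemma circle_prod_conj s : unimodular s -> exists2 C : Cplx R, C != 0 &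
  forall z, normc z = 1 -> z ^+ size s * conjc (\prod_(zeta <- s) ('X - zeta%:P)).[z]
    = C * (\prod_(zeta <- s) ('X - zeta%:P)).[z].
Proof.
elim: s => [|x s IH] us.
  by exists 1 => [|z _]; rewrite ?oner_neq0// big_nil !hornerE conjc_one.
have [x1 /IH[C C0 CP]] := unimodular_cons us.
have xx : x * conjc x = 1 by rewrite mulc_conj x1 expr1n.
have cx0 : conjc x != 0 by apply: contra_eq_neq xx => ->; rewrite mulr0 eq_sym oner_neq0.
exists (- conjc x * C) => [|z z1]; first by rewrite mulf_neq0// oppr_eq0.
have zz : z * conjc z = 1 by rewrite mulc_conj z1 expr1n.
rewrite big_cons !hornerE /= exprS conjcM conjcB mulrACA (CP z z1).
rewrite mulrBr zz -xx; ring.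
Qed.

Lemma circle_measurable_polyJ p : circle_measurable (fun w => p.[conjc w]).
Proof.
apply: circle_continuous_measurable => t.
apply: (@continuous_comp _ _ _ (fun v : Cplx R => conjc v : Cplx R) (fun v : Cplx R => p.[v])).
  exact: continuous_conjc.
exact: poly_continuous.
Qed.

(* Writing [1 / (1 - z * conj w)] as a geometric series with remainder: on the
   circle [conj w = 1 / w], so a factor [conj w ^+ n] shifts Taylor coefficients. *)
Lemma reproducing_shift F u n : H2bv F u -> exists p, forall z, normc z < 1 ->
  circle_integral (fun w => (z * conjc w) ^+ n * conjc (szego z w) * u w) = F z - p.[z].
Proof.
move=> Fu; have [_ [Lu _]] := Fu.
have mX m : circle_measurable (fun w => conjc w ^+ m : Cplx R).
  have -> : (fun w : Cplx R => conjc w ^+ m : Cplx R) = (fun w => ('X^m : {poly Cplx R}).[conjc w]).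
    by apply/funext => w; rewrite hornerXn.
  exact: circle_measurable_polyJ.
have icm m : circle_integrable (fun w => conjc w ^+ m * u w).
  apply: (@circle_integrable_boundedM _ _ _ 1) => // t.
  by rewrite normcX normc_conj normc_expi expr1n.
have ick m z : normc z < 1 -> circle_integrable (fun w => (z * conjc w) ^+ m * conjc (szego z w) * u w).
  move=> z1; have [_ [Lk _]] := H2bv_szego z1; have [mk _] := (L2P _).1 Lk.
  apply: (@circle_integrable_eq _ (fun w => z ^+ m * (conjc w ^+ m * conjc (szego z w) * u w))).
    by move=> t; rewrite exprMn !mulrA.
  apply/circle_integrableZ.
  apply: (@circle_integrable_boundedM _ _ _ (1 - normc z)^-1) => // [|t].
    by apply: circle_measurableM => //; exact: circle_measurable_conj.
  rewrite normcM normcX !normc_conj normc_expi expr1n mul1r; apply: szego_bound => //.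
  by rewrite normc_expi.
elim: n => [|n [p IH]].
  exists 0 => z z1; rewrite horner0 subr0 -(reproducing Fu z1).
  by apply: circle_integral_eq => t _; rewrite expr0 mul1r mulrC.
exists (p + circle_integral (fun w => conjc w ^+ n * u w) *: 'X^n) => z z1.
rewrite !hornerE opprD addrA -(IH z z1).
have iz : circle_integrable (fun w => z ^+ n * (conjc w ^+ n * u w)) by exact: circle_integrableZ.
rewrite [X in _ - X]mulrC -(circle_integralZ _ (icm n)).
rewrite -(circle_integralB (ick n z z1) iz).
apply: circle_integral_eq => t _; rewrite conjc_szego.
have h : 1 - z * conjc (expi t) != 0.
  by apply: one_sub_neq0; rewrite normcM normc_conj normc_expi mulr1.
have E : (z * conjc (expi t)) ^+ n.+1 * (1 / (1 - z * conjc (expi t))) =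
   (z * conjc (expi t)) ^+ n * (1 / (1 - z * conjc (expi t))) - (z * conjc (expi t)) ^+ n.
  by rewrite exprS; field.
by rewrite E exprMn; ring.
Qed.

(** Reversal of the conjugated coefficients. Since r has degree strictly below n, a factor w is left
    over: the resulting function vanishes at 0, hence so does its mean against any element of
    H^2. *)
Lemma reverse_poly n r : (size r <= n)%N -> exists p, forall w, normc w = 1 ->
  w ^+ n * conjc r.[w] = w * p.[w].
Proof.
elim/poly_ind: r n => [|r c IH] n.
  by move=> _; exists 0 => w _; rewrite !horner0 conjc0 !mulr0.
rewrite size_MXaddC; case: ifPn => [/andP[/eqP -> /eqP ->] _|_].
  by exists 0 => w _; rewrite !hornerE conjc0 !mulr0.
case: n => // n /IH[p pP]; exists (p + conjc c *: 'X^n) => w w1.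
have ww : w * conjc w = 1 by rewrite mulc_conj w1 expr1n.
rewrite !hornerE conjcD conjcM exprS.
have -> : w * w ^+ n * (conjc r.[w] * conjc w + conjc c) =
  (w * conjc w) * (w ^+ n * conjc r.[w]) + w * (conjc c * w ^+ n) by ring.
by rewrite ww pP//; ring.
Qed.

Lemma range_spaceP s g : unimodular s ->
  range_space (fun z => (\prod_(zeta <- s) ('X - zeta%:P)).[z]) g <->
  exists k kb q, H2bv k kb /\ forall z, normc z < 1 ->
    g z = (\prod_(zeta <- s) ('X - zeta%:P)).[z] * k z + q.[z].
Proof.
move=> us; set a := \prod_(zeta <- s) _; pose N := size s.
have [C C0 CP] := circle_prod_conj us; rewrite -/a -/N in CP.
have [A aA] := poly_bound a.
have mca : circle_measurable (fun w => conjc a.[w]).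
  by apply: circle_measurable_conj; apply: circle_continuous_measurable => t; exact: poly_continuous.
have bca t : normc (conjc a.[expi t]) <= A by rewrite normc_conj aA// normc_expi.
split.
  move=> [f [Hf [ab [fb [bab bfb [Lu Hg [gb bgb orth]]]]]]].
  have gg : H2bv g gb := conj Hg bgb; have ff : H2bv f fb := conj Hf bfb.
  have aff := H2bv_polyM a ff.
  have [p pP] := reproducing_shift N aff.
  (* Orthogonality tested on the Szego kernel at z says that pairing conj a f with this kernel gives
     g z. On the circle conj a = conj w ^ N C a, so multiplication by z ^ N brings in
     [reproducing_shift] for a f. *)
  have key z : normc z < 1 -> z ^+ N * g z = C * (a.[z] * f z - p.[z]).
    move=> z1; have kk := H2bv_szego z1; have := orth _ _ kk.1 kk.2.
    have [_ [Lk _]] := kk; have [mk _] := (L2P _).1 Lk.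
    have bk t : normc (conjc (szego z (expi t))) <= (1 - normc z)^-1.
      by rewrite normc_conj; apply: szego_bound; rewrite ?normc_expi.
    have mck := circle_measurable_conj mk.
    have iu := circle_integrable_boundedM mck bk Lu.
    have ig := circle_integrable_boundedM mck bk gg.2.1.
    have [mfb _] := (L2P _).1 bfb.1.
    rewrite /inner => o0.
    have : circle_integral (fun w => conjc (szego z w) * (conjc (ab w) * fb w)) = g z.
      apply/eqP; rewrite -(reproducing gg z1) /inner -subr_eq0; apply/eqP.
      rewrite -[RHS]o0 -[X in _ - X](@circle_integral_eq _ (fun w => conjc (szego z w) * gb w)); last by move=> t _; rewrite mulrC.
      rewrite -(circle_integralB iu ig); apply: circle_integral_eq => t _.
      by rewrite -mulrBr mulrC.
    rewrite (@circle_integral_ae _ _ (fun w => conjc (szego z w) * (conjc a.[w] * fb w))); first last.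
    - by apply: (ae_mono (boundary_value_ae bab (boundary_value_poly a))) => t h pt; rewrite h.
    - by apply: circle_measurableM => //; apply: circle_measurableM.
    - apply: circle_measurableM => //; apply: circle_measurableM => //.
      by apply: circle_measurable_conj; have [] := (L2P _).1 bab.1.
    move=> <-; rewrite -(pP z z1).
    have La : L2 (fun w => conjc a.[w] * fb w) := L2M_bounded mca bca bfb.1.
    rewrite -(circle_integralZ _ (circle_integrable_boundedM mck bk La)).
    have zbd t : normc ((z * conjc (expi t)) ^+ N * conjc (szego z (expi t))) <= (1 - normc z)^-1.
      rewrite normcM normcX normcM normc_conj normc_expi mulr1; apply: le_trans (bk t).
      by rewrite ler_piMl ?normc_ge0// exprn_ile1 ?normc_ge0// ltW.
    rewrite -circle_integralZ; last first.
      apply: circle_integrable_boundedM zbd (aff.2.1); apply: circle_measurableM => //.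
      have -> : (fun w : Cplx R => (z * conjc w) ^+ N) = (fun w => ((z *: 'X) ^+ N).[conjc w]).
        by apply/funext => w; rewrite horner_exp hornerZ hornerX.
      exact: circle_measurable_polyJ.
    apply: circle_integral_eq => t _.
    have e1 : expi t * conjc (expi t) = 1 :> Cplx R by rewrite mulc_conj normc_expi expr1n.
    have aE : conjc a.[expi t] = conjc (expi t) ^+ N * (C * a.[expi t]).
      by rewrite -(CP _ (normc_expi t)) mulrA -exprMn (mulrC (conjc _)) e1 expr1n mul1r.
    by rewrite aE exprMn; ring.
  (* [a] has no zero at 0. With U z^N + V a = 1, the relation [key] becomes g = a (C U f + V g) - C
     U p. *)
  have cop : coprimep ('X^N) a.
    apply: coprimep_expl; rewrite coprimep_sym coprimepX /root; apply: circle_prod_neq0 => //.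
    by rewrite normc0.
  have /Bezout_eq1_coprimepP[[U V] /= UV] := cop.
  exists (fun z => (C *: U).[z] * f z + V.[z] * g z).
  exists (fun z => (C *: U).[z] * fb z + V.[z] * gb z), (- C *: (U * p)).
  split; first by apply: H2bvD; exact: H2bv_polyM.
  move=> z z1; have UVz : U.[z] * z ^+ N + V.[z] * a.[z] = 1.
    by have := congr1 (fun P : {poly Cplx R} => P.[z]) UV; rewrite !hornerE.
  rewrite -[LHS]mul1r -UVz mulrDl -mulrA key// !hornerE /=; ring.
move=> [k [kb [q [kk gE]]]].
have asz : size a = N.+1 by rewrite size_prod_XsubC.
have aD0 : a != 0 by rewrite -size_poly_eq0 asz.
(* The preimage is F = (z^N k + q1) / C: on the circle conj a F = conj z ^ N a (z^N k + q1) = g -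
   conj z ^ N r. The defect conj z ^ N r is orthogonal to H^2, because r has degree below N. *)
pose q1 := ('X^N * q) %/ a; pose r := ('X^N * q) %% a.
have qE : 'X^N * q = q1 * a + r by rewrite -divp_eq.
have rN : (size r <= N)%N by rewrite -ltnS -asz ltn_modp.
have qEz z : z ^+ N * q.[z] = q1.[z] * a.[z] + r.[z].
  by have := congr1 (fun P : {poly Cplx R} => P.[z]) qE; rewrite !hornerE.
have [rho rhoP] := reverse_poly rN.
pose F z := (C^-1 *: 'X^N : {poly Cplx R}).[z] * k z + (C^-1 *: q1).[z].
pose Fb z := (C^-1 *: 'X^N : {poly Cplx R}).[z] * kb z + (C^-1 *: q1).[z].
have FF : H2bv F Fb by apply: H2bvD; [exact: H2bv_polyM|exact: H2bv_poly].
have gg : H2bv g (fun z => a.[z] * kb z + q.[z]).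
  apply: (@H2bv_eq _ (fun z => a.[z] * k z + q.[z])); last by move=> z z1; rewrite gE.
  by apply: H2bvD; [exact: H2bv_polyM|exact: H2bv_poly].
exists F; split; first exact: FF.1.
exists (fun z => a.[z]), Fb; split; [exact: boundary_value_poly|exact: FF.2|].
split; [exact: L2M_bounded mca bca FF.2.1|exact: gg.1|].
exists (fun z => a.[z] * kb z + q.[z]); first exact: gg.2.
move=> k' kb' Hk bk'; have kk' : H2bv k' kb' := conj Hk bk'.
(* The defect is the conjugate of -(w rho(w)), so its pairing with [kb'] is the conjugate of a mean
   value at 0, where w rho(w) vanishes. *)
have hk := H2bv_polyM (- ('X * rho)) kk'.
rewrite /inner -(@circle_integral_eq _ (fun w => conjc ((- ('X * rho)).[w] * kb' w))).
  rewrite circle_integral_conj; last exact: (L2_circle_integrable hk.2.1).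
  by rewrite (mean_boundary_value hk) !hornerE ?mul0r ?oppr0 ?mul0r conjc0.
move=> t _; rewrite conjcM; congr (_ * _).
have e1 : expi t * conjc (expi t) = 1 :> Cplx R by rewrite mulc_conj normc_expi expr1n.
have eN : expi t ^+ N * conjc (expi t) ^+ N = 1 :> Cplx R by rewrite -exprMn e1 expr1n.
have eN0 : expi t ^+ N != 0 :> Cplx R by rewrite expf_neq0// expi_neq0.
rewrite !hornerE -rhoP ?normc_expi// conjcN conjcM conjcK conjcX.
apply: (mulfI eN0); rewrite mulrBr mulrA (CP _ (normc_expi t)) [expi t ^+ N * (_ + _)]mulrDr qEz /Fb !hornerE.
rewrite mulrN mulrA eN mul1r.
rewrite /=; field; exact: C0.
Qed.

End RangeSpace.

(** * Series of Szego kernels *)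

Section ComplexSeries.
Context {R : realType}.
Implicit Types (x : nat -> Cplx R) (y : nat -> R) (l : Cplx R).

Definition psum x n : Cplx R := \sum_(i < n) x i.

Lemma normc_psum_le x y m n : (forall i, normc (x i) <= y i) -> (m <= n)%N ->
  normc (psum x n - psum x m) <= \sum_(m <= i < n) y i.
Proof.
move=> xy mn; rewrite /psum -!(big_mkord xpredT x) (@big_cat_nat _ _ _ m)//= addrAC subrr add0r.
elim/big_ind2: _ => [|a1 a2 b1 b2 h1 h2|i _]; first by rewrite normc0.
  by apply: le_trans (le_normcD _ _) _; exact: lerD.
exact: xy.
Qed.

Lemma psum_cvgP x l : psum x @ \oo --> l <->
  forall e : R, 0 < e -> exists N, forall n, (N <= n)%N -> normc (psum x n - l) < e.
Proof.
rewrite cvg_cplxP; split=> H e /H; first by move=> [N _ NP]; exists N.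
by move=> [N NP]; exists N.
Qed.

Lemma psum_cvg_ex x y (B : R) : (forall i, normc (x i) <= y i) ->
  (forall n, \sum_(i < n) y i <= B) -> exists l, psum x @ \oo --> l.
Proof.
move=> xy yB.
have part (u : nat -> R) : (forall i, `|u i| <= normc (x i)) ->
    exists s : R, series u @ \oo --> s.
  move=> ux; apply/cvg_ex/normed_cvg; apply: nondecreasing_is_cvgn.
    by apply/nondecreasing_seqP => n; rewrite /= seriesSr lerDl.
  exists B => _ [n _ <-]; rewrite /= /series/= big_mkord; apply: le_trans (yB n).
  by apply: ler_sum => i _; apply: le_trans (ux i) (xy i).
have [a ua] := part _ (fun i => Re_le_normc (x i)).
have [b ub] := part _ (fun i => Im_le_normc (x i)).
exists (a +i* b); apply/psum_cvgP => e e0.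
have e2 : 0 < e / 2 by lra.
have /cvgrPdist_lt/(_ _ e2)[N1 _ P1] := ua.
have /cvgrPdist_lt/(_ _ e2)[N2 _ P2] := ub.
have re n : complex.Re (psum x n) = series (fun i => complex.Re (x i)) n.
  by rewrite /psum /series/= big_mkord; elim/big_ind2: _ => // ? [? ?] ? [? ?] /= -> ->.
have im n : complex.Im (psum x n) = series (fun i => complex.Im (x i)) n.
  by rewrite /psum /series/= big_mkord; elim/big_ind2: _ => // ? [? ?] ? [? ?] /= -> ->.
exists (maxn N1 N2) => n; rewrite geq_max => /andP[/P1 h1 /P2 h2].
apply: le_lt_trans (normc_le_ReIm _) _.
move: h1 h2; rewrite /= -re -im; case: (psum x n) => p q /= h1 h2.
by rewrite distrC (distrC q); lra.
Qed.

Lemma cvg_normc_le (s : nat -> Cplx R) l (tau : R) N : s @ \oo --> l ->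
  (forall n, (N <= n)%N -> normc (s n) <= tau) -> normc l <= tau.
Proof.
move=> /cvg_cplxP sl st; apply/ler_addgt0Pr => e /sl[M _ MP].
have := st (maxn N M) (leq_maxl _ _).
have : normc (s (maxn N M) - l) < e := MP _ (leq_maxr _ _).
by have := normc_sub_le l (s (maxn N M)); rewrite normcB; lra.
Qed.

Lemma psum_tail x y l n (tau : R) : psum x @ \oo --> l -> (forall i, normc (x i) <= y i) ->
  (forall m, (n <= m)%N -> \sum_(n <= i < m) y i <= tau) -> normc (l - psum x n) <= tau.
Proof.
move=> xl xy yt; apply: (@cvg_normc_le (fun m => psum x m - psum x n) _ _ n).
  apply/cvg_cplxP => e e0; move: xl => /cvg_cplxP/(_ e e0); apply: filterS => m.
  by rewrite opprB addrA subrK.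
by move=> m nm; apply: le_trans (normc_psum_le xy nm) (yt m nm).
Qed.

(** The ratio 1/8 makes the terms after n sum to at most eps n / 7, below the half of eps n against
    which [H2_multiplier_bounded] weighs this tail. *)
Definition eps (i : nat) : R := 8^-1 ^+ i.

Lemma eps_gt0 i : 0 < eps i.
Proof. by rewrite exprn_gt0// invr_gt0. Qed.

Lemma eps_sum n m : (n <= m)%N -> \sum_(n <= i < m) eps i <= 8 / 7 * eps n.
Proof.
move=> nm; suff -> : \sum_(n <= i < m) eps i = 8 / 7 * (eps n - eps m).
  by have := eps_gt0 m; lra.
rewrite -(subnKC nm); elim: (m - n)%N => [|k IH]; first by rewrite addn0 big_geq// subrr mulr0.
rewrite addnS big_nat_recr ?leq_addr//= IH.
have -> : eps (n + k).+1 = 8^-1 * eps (n + k) by rewrite /eps exprS.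
lra.
Qed.

Lemma eps_sum0 n : \sum_(i < n) eps i <= 8 / 7.
Proof.
have := eps_sum (leq0n n); rewrite big_mkord; have -> : eps 0 = 1 by rewrite /eps expr0.
lra.
Qed.

Lemma eps_sum_scale n m (b : R) : 0 <= b -> (n <= m)%N ->
  \sum_(n <= i < m) eps i * b <= 8 / 7 * eps n * b.
Proof. by move=> b0 nm; rewrite -mulr_suml ler_wpM2r// eps_sum. Qed.

Lemma eps_cauchy_schwarz (y : nat -> R) n : (forall i, 0 <= y i) ->
  (\sum_(i < n) eps i * y i) ^+ 2 <= 8 / 7 * \sum_(i < n) eps i * y i ^+ 2.
Proof.
move=> y0; suff H : (\sum_(i < n) eps i * y i) ^+ 2 <=
    (\sum_(i < n) eps i) * \sum_(i < n) eps i * y i ^+ 2.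
  apply: (le_trans H); rewrite ler_wpM2r ?eps_sum0//.
  by apply: sumr_ge0 => i _; rewrite mulr_ge0 ?sqr_ge0// ltW// eps_gt0.
elim: n => [|n IH]; first by rewrite !big_ord0 mul0r expr0n.
rewrite !big_ord_recr /=.
have E0 : 0 <= \sum_(i < n) eps i by apply: sumr_ge0 => i _; rewrite ltW// eps_gt0.
have X0 : 0 <= \sum_(i < n) eps i * y i.
  by apply: sumr_ge0 => i _; rewrite mulr_ge0// ltW// eps_gt0.
have Y0 : 0 <= \sum_(i < n) eps i * y i ^+ 2.
  by apply: sumr_ge0 => i _; rewrite mulr_ge0 ?sqr_ge0// ltW// eps_gt0.
move: IH E0 X0 Y0; have := eps_gt0 n; have := y0 n.
move: (eps n) (y n) (\sum_(i < n) eps i) (\sum_(i < n) eps i * y i) (\sum_(i < n) eps i * y i ^+ 2).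
move=> e v E X Y v0 e0 IH E0 X0 Y0.
(* AM-GM: [IH] gives X^2 <= E Y, and 4 E Y v^2 <= (E v^2 + Y)^2. *)
have key : 2 * X * v <= E * v ^+ 2 + Y.
  rewrite -(@ler_pXn2r _ 2)// ?nnegrE; last 2 first.
  - by rewrite !mulr_ge0.
  - by rewrite addr_ge0// mulr_ge0// sqr_ge0.
  apply: (@le_trans _ _ (4 * (E * Y) * v ^+ 2)).
    rewrite !exprMn (_ : 2 ^+ 2 = 4 :> R); last by ring.
    by rewrite ler_wpM2r ?sqr_ge0// ler_wpM2l.
  have := sqr_ge0 (E * v ^+ 2 - Y).
  have -> : (E * v ^+ 2 + Y) ^+ 2 = (E * v ^+ 2 - Y) ^+ 2 + 4 * (E * Y) * v ^+ 2 by ring.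
  lra.
have : e * (2 * X * v) <= e * (E * v ^+ 2 + Y) by rewrite ler_wpM2l// ltW.
have -> : (X + e * v) ^+ 2 = X ^+ 2 + e * (2 * X * v) + e ^+ 2 * v ^+ 2 by ring.
have -> : (E + e) * (Y + e * v ^+ 2) = E * Y + e * (E * v ^+ 2 + Y) + e ^+ 2 * v ^+ 2 by ring.
lra.
Qed.

End ComplexSeries.

Arguments eps : clear implicits.

(** * Series of normalized Szego kernels *)

Section SzegoSeries.
Context {R : realType}.
Notation mu := (@lebesgue_measure R).
Implicit Types (z : Cplx R).

Lemma sqnorm_szego z : normc z < 1 -> (sqnorm (szego z) <= ((1 - normc z)^-1)%:E)%E.
Proof.
move=> z1; have zz := H2bv_szego z1; have [_ [Lk _]] := zz.
have [mk [K kK]] := (L2P _).1 Lk.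
have ik : mu.-integrable (period R) (EFin \o (fun t => normc (szego z (expi t)) ^+ 2)).
  apply/integrableP; split; first by apply/measurable_EFinP; exact: (circle_measurable_normc mk).
  under eq_integral do rewrite gee0_abs ?lee_fin ?sqr_ge0//.
  by apply: le_lt_trans ((sqnorm_leP _ _).1 kK) (ltry _).
have -> : sqnorm (szego z) = (complex.Re (szego z z))%:E.
  rewrite -(reproducing zz z1) /inner /sqnorm /= EFinM /Rintegral.
  rewrite (_ : (fun t => (complex.Re (szego z (expi t) * conjc (szego z (expi t))))%:E) =
     EFin \o (fun t => normc (szego z (expi t)) ^+ 2)); last first.
    by apply/funext => t /=; rewrite mulc_conj.
  by rewrite fineK//; exact: (integrable_fin_num measurable_period ik).
rewrite lee_fin; apply: le_trans (szego_bound z1 (ltW z1)).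
exact: le_trans (ler_norm _) (Re_le_normc _).
Qed.

(** Passing from r v to v moves the denominator by at most 1 - r, and 1 - r <= |1 - r v|. The values
    on the circle therefore dominate the whole radius, uniformly in r. *)
Lemma szego_radial (a z : Cplx R) (r : R) : normc a < 1 -> normc z <= 1 -> 0 <= r <= 1 ->
  normc (szego a (r%:C * z)) <= 2 * normc (szego a z).
Proof.
move=> a1 z1 /andP[r0 r1]; rewrite /szego !mul1r !normcV.
set v := conjc a * z; have vv : normc v < 1.
  by rewrite normcM normc_conj; apply: le_lt_trans a1; rewrite ler_piMr ?normc_ge0.
have -> : conjc a * (r%:C * z) = r%:C * v by rewrite /v; ring.
have rv : normc (r%:C * v) = r * normc v by rewrite normcM normc_real ger0_norm.
have h1 : 1 - r <= normc (1 - r%:C * v).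
  have := normc_sub_le 1 (r%:C * v); rewrite normc1 rv.
  have : r * normc v <= r by rewrite ler_piMr// ltW.
  lra.
have h2 : normc (1 - v) <= 2 * normc (1 - r%:C * v).
  have -> : 1 - v = (1 - r%:C * v) + (r - 1)%:C * v by rewrite rmorphB rmorph1; ring.
  apply: le_trans (le_normcD _ _) _; rewrite [normc (_ * v)]normcM normc_real distrC.
  rewrite (ger0_norm (_ : 0 <= 1 - r)) ?subr_ge0//.
  have : (1 - r) * normc v <= 1 - r by rewrite ler_piMr// ?subr_ge0// ltW.
  lra.
have v0 : 0 < normc (1 - v) by exact/normc_gt0P/one_sub_neq0.
rewrite -[2 in leRHS]invrK -invfM lef_pV2 ?posrE; last 2 first.
- apply/normc_gt0P/one_sub_neq0; rewrite rv; apply: le_lt_trans vv.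
  by rewrite ler_piMl// normc_ge0.
- by rewrite mulr_gt0// invr_gt0.
by rewrite mulrC ler_pdivrMr// mulrC.
Qed.

(** Both 1 - |a| and 1 - |z| are at most 1 - |a| |z|, which is at most |1 - conj a z|. *)
Lemma szego_growth (a z : Cplx R) : normc a < 1 -> normc z < 1 ->
  Num.sqrt (1 - normc a) * normc (szego a z) <= (Num.sqrt (1 - normc z))^-1.
Proof.
move=> a1 z1; have a0 := normc_ge0 a; have z0 := normc_ge0 z.
have sz : 0 < Num.sqrt (1 - normc z) by rewrite sqrtr_gt0 subr_gt0.
rewrite /szego mul1r normcV.
have az : normc a * normc z < 1 by rewrite mulr_ilt1.
have D0 : 0 < normc (1 - conjc a * z).
  by apply/normc_gt0P/one_sub_neq0; rewrite normcM normc_conj.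
rewrite ler_pdivrMr// mulrC ler_pdivlMr//.
apply: (@le_trans _ _ (1 - normc a * normc z)); last first.
  by have := normc_sub_le 1 (conjc a * z); rewrite normc1 normcM normc_conj.
rewrite -(@ler_pXn2r _ 2)// ?nnegrE ?mulr_ge0 ?sqrtr_ge0//; last by rewrite subr_ge0 ltW.
rewrite exprMn !sqr_sqrtr ?subr_ge0 ?(ltW a1) ?(ltW z1)// expr2.
have h1 : normc a * normc z <= normc a by rewrite ler_piMr// ltW.
have h2 : normc a * normc z <= normc z by rewrite ler_piMl// ltW.
by apply: ler_pM; rewrite ?subr_ge0 ?(ltW a1) ?(ltW z1)//; lra.
Qed.

Lemma tail_small (y : nat -> R) (B e : R) : (forall i, 0 <= y i) ->
  (forall n, \sum_(i < n) y i <= B) -> 0 < e ->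
  exists N, forall m, (N <= m)%N -> \sum_(N <= i < m) y i <= e.
Proof.
move=> y0 yB e0; pose x i : Cplx R := (y i)%:C.
have xy i : normc (x i) <= y i by rewrite normc_real ger0_norm.
have [l] := psum_cvg_ex xy yB.
move=> /psum_cvgP/(_ (e / 2) ltac:(lra))[N NP]; exists N => m Nm.
have := NP m Nm; have := NP N (leqnn N).
have E n : psum x n = (\sum_(i < n) y i)%:C by rewrite rmorph_sum.
have := le_normcD (psum x m - l) (l - psum x N).
rewrite subrKA (normcB l) !E -(rmorphB (real_complex R)) normc_real -!(big_mkord xpredT y).
rewrite (@big_cat_nat _ _ _ N 0 m)//= addrAC subrr add0r => h h1 h2.
by apply: le_trans (ler_norm _) _; lra.
Qed.

Variables (w : nat -> Cplx R) (c : nat -> R).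
Hypothesis w1 : forall i, normc (w i) < 1.
Hypothesis cw : forall i, `|c i| <= eps R i * Num.sqrt (1 - normc (w i)).

(** The square norm of szego (w i) is at most 1 / (1 - |w i|), so [cw] bounds the L^2 norm of this
    term by eps i. The signs of the c i remain free. *)
Definition term i z : Cplx R := (c i)%:C * szego (w i) z.

Lemma term_bound i z : normc z < 1 -> normc (term i z) <= eps R i * (Num.sqrt (1 - normc z))^-1.
Proof.
move=> z1; rewrite normcM normc_real.
apply: (@le_trans _ _ (eps R i * Num.sqrt (1 - normc (w i)) * normc (szego (w i) z))).
  by rewrite ler_wpM2r ?normc_ge0.
by rewrite -mulrA ler_wpM2l ?(ltW (eps_gt0 _))// szego_growth.
Qed.

Definition circ_weight i (t : R) : R :=
  Num.sqrt (1 - normc (w i)) * normc (szego (w i) (expi t)).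

Lemma circ_weight_ge0 i t : 0 <= circ_weight i t.
Proof. by rewrite mulr_ge0 ?sqrtr_ge0 ?normc_ge0. Qed.

Lemma term_circle i t : normc (term i (expi t)) <= eps R i * circ_weight i t.
Proof. by rewrite normcM normc_real mulrA ler_wpM2r ?normc_ge0. Qed.

Lemma term_radial i t (r : R) : 0 <= r <= 1 ->
  normc (term i (r%:C * expi t)) <= 2 * (eps R i * circ_weight i t).
Proof.
move=> hr; rewrite normcM normc_real.
apply: (@le_trans _ _ (eps R i * Num.sqrt (1 - normc (w i)) * (2 * normc (szego (w i) (expi t))))).
  apply: ler_pM => //; first exact: normc_ge0.
  by apply: szego_radial => //; rewrite normc_expi.
by rewrite /circ_weight le_eqVlt; apply/orP; left; apply/eqP; ring.
Qed.

(** A majorant with finite integral, hence finite almost everywhere. Wherever it is finite it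
    controls, by Cauchy-Schwarz with weights eps, the series on the circle and all its dilations. *)
Definition weight (t : R) : \bar R :=
  (\sum_(0 <= i <oo) (eps R i * circ_weight i t ^+ 2)%:E)%E.

Lemma weight_term_ge0 i t : 0 <= eps R i * circ_weight i t ^+ 2.
Proof. by rewrite mulr_ge0 ?sqr_ge0// ltW// eps_gt0. Qed.

Lemma measurable_weight_term i :
  measurable_fun (period R) (fun t => (eps R i * circ_weight i t ^+ 2)%:E).
Proof.
apply/measurable_EFinP; have [_ [Lk _]] := H2bv_szego (w1 i); have [mk _] := (L2P _).1 Lk.
have := measurable_funM (@measurable_cst _ _ _ _ (period R) (eps R i * (1 - normc (w i)))) (circle_measurable_normc mk).
congr measurable_fun; apply/funext => t /=.
by rewrite /circ_weight exprMn sqr_sqrtr ?mulrA// subr_ge0 ltW.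
Qed.

Lemma measurable_weight : measurable_fun (period R) weight.
Proof.
apply: (@ge0_emeasurable_sum _ _ _ _ _ xpredT) => [i t _ _|i _].
  by rewrite lee_fin weight_term_ge0.
exact: measurable_weight_term.
Qed.

Lemma weight_ge0 t : (0 <= weight t)%E.
Proof. by apply: nneseries_ge0 => i _ _; rewrite lee_fin weight_term_ge0. Qed.

Lemma integral_weight : (\int[mu]_(t in period R) weight t <= (2 * pi * (8 / 7))%:E)%E.
Proof.
rewrite /weight integral_nneseries; first last.
- by move=> i t _; rewrite lee_fin weight_term_ge0.
- exact: measurable_weight_term.
- exact: measurable_period.
have it i : (\int[mu]_(t in period R) (eps R i * circ_weight i t ^+ 2)%:E <= (eps R i * (2 * pi))%:E)%E.
  have [_ [Lk _]] := H2bv_szego (w1 i); have [mk _] := (L2P _).1 Lk.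
  have d0 : 0 < 1 - normc (w i) by rewrite subr_gt0.
  have tE t : (eps R i * circ_weight i t ^+ 2)%:E =
      ((eps R i * (1 - normc (w i)))%:E * (normc (szego (w i) (expi t)) ^+ 2)%:E)%E.
    by rewrite -EFinM /circ_weight exprMn sqr_sqrtr ?mulrA// ltW.
  under eq_integral do rewrite tE.
  rewrite (ge0_integralZl_EFin _ measurable_period); first last.
  - by rewrite mulr_ge0// ltW// eps_gt0.
  - by apply/measurable_EFinP; exact: (circle_measurable_normc mk).
  - by move=> t _; rewrite lee_fin sqr_ge0.
  have /sqnorm_leP h := sqnorm_szego (w1 i).
  apply: (@le_trans _ _ ((eps R i * (1 - normc (w i)))%:E * (2 * pi * (1 - normc (w i))^-1)%:E)%E).
    by rewrite lee_wpmul2l// lee_fin mulr_ge0// ltW// eps_gt0.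
  rewrite -EFinM lee_fin le_eqVlt; apply/orP; left; apply/eqP; field; exact: lt0r_neq0.
apply: lime_le.
  by apply: is_cvg_nneseries => i _ _; apply: integral_ge0 => t _; rewrite lee_fin weight_term_ge0.
apply: nearW => n; apply: (@le_trans _ _ (\sum_(0 <= i < n) (eps R i * (2 * pi))%:E)%E).
  by apply: lee_sum => i _; exact: it.
rewrite sumEFin lee_fin big_mkord -mulr_suml mulrC ler_wpM2l ?eps_sum0//.
by rewrite ltW// twopi_gt0.
Qed.

Lemma weight_fin : {ae mu, forall t, period R t -> exists b : R, weight t = b%:E}.
Proof.
have iw : mu.-integrable (period R) weight.
  apply/integrableP; split; first exact: measurable_weight.
  under eq_integral do rewrite gee0_abs ?weight_ge0//.
  exact: le_lt_trans integral_weight (ltry _).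
apply: (ae_mono (integrable_ae measurable_period iw)) => t h /h /fineK <-.
by exists (fine (weight t)).
Qed.

Lemma weight_psum t (b : R) n : weight t = b%:E ->
  \sum_(i < n) eps R i * circ_weight i t ^+ 2 <= b.
Proof.
move=> wb; rewrite -lee_fin -wb -sumEFin -(big_mkord xpredT (fun i => (eps R i * circ_weight i t ^+ 2)%:E)).
by apply: nneseries_lim_ge => i _ _; rewrite lee_fin weight_term_ge0.
Qed.

Lemma weight_psum1 t (b : R) n : weight t = b%:E ->
  \sum_(i < n) eps R i * circ_weight i t <= 8 / 7 + b.
Proof.
move=> wb; apply: (@le_trans _ _ (\sum_(i < n) (eps R i + eps R i * circ_weight i t ^+ 2))).
  apply: ler_sum => i _; have := @eps_gt0 R i; have := sqr_ge0 (circ_weight i t - 1).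
  rewrite sqrrB => h e0.
  rewrite -[X in X + _]mulr1 -mulrDr ler_wpM2l ?(ltW e0)//.
  have := circ_weight_ge0 i t; lra.
by rewrite big_split /= lerD ?eps_sum0// weight_psum.
Qed.

(** 32 / 7 = 4 * (8 / 7): the square of the factor 2 from [term_radial] times the constant of
    [eps_cauchy_schwarz]. *)
Lemma weight_bound t (b : R) (x : nat -> Cplx R) (l : Cplx R) : weight t = b%:E ->
  psum x @ \oo --> l -> (forall i, normc (x i) <= 2 * (eps R i * circ_weight i t)) ->
  normc l ^+ 2 <= 32 / 7 * b.
Proof.
move=> wb xl xw; have b0 : 0 <= b by rewrite -lee_fin -wb weight_ge0.
have C0 : 0 <= 32 / 7 * b by rewrite mulr_ge0.
rewrite -[leRHS]sqr_sqrtr// ler_pXn2r ?nnegrE ?normc_ge0 ?sqrtr_ge0//.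
apply: (cvg_normc_le (N := 0) xl) => n _.
rewrite -(@ler_pXn2r _ 2) ?nnegrE ?normc_ge0 ?sqrtr_ge0// sqr_sqrtr//.
have := normc_psum_le xw (leq0n n); rewrite {2}/psum big_ord0 subr0 big_mkord -mulr_sumr => h.
have S0 : 0 <= \sum_(i < n) eps R i * circ_weight i t.
  by apply: sumr_ge0 => i _; rewrite mulr_ge0 ?circ_weight_ge0// ltW// eps_gt0.
apply: (@le_trans _ _ ((2 * \sum_(i < n) eps R i * circ_weight i t) ^+ 2)).
  by rewrite ler_pXn2r ?nnegrE ?normc_ge0 ?mulr_ge0.
have := eps_cauchy_schwarz n (fun i => circ_weight_ge0 i t); have := weight_psum n wb.
rewrite exprMn (_ : 2 ^+ 2 = 4 :> R); last by ring.
lra.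
Qed.

Lemma sqnorm_weight u : circle_measurable u ->
  {ae mu, forall t, period R t -> forall b, weight t = b%:E ->
     normc (u (expi t)) ^+ 2 <= 32 / 7 * b} ->
  (sqnorm u <= (32 / 7 * (8 / 7))%:E)%E.
Proof.
move=> mu_ ub; apply/sqnorm_leP.
apply: (@le_trans _ _ (\int[mu]_(t in period R) ((32 / 7)%:E * weight t))%E).
  apply: (ae_ge0_le_integral measurable_period).
  - by move=> t _; rewrite lee_fin sqr_ge0.
  - by apply/measurable_EFinP; exact: (circle_measurable_normc mu_).
  - by move=> t _; apply: mule_ge0; [rewrite lee_fin|exact: weight_ge0].
  - by apply: measurable_funeM; exact: measurable_weight.
  - apply: (ae_mono2 ub weight_fin) => t h1 h2 pt; have [b wb] := h2 pt.
    by rewrite wb -EFinM lee_fin; exact: h1.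
rewrite (ge0_integralZl_EFin _ measurable_period); first last.
- by [].
- exact: measurable_weight.
- by move=> t _; exact: weight_ge0.
apply: (@le_trans _ _ ((32 / 7)%:E * (2 * pi * (8 / 7))%:E)%E).
  by rewrite lee_wpmul2l ?lee_fin//; exact: integral_weight.
by rewrite -EFinM lee_fin le_eqVlt; apply/orP; left; apply/eqP; ring.
Qed.

Lemma term_cdiff i z : normc z <= 1 -> cdiff (term i) z.
Proof.
move=> z1; apply/derivable_cdiff; apply: derivableM; first exact: derivable_cst.
exact/derivable_cdiff/szego_cdiff.
Qed.

Lemma psum_term_continuous n z : normc z <= 1 ->
  {for z, continuous (fun v : Cplx R => psum (term^~ v) n)}.
Proof.
move=> z1; elim: n => [|n IH].
  apply/ccontP => e e0; exists 1 => // v _; by rewrite /psum !big_ord0 subrr normc0.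
have -> : (fun v : Cplx R => psum (term^~ v) n.+1) = (fun v => psum (term^~ v) n + term n v).
  by apply/funext => v; rewrite /psum big_ord_recr.
exact: (continuousD IH (cdiff_continuous (term_cdiff n z1))).
Qed.

Lemma term_psum_ex z : normc z < 1 -> exists l : Cplx R, psum (term^~ z) @ \oo --> l.
Proof.
move=> z1; apply: (psum_cvg_ex (B := 8 / 7 * (Num.sqrt (1 - normc z))^-1) (fun i => term_bound i z1)).
by move=> n; rewrite -mulr_suml ler_wpM2r ?invr_ge0 ?sqrtr_ge0// eps_sum0.
Qed.

(** The derivative of [term i]. *)
Definition dterm i z : Cplx R := (c i)%:C * (conjc (w i) / (1 - conjc (w i) * z) ^+ 2).

Lemma den_bound i z (d : R) : normc z <= 1 - d -> d <= normc (1 - conjc (w i) * z).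
Proof.
move=> zd; have := normc_sub_le 1 (conjc (w i) * z); rewrite normc1 normcM normc_conj.
have : normc (w i) * normc z <= normc z by rewrite ler_piMl ?normc_ge0// ltW.
lra.
Qed.

Lemma c_bound i : `|c i| <= eps R i.
Proof.
apply: (le_trans (cw i)); rewrite ler_piMr ?(ltW (eps_gt0 _))//.
by rewrite -[leRHS]sqrtr1 ler_sqrt// gerBl normc_ge0.
Qed.

Lemma dterm_bound i z (d : R) : 0 < d -> normc z <= 1 - d ->
  normc (dterm i z) <= eps R i * d ^- 2.
Proof.
move=> d0 zd; rewrite !normcM normc_real normcV normcX normc_conj.
apply: ler_pM; rewrite ?mulr_ge0 ?invr_ge0 ?exprn_ge0 ?normc_ge0 ?c_bound//.
rewrite -[leRHS]mul1r; apply: ler_pM; rewrite ?invr_ge0 ?exprn_ge0 ?normc_ge0 ?(ltW (w1 i))//.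
have db := den_bound i zd.
rewrite lef_pV2 ?posrE ?exprn_gt0//; last exact: lt_le_trans db.
by rewrite ler_pXn2r// nnegrE ?normc_ge0// ltW.
Qed.

(** The remainder is an explicit fraction with numerator c conj(w)^2 (z' - z)^2 and three
    denominator factors of modulus at least d. It is quadratic in z' - z and summable in i, which
    permits termwise differentiation. *)
Lemma term_remainder i z z' (d : R) : 0 < d -> normc z <= 1 - d -> normc z' <= 1 - d ->
  normc (term i z' - term i z - dterm i z * (z' - z)) <= eps R i * (normc (z' - z) ^+ 2 / d ^+ 3).
Proof.
move=> d0 zd zd'; have b := den_bound i zd; have b' := den_bound i zd'.
have n0 : 1 - conjc (w i) * z != 0.
  by apply/eqP => h; move: b; rewrite h normc0 leNgt d0.
have n0' : 1 - conjc (w i) * z' != 0.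
  by apply/eqP => h; move: b'; rewrite h normc0 leNgt d0.
have -> : term i z' - term i z - dterm i z * (z' - z) =
  (c i)%:C * (conjc (w i) ^+ 2 * (z' - z) ^+ 2 * ((1 - conjc (w i) * z') * (1 - conjc (w i) * z) ^+ 2)^-1).
  by rewrite /term /dterm /szego; field; rewrite n0 n0'.
rewrite normcM normc_real; apply: ler_pM; rewrite ?normc_ge0 ?c_bound//.
rewrite normcM; apply: ler_pM; rewrite ?normc_ge0//.
  rewrite normcM !normcX normc_conj ler_piMl ?sqr_ge0// exprn_ile1 ?normc_ge0//; exact: ltW.
rewrite normcV lef_pV2 ?posrE ?exprn_gt0//; last first.
  by rewrite normc_gt0P// mulf_neq0// expf_neq0.
rewrite normcM normcX exprS; apply: ler_pM => //; rewrite ?exprn_ge0 ?(ltW d0)//.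
by rewrite ler_pXn2r// nnegrE ?normc_ge0// ltW.
Qed.

Lemma psum_lin (x1 x2 x3 : nat -> Cplx R) (l1 l2 l3 k : Cplx R) :
  psum x1 @ \oo --> l1 -> psum x2 @ \oo --> l2 -> psum x3 @ \oo --> l3 ->
  psum (fun i => x1 i - x2 i - x3 i * k) @ \oo --> l1 - l2 - l3 * k.
Proof.
move=> h1 h2 h3; have -> : psum (fun i => x1 i - x2 i - x3 i * k) =
    (fun n => psum x1 n - psum x2 n - psum x3 n * k).
  by apply/funext => n; rewrite /psum mulr_suml !sumrB.
apply: cvgB; first by apply: cvgB; [exact: h1|exact: h2].
by apply: cvgM; [exact: h3|exact: cvg_cst].
Qed.

(* A series of Szego kernels with geometric weights: |1 - v| <= 2 |1 - r v|
   dominates the radial limits on the circle. *)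
Lemma szego_series : exists f fb, H2bv f fb /\ forall n z, normc z < 1 ->
  normc (f z - psum (term^~ z) n) <= 8 / 7 * eps R n / Num.sqrt (1 - normc z).
Proof.
have [f fP] : exists f : Cplx R -> Cplx R, forall z, normc z < 1 -> psum (term^~ z) @ \oo --> f z.
  have : forall z : Cplx R, exists l : Cplx R, normc z < 1 -> psum (term^~ z) @ \oo --> l.
    move=> z; case: (pselect (normc z < 1)) => [z1|nz]; last by exists 0.
    by have [l hl] := term_psum_ex z1; exists l.
  by move=> /choice[f fP]; exists f.
(* An upper limit is defined and measurable without any convergence; it is the true limit where
   [weight] is finite, hence almost everywhere. *)
pose fb z : Cplx R := fine (limn_esup (fun n => (complex.Re (psum (term^~ z) n))%:E))
  +i* fine (limn_esup (fun n => (complex.Im (psum (term^~ z) n))%:E)).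
have fbP t (b : R) : weight t = b%:E -> psum (term^~ (expi t)) @ \oo --> fb (expi t).
  move=> wb; have [l tl] := psum_cvg_ex (fun i => term_circle i t) (fun n => weight_psum1 n wb).
  suff -> : fb (expi t) = l by [].
  have cRe : (fun n => (complex.Re (psum (term^~ (expi t)) n))%:E) @ \oo --> (complex.Re l)%:E.
    apply/cvg_EFin; first by near=> n.
    by apply: (cvg_comp _ _ tl); exact: continuous_Re.
  have cIm : (fun n => (complex.Im (psum (term^~ (expi t)) n))%:E) @ \oo --> (complex.Im l)%:E.
    apply/cvg_EFin; first by near=> n.
    by apply: (cvg_comp _ _ tl); exact: continuous_Im.
  rewrite /fb (cvg_limn_einf_sup cRe).2 (cvg_limn_einf_sup cIm).2 /=.
  by case: l {tl cRe cIm}.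
have mS n : circle_measurable (fun z => psum (term^~ z) n).
  by apply: circle_continuous_measurable => t; apply: psum_term_continuous; rewrite normc_expi.
have mfb : circle_measurable fb.
  split.
    apply: (@measurableT_comp _ _ _ _ _ _ (@fine R)); first exact: fine_measurable.
    apply: measurable_fun_limn_esup => n; apply/measurable_EFinP; have [] := mS n.
    by [].
  apply: (@measurableT_comp _ _ _ _ _ _ (@fine R)); first exact: fine_measurable.
  apply: measurable_fun_limn_esup => n; apply/measurable_EFinP; have [] := mS n.
  by [].
have af : analytic f.
  move=> z /unit_discE z1; apply/derivable_cdiff.
  pose d := (1 - normc z) / 2; have d0 : 0 < d by rewrite /d; lra.
  have zd : normc z <= 1 - d by rewrite /d; lra.
  have [L dL] : exists L : Cplx R, psum (dterm^~ z) @ \oo --> L.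
    apply: (psum_cvg_ex (B := 8 / 7 * d ^- 2) (fun i => dterm_bound i d0 zd)) => n.
    by rewrite -mulr_suml ler_wpM2r ?invr_ge0 ?exprn_ge0 ?(ltW d0)// eps_sum0.
  (* The first bound keeps z' in the disc of radius 1 - d. The remainders sum to at most 8/7 |z' -
     z|^2 / d^3, and |z' - z| < e d^3 / 2 makes this less than e |z' - z|. *)
  exists L => e e0; exists (Num.min d (e * d ^+ 3 / 2)).
    by rewrite lt_min d0 divr_gt0// mulr_gt0// exprn_gt0.
  move=> z'; rewrite lt_min => /andP[h1 h2].
  have zd' : normc z' <= 1 - d.
    by have := le_normcD (z' - z) z; rewrite subrK; move: h1; rewrite /d; lra.
  have z1' : normc z' < 1 by lra.
  have lim := psum_lin (k := z' - z) (fP z' z1') (fP z z1) dL.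
  apply: (@le_trans _ _ (8 / 7 * (normc (z' - z) ^+ 2 / d ^+ 3))).
    apply: (cvg_normc_le (N := 0) lim) => n _.
    have := normc_psum_le (fun i => term_remainder i d0 zd zd') (leq0n n).
    rewrite {2}/psum big_ord0 subr0 big_mkord => h; apply: (le_trans h).
    rewrite -mulr_suml ler_wpM2r ?eps_sum0// divr_ge0 ?exprn_ge0 ?normc_ge0//.
    exact: ltW.
  rewrite expr2; have d3 : 0 < d ^+ 3 by rewrite exprn_gt0.
  have -> : 8 / 7 * (normc (z' - z) * normc (z' - z) / d ^+ 3) =
     (8 / 7 * normc (z' - z) / d ^+ 3) * normc (z' - z) by field; rewrite gt_eqF.
  rewrite ler_wpM2r ?normc_ge0// ler_pdivrMr//.
  by move: h2; have := mulr_gt0 e0 d3; lra.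
exists f, fb; split; first split; first split => //.
- exists (32 / 7 * (8 / 7)) => r /andP[r0 r1].
  apply: sqnorm_weight; first by apply: analytic_circle_measurable; rewrite ?r0.
  apply: aeW => t _ b wb; apply: (weight_bound wb (fP _ _)).
    by apply: dilation_disc; rewrite ?r0 ?normc_expi.
  by move=> i; apply: term_radial; rewrite r0 ltW.
- split.
    apply/L2P; split => //; exists (32 / 7 * (8 / 7)); apply: sqnorm_weight => //.
    apply: aeW => t _ b wb; apply: (weight_bound wb (fbP _ _ wb)) => i.
    by have := @term_radial i t 1; rewrite mul1r; apply; rewrite ler01 lexx.
  apply: (ae_mono weight_fin) => t h /h[b wb]; apply/radial_cvgP => e e0.
  have y0 i : 0 <= eps R i * circ_weight i t.
    by rewrite mulr_ge0 ?circ_weight_ge0// ltW// eps_gt0.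
  (* The tail costs 2 (e / 8) on the radius and e / 8 on the circle, the finite sum e / 2: in total
     7 e / 8. *)
  have e8 : 0 < e / 8 by lra.
  have [N NP] := tail_small y0 (fun n => weight_psum1 n wb) e8.
  have e2 : 0 < e / 2 by lra.
  have et1 : normc (expi t) <= 1 by rewrite normc_expi.
  have [d d0 dP] := (ccontP _ _).2 (psum_term_continuous (n := N) et1) (e / 2) e2.
  exists (Num.min d 1); first by rewrite lt_min d0 ltr01.
  move=> r /andP[rd r1].
  have m1 : Num.min d 1 <= d by rewrite ge_min lexx.
  have m2 : Num.min d 1 <= 1 by rewrite ge_min lexx orbT.
  have r0 : 0 <= r by lra.
  have zr : normc (r%:C * expi t) < 1 by apply: dilation_disc; rewrite ?r0 ?normc_expi.
  have t1 : normc (f (r%:C * expi t) - psum (term^~ (r%:C * expi t)) N) <= 2 * (e / 8).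
    apply: (psum_tail (fP _ zr) (y := fun i => 2 * (eps R i * circ_weight i t))).
      by move=> i; apply: term_radial; rewrite r0 ltW.
    by move=> m /NP h'; rewrite -mulr_sumr ler_wpM2l.
  have t2 : normc (fb (expi t) - psum (term^~ (expi t)) N) <= e / 8.
    exact: (psum_tail (fbP _ _ wb) (fun i => term_circle i t)).
  have t3 : normc (psum (term^~ (r%:C * expi t)) N - psum (term^~ (expi t)) N) < e / 2.
    apply: dP; rewrite -[X in _ - X]mul1r -mulrBl normcM normc_expi mulr1.
    by rewrite -(rmorph1 (real_complex R)) -rmorphB normc_real distrC gtr0_norm; lra.
  have h1 := le_normcD (f (r%:C * expi t) - psum (term^~ (r%:C * expi t)) N)
    (psum (term^~ (r%:C * expi t)) N - psum (term^~ (expi t)) N).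
  have h2 := le_normcD (f (r%:C * expi t) - psum (term^~ (expi t)) N)
    (psum (term^~ (expi t)) N - fb (expi t)).
  move: h1 h2; rewrite !subrKA (normcB (psum _ _) (fb _)).
  by move: t1 t2 t3; lra.
- move=> n z z1; apply: (psum_tail (fP z z1) (fun i => term_bound i z1)) => m nm.
  by apply: eps_sum_scale => //; rewrite invr_ge0 sqrtr_ge0.
Unshelve. all: by end_near. Qed.

End SzegoSeries.

(** * Multipliers *)

Section Multipliers.
Context {R : realType}.
Implicit Types (f g k : Cplx R -> Cplx R) (z : Cplx R) (p q : {poly Cplx R}).

Lemma normc_radius (zeta : Cplx R) (r : R) : normc zeta = 1 -> 0 < r -> normc (r%:C * zeta) = r.
Proof. by move=> z1 r0; rewrite normcM normc_real z1 mulr1 gtr0_norm. Qed.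

Lemma normc_radial_sub (zeta : Cplx R) (r : R) : normc zeta = 1 -> r < 1 ->
  normc (r%:C * zeta - zeta) = 1 - r.
Proof.
move=> z1 r1; rewrite -[X in _ - X]mul1r -mulrBl normcM z1 mulr1.
by rewrite -(rmorph1 (real_complex R)) -rmorphB normc_real distrC gtr0_norm// subr_gt0.
Qed.

(* A pole of p / prod on the circle would be at least as large as 1 / (1 - r). *)
Lemma circle_prod_dvd s p : unimodular s ->
  (forall zeta, zeta \in s -> exists A : R, forall r : R, 0 < r < 1 ->
    normc (p.[r%:C * zeta] / (\prod_(zeta <- s) ('X - zeta%:P)).[r%:C * zeta])
      <= A / Num.sqrt (1 - r)) ->
  exists q, p = (\prod_(zeta <- s) ('X - zeta%:P)) * q.
Proof.
elim: s p => [|x s IH] p us H; first by exists p; rewrite big_nil mul1r.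
have [x1 us'] := unimodular_cons us.
set b := \prod_(zeta <- s) ('X - zeta%:P) in IH *.
have [B bB] := poly_bound b; have [A AP] := H x (mem_head _ _).
have B0 : 0 <= B by apply: le_trans (bB 0 _); rewrite ?normc_ge0 ?normc0.
have bE r : (\prod_(zeta <- x :: s) ('X - zeta%:P)).[r] = (r - x) * b.[r].
  by rewrite big_cons !hornerE.
have px : p.[x] = 0.
  apply: normc_small_eq => e e0; rewrite subr0.
  have [d d0 dP] := (ccontP _ _).2 (@poly_continuous R p x) (e / 2) ltac:(lra).
  pose K := `|A| * B + 1; have K0 : 0 < K by rewrite ltr_wpDl ?mulr_ge0.
  (* With 1 - r = m / 2, both |p(r x) - p(x)| and the bound K sqrt(1 - r) on |p(r x)| are at most e
     / 2. *)
  pose m := Num.min d (Num.min 1 ((e / (2 * K)) ^+ 2)).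
  have m0 : 0 < m by rewrite lt_min d0/= lt_min ltr01 exprn_gt0// divr_gt0// mulr_gt0.
  have m1 : m <= d by rewrite ge_min lexx.
  have m2 : m <= 1 by rewrite /m !ge_min lexx orbT.
  have m3 : m <= (e / (2 * K)) ^+ 2 by rewrite /m !ge_min lexx !orbT.
  pose r := 1 - m / 2; have r0 : 0 < r by rewrite /r; lra.
  have r1 : r < 1 by rewrite /r; lra.
  have rE : 1 - r = m / 2 by rewrite /r; ring.
  have h1 : normc (p.[r%:C * x] - p.[x]) < e / 2.
    by apply: dP; rewrite normc_radial_sub// rE; lra.
  have := AP r ltac:(by rewrite r0 r1); rewrite bE normcM normcV normcM normc_radial_sub//.
  have s0 : 0 < Num.sqrt (1 - r) by rewrite sqrtr_gt0 rE; lra.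
  have s2 : Num.sqrt (1 - r) ^+ 2 = 1 - r by rewrite sqr_sqrtr// rE; lra.
  have br0 : 0 < normc b.[r%:C * x].
    by apply/normc_gt0P/circle_prod_neq0 => //; rewrite normc_radius.
  have br1 : normc b.[r%:C * x] <= B by apply: bB; rewrite normc_radius// ltW.
  rewrite ler_pdivrMr ?mulr_gt0//; last by rewrite -s2 exprn_gt0.
  rewrite -[X in _ * (X * _)]s2 => h2.
  have h3 : normc p.[r%:C * x] <= K * Num.sqrt (1 - r).
    apply: (le_trans h2).
    have -> : A / Num.sqrt (1 - r) * (Num.sqrt (1 - r) ^+ 2 * normc b.[r%:C * x]) =
      A * normc b.[r%:C * x] * Num.sqrt (1 - r) by field; rewrite gt_eqF.
    rewrite ler_wpM2r ?(ltW s0)//; apply: (@le_trans _ _ (`|A| * B)); last by rewrite /K lerDl.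
    apply: le_trans (ler_norm _) _; rewrite normrM ler_wpM2l// gtr0_norm//.
  have h4 : Num.sqrt (1 - r) <= e / (2 * K).
    rewrite -(@ler_pXn2r _ 2)// ?nnegrE ?(ltW s0) ?divr_ge0 ?mulr_ge0 ?(ltW e0) ?(ltW K0)//.
    by rewrite s2 rE; lra.
  have h5 : K * Num.sqrt (1 - r) <= e / 2.
    apply: (@le_trans _ _ (K * (e / (2 * K)))); first by rewrite ler_wpM2l// ltW.
    by rewrite le_eqVlt; apply/orP; left; apply/eqP; field; rewrite gt_eqF.
  have := normc_sub_le p.[x] p.[r%:C * x]; rewrite normcB; lra.
have /factor_theorem[p1 pE] : root p x by rewrite /root px.
have [|q qE] := IH p1 us'; last first.
  by exists q; rewrite big_cons pE qE mulrC mulrA.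
(* The common factor v - x cancels along every radius, as v = r zeta lies inside the disc and x on
   the circle; the growth hypothesis thus passes to p1 even if zeta = x. *)
move=> zeta zs; have [A' AP'] := H zeta ltac:(by rewrite inE zs orbT); exists A' => r /andP[r0 r1].
have z1 := us' _ zs.
have nz : r%:C * zeta - x != 0.
  rewrite subr_eq0; apply/eqP => h; move: r1.
  by rewrite -(normc_radius z1 r0) h x1 ltxx.
have := AP' r ltac:(by rewrite r0 r1); rewrite bE pE !hornerE.
by rewrite (mulrC p1.[_]) -mulf_div divff// mul1r.
Qed.

(* If psi is unbounded at points w_n, choose the signs of the coefficients of a
   series of normalized Szego kernels at w_n one after the other, so that no
   partial sum loses the size of its last term at w_n. The product with psi then
   grows too fast along w_n to be in H^2. *)
Lemma H2_multiplier_bounded (psi : Cplx R -> Cplx R) :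
  (forall f fb, H2bv f fb -> exists k kb, H2bv k kb /\
     forall z, normc z < 1 -> psi z * f z = k z) ->
  exists M : R, forall z, normc z < 1 -> normc (psi z) <= M.
Proof.
move=> mult; apply: contrapT => unb.
(* Dividing by eps n makes psi outgrow the decay of the coefficients by a factor n. *)
have big (n : nat) : exists z, normc z < 1 /\ n%:R / eps R n < normc (psi z).
  apply: contrapT => nz; apply: unb; exists (n%:R / eps R n) => z z1.
  by rewrite leNgt; apply/negP => h; apply: nz; exists z.
have [w /all_and2[w1 wpsi]] := choice big.
pose b n : R := eps R n * Num.sqrt (1 - normc (w n)).
have b0 n : 0 <= b n by rewrite mulr_ge0 ?sqrtr_ge0// ltW// eps_gt0.
pose last n : Cplx R := (b n)%:C * szego (w n) (w n).
(* Since (x + l) + (l - x) = 2 l, one of x + l and x - l has modulus at least |l|. *)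
pose sg n (x : Cplx R) : R := if normc (last n) <= normc (x + last n) then 1 else - 1.
(* The n-th sign depends on the preceding partial sum at w n, so the partial sums are built by
   recursion first; [PE] identifies them with those of [term w c]. *)
pose P := fix P n : Cplx R -> Cplx R := if n is m.+1
  then (fun z => P m z + (sg m (P m (w m)) * b m)%:C * szego (w m) z) else (fun=> 0).
pose c n := sg n (P n (w n)) * b n.
have sg1 n x : `|sg n x| = 1 by rewrite /sg; case: ifP; rewrite ?normrN normr1.
have PE n z : psum (fun i => term w c i z) n = P n z.
  by rewrite /psum; elim: n => [|n IH]; rewrite ?big_ord0// big_ord_recr/= IH.
have cb n : `|c n| <= eps R n * Num.sqrt (1 - normc (w n)).
  by rewrite normrM sg1 mul1r ger0_norm.
have PS n : normc (last n) <= normc (P n.+1 (w n)).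
  have -> : P n.+1 (w n) = P n (w n) + (sg n (P n (w n)))%:C * last n.
    by rewrite /last mulrA -(rmorphM (real_complex R)).
  rewrite /sg; move: (P n (w n)) => x; case: ifPn => [h|]; first by rewrite rmorph1 mul1r.
  rewrite -ltNge => h; rewrite rmorphN rmorph1 mulN1r.
  have := le_normcD (x + last n) (last n - x).
  have -> : x + last n + (last n - x) = last n + last n by ring.
  have -> : normc (last n + last n) = normc (last n) + normc (last n).
    by rewrite -mulr2n normcMn mulr2n.
  by rewrite (normcB (last n)); lra.
have [f [fb [ffb fS]]] := szego_series w1 cb.
have [k [kb [kkb fk]]] := mult f fb ffb.
have [C C0 kC] := growth kkb.
(* 5/14 = 1/2 - 1/7: at w n the last term has modulus at least eps n / (2 s), as 1 - |w n|^2 <= 2 (1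
   - |w n|), and the later terms take away at most eps n / (7 s). Multiplied by psi this exceeds n
   (5/14) / s, while the growth bound is C / s. *)
have key n : n%:R * (5 / 14) <= C.
  pose s := Num.sqrt (1 - normc (w n)).
  have d0 : 0 < 1 - normc (w n) by rewrite subr_gt0.
  have s0 : 0 < s by rewrite sqrtr_gt0.
  have s2 : s ^+ 2 = 1 - normc (w n) by rewrite sqr_sqrtr// ltW.
  have e0 := @eps_gt0 R n.
  have lastE : eps R n / (2 * s) <= normc (last n).
    rewrite /last normcM normc_real ger0_norm// /szego mul1r normcV.
    rewrite (mulrC (conjc (w n))) mulc_conj -(rmorph1 (real_complex R)) -rmorphB normc_real.
    have n0 := normc_ge0 (w n).
    have dd : 0 < 1 - normc (w n) ^+ 2 by rewrite subr_gt0 expr_lt1.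
    rewrite gtr0_norm// ler_pdivrMr ?mulr_gt0// mulrAC ler_pdivlMr//.
    rewrite /b -/s -mulrA ler_wpM2l ?(ltW e0)//.
    have -> : s * (2 * s) = 2 * (1 - normc (w n)) by rewrite -s2; ring.
    by have := w1 n; rewrite expr2; nra.
  have := fS n.+1 (w n) (w1 n); rewrite (_ : psum _ n.+1 = P n.+1 (w n)); last exact: PE.
  have -> : 8 / 7 * eps R n.+1 / Num.sqrt (1 - normc (w n)) = eps R n / s / 7.
    by rewrite /eps exprS -/s; field; rewrite gt_eqF.
  move=> h1; have fn : 5 / 14 * (eps R n / s) <= normc (f (w n)).
    have := normc_sub_le (P n.+1 (w n)) (f (w n)); rewrite normcB.
    have E : eps R n / (2 * s) = eps R n / s / 2 by field; rewrite gt_eqF.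
    by have := PS n; rewrite E in lastE; lra.
  have := kC (w n) (w1 n); rewrite -(fk _ (w1 n)) normcM -/s ler_pdivlMr// => h2.
  apply: le_trans h2.
  have E : n%:R * (5 / 14) = (n%:R / eps R n) * (5 / 14 * (eps R n / s)) * s.
    by field; rewrite !gt_eqF.
  rewrite E ler_wpM2r ?(ltW s0)//; apply: ler_pM => //.
  - by rewrite divr_ge0// ltW.
  - by rewrite mulr_ge0// divr_ge0// ltW.
  - exact: ltW.
have := archi_boundP (_ : 0 <= C * (14 / 5)); rewrite mulr_ge0// => /(_ isT).
have := key (Num.bound (C * (14 / 5))); lra.
Qed.

End Multipliers.

Theorem theorem1p4 (R : realType) (a1 a2 : {poly Cplx R})
  (ha1 : circle_poly a1) (ha2 : circle_poly a2)
  (hinf : Hinf (fun z : Cplx R => a1.[z] / a2.[z])) :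
  multipliers (fun z => a1.[z]) (fun z => a2.[z]) =
  [set phi | range_space (fun z => a2.[z]) phi /\
             Hinf (fun z => a1.[z] / a2.[z] * phi z)].
Proof.
have [s1 us1 a1E] := circle_polyE ha1; have [s2 us2 a2E] := circle_polyE ha2.
have a20 z : normc z < 1 -> a2.[z] != 0.
  by move=> z1; rewrite a2E; exact: circle_prod_neq0.
have [H HE] : exists H, a1 = a2 * H.
  have [_ [M hM]] := hinf; rewrite a2E; apply: circle_prod_dvd => // zeta /us2 zeta1.
  (* A bounded quotient satisfies the weaker growth condition because sqrt(1 - r) <= 1. *)
  exists `|M| => r /andP[r0 r1]; rewrite -a2E.
  have n1 : normc (r%:C * zeta) < 1 by rewrite normc_radius.
  have := hM _ ((unit_discE _).2 n1); rewrite cnormE lecR => h; apply: (le_trans h).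
  apply: le_trans (ler_norm _) _; rewrite ler_pdivlMr ?sqrtr_gt0 ?subr_gt0//.
  rewrite ler_piMr// -[leRHS]sqrtr1 ler_sqrt//; lra.
have hE z : normc z < 1 -> a1.[z] / a2.[z] = H.[z].
  by move=> z1; rewrite HE hornerM mulrC mulKf// a20.
apply/seteqP; split=> phi /=.
- move=> [aphi mphi].
  have rphi : range_space (fun z => a2.[z]) phi.
    have <- : (fun z => phi z * 1) = phi by apply/funext => z; rewrite mulr1.
    apply: (mphi (fun=> 1)); rewrite a1E; apply/range_spaceP => //.
    exists (fun z => (0 : {poly Cplx R}).[z]), (fun z => (0 : {poly Cplx R}).[z]), 1.
    split; first exact: H2bv_poly.
    by move=> z z1; rewrite !hornerE ?mulr0 ?add0r.
  split; first exact: rphi.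
  move: (rphi); rewrite a2E => /range_spaceP[//|k0 [kb0 [p0 [kk0]]]]; rewrite -a2E => phiE.
  have [M HM] : exists M : R, forall z, normc z < 1 -> normc (H.[z] * phi z) <= M.
    apply: H2_multiplier_bounded => f fb ff.
    have : range_space (fun z => a2.[z]) (fun z => phi z * (a1.[z] * f z)).
      apply: mphi; rewrite a1E; apply/range_spaceP => //.
      by exists f, fb, 0; split; [exact: ff|move=> z z1; rewrite horner0 addr0].
    rewrite a2E => /range_spaceP[//|k1 [kb1 [p [kk1]]]]; rewrite -a2E => E1.
    have E2 z : normc z < 1 -> H.[z] * phi z * f z = k1 z + p.[z] / a2.[z].
      move=> z1; apply: (mulfI (a20 z z1)).
      rewrite mulrDr [a2.[z] * (p.[z] / _)]mulrC mulfVK ?a20// -E1// HE hornerM; ring.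
    have [q pE] : exists q, p = a2 * q.
      rewrite a2E; apply: circle_prod_dvd => // zeta zs; have zeta1 := us2 _ zs; rewrite -a2E.
      have [C0 C00 gk0] := growth kk0; have [Cf Cf0 gf] := growth ff; have [C1 C10 g1] := growth kk1.
      have [D hD] := poly_bound (H * p0).
      have D0 : 0 <= D by apply: le_trans (hD 0 _); rewrite ?normc_ge0 ?normc0.
      (* One zero of a1 at zeta, inherited from a2, suffices: its factor 1 - r = s^2 offsets the two
         factors 1 / s from the growth of k0 and f. *)
      have [b bE] : exists b, a1 = b * ('X - zeta%:P).
        apply/factor_theorem; rewrite /root HE hornerM a2E horner_prod.
        by rewrite (big_rem zeta)//= !hornerE subrr !mul0r.
      have [B bB] := poly_bound b.
      have B0 : 0 <= B by apply: le_trans (bB 0 _); rewrite ?normc_ge0 ?normc0.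
      (* One summand for each of a1 k0 f, H p0 f and k1. The first is even bounded, and is divided
         by s <= 1 to match the others. *)
      exists (B * (C0 * Cf) + D * Cf + C1) => r /andP[r0 r1].
      pose v : Cplx R := r%:C * zeta; have vr : normc v = r by rewrite normc_radius.
      have v1 : normc v < 1 by rewrite vr.
      pose s := Num.sqrt (1 - r).
      have s0 : 0 < s by rewrite sqrtr_gt0 subr_gt0.
      have ss : s ^+ 2 = 1 - r by rewrite sqr_sqrtr// subr_ge0 ltW.
      have s1' : s <= 1 by rewrite -[leRHS]sqrtr1 ler_sqrt//; lra.
      (* [E2] solved for p / a2, with H phi expanded as a1 k0 + H p0. *)
      have Ev : p.[v] / a2.[v] = a1.[v] * (k0 v * f v) + (H * p0).[v] * f v - k1 v.
        have -> : p.[v] / a2.[v] = H.[v] * phi v * f v - k1 v.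
          by rewrite E2// addrAC subrr add0r.
        rewrite phiE// HE !hornerM; ring.
      have gk0v := gk0 v v1; have gfv := gf v v1; have g1v := g1 v v1.
      rewrite vr -/s in gk0v gfv g1v.
      have t1 : normc (a1.[v] * (k0 v * f v)) <= B * (C0 * Cf).
        rewrite bE hornerM hornerXsubC !normcM normc_radial_sub//.
        apply: (@le_trans _ _ (B * s ^+ 2 * (C0 / s * (Cf / s)))); last first.
          by rewrite le_eqVlt; apply/orP; left; apply/eqP; field; rewrite gt_eqF.
        rewrite ss; apply: ler_pM; rewrite ?mulr_ge0 ?normc_ge0 ?subr_ge0 ?(ltW r1)//.
          by rewrite ler_wpM2r ?subr_ge0 ?(ltW r1)// bB// ltW.
        by apply: ler_pM; rewrite ?normc_ge0.
      have t2 : normc ((H * p0).[v] * f v) <= D * (Cf / s).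
        by rewrite normcM; apply: ler_pM; rewrite ?normc_ge0// hD// ltW.
      rewrite Ev !mulrDl.
      have h1 := le_normcD (a1.[v] * (k0 v * f v) + (H * p0).[v] * f v) (- k1 v).
      have h2 := le_normcD (a1.[v] * (k0 v * f v)) ((H * p0).[v] * f v).
      have t3 : B * (C0 * Cf) <= B * (C0 * Cf) / s.
        by rewrite ler_pdivlMr// ler_piMr// !mulr_ge0.
      by move: h1 t2; rewrite normcN (mulrA D); lra.
    exists (fun z => k1 z + q.[z]), (fun z => kb1 z + q.[z]); split.
      by apply: H2bvD; [exact: kk1|exact: H2bv_poly].
    by move=> z z1; rewrite E2// pE hornerM mulrC mulKf// a20.
  split.
    apply: (@analytic_eq _ (fun z => H.[z] * phi z)); last by move=> z z1; rewrite hE.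
    by apply: analyticM; [exact: poly_analytic|exact: aphi].
  by exists M => z /unit_discE z1; rewrite cnormE lecR hE//; exact: HM.
- move=> [rphi [_ [M hM]]].
  move: (rphi); rewrite a2E => /range_spaceP[//|k0 [kb0 [p0 [kk0]]]]; rewrite -a2E => phiE.
  (* This supplies phi, and then H phi, with an explicit boundary function, which the product of the
     bounded function H phi with k requires. *)
  have pphi : H2bv phi (fun z => a2.[z] * kb0 z + p0.[z]).
    apply: (@H2bv_eq _ (fun z => a2.[z] * k0 z + p0.[z])); last by move=> z z1; rewrite phiE.
    by apply: H2bvD; [exact: H2bv_polyM|exact: H2bv_poly].
  split; first exact: pphi.1.1.
  move=> f; rewrite a1E => /range_spaceP[//|k [kb [q [kk]]]]; rewrite -a1E => fE.
  have [[apsi _] bpsi] := H2bv_polyM H pphi.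
  have psiM z : normc z < 1 -> normc (H.[z] * phi z) <= M.
    by move=> z1; have := hM _ ((unit_discE _).2 z1); rewrite cnormE lecR hE.
  have Kk := H2bvD (H2bvM_bounded apsi bpsi psiM kk) (H2bv_polyM q kk0).
  rewrite a2E; apply/range_spaceP => //; rewrite -a2E.
  do 2 eexists; exists (p0 * q); split; first exact: Kk.
  by move=> z z1; rewrite fE// HE !hornerM mulrDr [in phi z * q.[z]]phiE//; ring.
Qed.
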